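(* Let $\Phi$ be an isometry of the Poincaré disk. For all $\varphi,\psi\in C_c^\infty(\mathbb{D})$, the functions $\varphi\circ\Phi$ and $\psi\circ\Phi$ belong to $C_c^\infty(\mathbb{D})$ and $$\langle\varphi\circ\Phi,\psi\circ\Phi\rangle=\langle\varphi,\psi\rangle .$$ Thus the map $\Phi^*:\varphi\mapsto\varphi\circ\Phi$ is a linear isometry of $C_c^\infty(\mathbb{D})$ equipped with $\langle\cdot,\cdot\rangle$; it extends by density to a linear isometry $\Phi^*$ of $H_0^1(\mathbb{D})$, and $\Phi^*(u)=u\circ\Phi$ for every $u\in H_0^1(\mathbb{D})$.
   Context: $\mathbb{D}=\{z\in\mathbb{C}: |z|<1\}$; all vector spaces and functions are real. The hyperbolic metric on $\mathbb{D}$ is $g^{\mathbf h}_z(u,v)=(1-|z|^2)^{-2}\,g_z(u,v)$, where $g$ is the Euclidean metric. An isometry of the Poincaré disk is a $C^\infty$-diffeomorphism $\Phi:\mathbb{D}\to\mathbb{D}$ preserving $g^{\mathbf h}$, i.e. $g^{\mathbf h}_{\Phi(z)}(T_z\Phi(u),T_z\Phi(v))=g^{\mathbf h}_z(u,v)$ for all $z\in\mathbb{D}$ and $u,v\in T_z\mathbb{D}$ (it may preserve or reverse orientation). $C_c^\infty(\mathbb{D})$ is the space of $C^\infty$ functions on $\mathbb{D}$ with compact support in $\mathbb{D}$. $H_0^1(\mathbb{D})$ is the closure of $C_c^\infty(\mathbb{D})$ in the Sobolev space $H^1(\mathbb{D})$ (Euclidean Lebesgue measure), regarded as a Hilbert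 space with the inner product $\langle u,v\rangle=\frac{1}{2\pi}\int_{\mathbb{D}}\nabla u\cdot\nabla v\,dx\,dy$ (Euclidean gradients). Elements of $H_0^1(\mathbb{D})$ are identified when equal almost everywhere. *)

(* Defs.v *)
From HB Require Import structures.
From mathcomp Require Import all_boot all_order all_algebra.
From mathcomp Require Import all_classical all_reals all_analysis.

Set Implicit Arguments.
Unset Strict Implicit.
Unset Printing Implicit Defensive.

Import Order.TTheory GRing.Theory Num.Theory.
Import numFieldNormedType.Exports.

Local Open Scope classical_set_scope.
Local Open Scope ring_scope.

(* The plane is R * R.  Its library norm is the max norm, so the Euclidean
   metric is written out.  Functions and maps on the disk are total functions
   on the plane whose values outside the disk are irrelevant: every definition
   below depends only on the values on the (open) disk. *)

Definition dot (R : realType) (u v : R * R) : R := u.1 * v.1 + u.2 * v.2.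

Definition disk (R : realType) : set (R * R) := [set z | dot z z < 1].
Arguments disk R : clear implicits.

(* C^k on an open set U: f is C^(k+1) when it is differentiable on U and all
   the functions z |-> 'd f z v are C^k; in finite dimension this says that
   the differential of f is C^k. *)
Fixpoint Ck_on (R : realType) (V W : normedModType R) (k : nat) (U : set V)
    (f : V -> W) : Prop :=
  if k is k'.+1 then
    (forall z, U z -> differentiable f z) /\
    (forall v, Ck_on k' U (fun z => 'd f z v))
  else forall z, U z -> {for z, continuous f}.

Definition smooth_on (R : realType) (V W : normedModType R) (U : set V)
    (f : V -> W) : Prop :=
  forall k, Ck_on k U f.

Definition disk_diffeo (R : realType) (Phi : R * R -> R * R) : Prop :=
  [/\ forall z, disk R z -> disk R (Phi z),
      smooth_on (disk R) Phi &
      exists Psi : R * R -> R * R,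
        [/\ forall z, disk R z -> disk R (Psi z),
            smooth_on (disk R) Psi,
            forall z, disk R z -> Psi (Phi z) = z &
            forall z, disk R z -> Phi (Psi z) = z]].

Definition hyp_metric (R : realType) (z u v : R * R) : R :=
  (1 - dot z z) ^- 2 * dot u v.

Definition poincare_isometry (R : realType) (Phi : R * R -> R * R) : Prop :=
  disk_diffeo Phi /\
  forall z u v, disk R z ->
    hyp_metric (Phi z) ('d Phi z u) ('d Phi z v) = hyp_metric z u v.

(* the support, taken relative to the disk *)
Definition disk_support (R : realType) (phi : R * R -> R) : set (R * R) :=
  disk R `&` closure [set z | disk R z /\ phi z != 0].

Definition Cc_infty (R : realType) (phi : R * R -> R) : Prop :=
  smooth_on (disk R) phi /\ compact (disk_support phi).

(* the plane with its Borel sigma-algebra and Lebesgue measure *)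
Definition plane (R : realType) : measurableType _ :=
  (measurableTypeR R * measurableTypeR R)%type.

Definition leb2 (R : realType) : {measure set (plane R) -> \bar R} :=
  (@lebesgue_measure R \x @lebesgue_measure R)%E.
Arguments leb2 R : clear implicits.

Definition diskint (R : realType) (f : R * R -> R) : R :=
  (\int[leb2 R]_(z in disk R) f z)%R.

Definition eq_on_disk (R : realType) (u v : R * R -> R) : Prop :=
  forall z, disk R z -> u z = v z.

Definition ae_eq_on_disk (R : realType) (u v : R * R -> R) : Prop :=
  ae_eq (leb2 R) (disk R) u v.

(* Measurability is with respect to the Borel sets of the plane; every
   Lebesgue measurable function is almost everywhere equal to such a u. *)
Definition L2_disk (R : realType) (u : R * R -> R) : Prop :=
  measurable_fun (disk R : set (plane R)) (u : plane R -> R) /\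
  (leb2 R).-integrable (disk R) (EFin \o (fun z => u z ^+ 2)).

Definition e_x (R : realType) : R * R := (1, 0).
Definition e_y (R : realType) : R * R := (0, 1).
Arguments e_x R : clear implicits.
Arguments e_y R : clear implicits.

Definition is_weak_derive (R : realType) (e : R * R) (u v : R * R -> R) : Prop :=
  forall phi, Cc_infty phi ->
    diskint (fun z => u z * 'd phi z e) = - diskint (fun z => v z * phi z).

Definition has_L2_derive (R : realType) (e : R * R) (u : R * R -> R) : Prop :=
  exists v, L2_disk v /\ is_weak_derive e u v.

(* a representative of the weak derivative, which is unique up to almost
   everywhere equality on the disk when it exists *)
Definition weak_derive (R : realType) (e : R * R) (u : R * R -> R) :
    R * R -> R :=
  xget (fun=> 0) [set v | L2_disk v /\ is_weak_derive e u v].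

Definition weak_grad (R : realType) (u : R * R -> R) (z : R * R) : R * R :=
  (weak_derive (e_x R) u z, weak_derive (e_y R) u z).

Definition grad (R : realType) (phi : R * R -> R) (z : R * R) : R * R :=
  ('d phi z (e_x R), 'd phi z (e_y R)).

Definition H1 (R : realType) (u : R * R -> R) : Prop :=
  [/\ L2_disk u, has_L2_derive (e_x R) u & has_L2_derive (e_y R) u].

Definition H1_norm (R : realType) (u : R * R -> R) : R :=
  Num.sqrt (diskint (fun z => u z ^+ 2 + dot (weak_grad u z) (weak_grad u z))).

Definition H10 (R : realType) (u : R * R -> R) : Prop :=
  H1 u /\
  forall eps : R, 0 < eps -> exists phi, Cc_infty phi /\ H1_norm (u \- phi) < eps.

(* <u, v> on H10, through weak gradients, and on Cc_infty, through classical
   gradients; they agree on Cc_infty. *)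
Definition dirichlet_weak (R : realType) (u v : R * R -> R) : R :=
  (2 * pi)^-1 * diskint (fun z => dot (weak_grad u z) (weak_grad v z)).

Definition dirichlet (R : realType) (phi psi : R * R -> R) : R :=
  (2 * pi)^-1 * diskint (fun z => dot (grad phi z) (grad psi z)).

(* T induces a linear isometry of the vector space of functions satisfying S,
   taken modulo the equivalence eqv, for the inner product ip. *)
Definition linear_isometry (R : realType) (X : Type)
    (S : (X -> R) -> Prop) (eqv : (X -> R) -> (X -> R) -> Prop)
    (ip : (X -> R) -> (X -> R) -> R) (T : (X -> R) -> (X -> R)) : Prop :=
  [/\ forall u, S u -> S (T u),
      forall u v, S u -> S v -> eqv u v -> eqv (T u) (T v),
      forall a u v, S u -> S v -> eqv (T (a \*o u \+ v)) (a \*o T u \+ T v) &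
      forall u v, S u -> S v -> ip (T u) (T v) = ip u v].

(* T induces a linear isometry of the Hilbert space H10 that coincides with
   phi |-> phi \o Phi on the subspace Cc_infty. *)
Definition isometric_extension (R : realType) (Phi : R * R -> R * R)
    (T : (R * R -> R) -> (R * R -> R)) : Prop :=
  linear_isometry (@H10 R) (@ae_eq_on_disk R) (@dirichlet_weak R) T /\
  forall phi, Cc_infty phi -> ae_eq_on_disk (T phi) (phi \o Phi).

(* Main.v *)
(* An isometry Phi of the hyperbolic metric is conformal: 'd Phi z is lam z times
   an orthogonal map, with lam z = (1 - |Phi z|^2) / (1 - |z|^2).  Hence the
   Jacobian of Phi is lam^2 and |grad (phi o Phi)|^2 = lam^2 |grad phi|^2 o Phi,
   so that the Dirichlet integral is invariant by change of variables.  Along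
   rays, a differential inequality for 1 - |Phi|^2 bounds lam below by a positive
   constant, so composition with Phi is bounded on L2 and the chain rule for weak
   gradients passes from Cc_infty to H10 by density.  Poincare's inequality turns
   convergence in the Dirichlet norm into convergence in L2, which identifies
   every isometric extension with u |-> u o Phi.

   For the change of variables, the measures A |-> |Phi A| and
   A |-> int_A |det 'd Phi| differ by o(r^2) on the rectangles of side r around a
   point where Phi is differentiable; repeated bisection of a rectangle on which
   they differed would contradict this. *)
Require Import Defs.
From HB Require Import structures.
From mathcomp Require Import all_boot all_order all_algebra.
From mathcomp Require Import ring lra.
From mathcomp Require Import all_classical all_reals all_analysis.
From mathcomp Require Import measurable_realfun.

Set Implicit Arguments.
Unset Strict Implicit.
Unset Printing Implicit Defensive.

Import Order.TTheory GRing.Theory Num.Theory.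
Import numFieldNormedType.Exports.

Local Open Scope classical_set_scope.
Local Open Scope ring_scope.

(** The Dirichlet integral is conformally invariant, but the L2 part of the H1 norm is not, and this
    shapes the proof. The integral of (u o Phi)^2 equals that of (u^2 o Phi) lam^2 / lam^2, hence is
    at most c^-1 times the integral of u^2, where c is the square of the lower bound of lam. That
    bound is drawn from the metric identity alone: Cauchy-Schwarz controls the derivative of |Phi|^2
    along a ray by lam, that is, by 1 - |Phi|^2 itself. In the weak chain rule the test function
    stays fixed and only u is approximated: the defect of the defining identity is linear in u,
    bounded by the H1 norm, and zero on [Cc_infty]. Since [weak_grad] is a representative obtained
    by choice, weak gradients must be known to be unique before any inner product can be computed.
    The fundamental lemma behind this uniqueness and the change of variables end in the same way:
    two measures that agree on rectangles agree on the Borel subsets of an open set. *)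

(** * Borel sets of the plane and the disk *)

Lemma plane_ballP (R : realType) (U : set (R * R)) (z : R * R) :
  nbhs z U <-> exists2 e : R, 0 < e & forall w : R * R,
    `|w.1 - z.1| < e -> `|w.2 - z.2| < e -> U w.
Proof.
split.
  move=> /nbhs_ballP[e /= e0 he]; exists e => // w w1 w2; apply: he.
  by split; rewrite -ball_normE /ball_/= distrC.
move=> [e e0 he]; apply/nbhs_ballP; exists e => //= w [].
by rewrite -!ball_normE /ball_/= => w1 w2; apply: he; rewrite distrC.
Qed.

(** An open set is the union of the boxes with rational endpoints that it contains. [C] replaces the
    other boxes by the empty set, so that the union runs over a whole countable type. *)
Lemma open_measurable_plane (R : realType) (U : set (R * R)) :
  open U -> measurable (U : set (plane R)).
Proof.
move=> oU.
pose B (q : (rat * rat) * (rat * rat)) : set (plane R) :=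
  `]ratr q.1.1, ratr q.1.2[%classic `*` `]ratr q.2.1, ratr q.2.2[%classic.
pose C q := if `[< B q `<=` U >] then B q else set0.
rewrite (_ : U = \bigcup_q C q); last first.
  apply/seteqP; split; last first.
    by move=> z [q _]; rewrite /C; case: asboolP => // BU /BU.
  move=> z Uz.
  have /plane_ballP[e e0 he] : nbhs z U by apply: open_nbhs_nbhs.
  have [a1] : exists q : rat, z.1 - e < ratr q < z.1.
    by have [|q] := @rat_in_itvoo R (z.1 - e) z.1; rewrite ?ltrBlDr ?ltrDl// in_itv/=; exists q.
  have [b1] : exists q : rat, z.1 < ratr q < z.1 + e.
    by have [|q] := @rat_in_itvoo R z.1 (z.1 + e); rewrite ?ltrDl// in_itv/=; exists q.
  have [a2] : exists q : rat, z.2 - e < ratr q < z.2.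
    by have [|q] := @rat_in_itvoo R (z.2 - e) z.2; rewrite ?ltrBlDr ?ltrDl// in_itv/=; exists q.
  have [b2] : exists q : rat, z.2 < ratr q < z.2 + e.
    by have [|q] := @rat_in_itvoo R z.2 (z.2 + e); rewrite ?ltrDl// in_itv/=; exists q.
  move=> /andP[? ?] /andP[? ?] /andP[? ?] /andP[? ?].
  exists ((a1, b1), (a2, b2)) => //; rewrite /C; case: asboolP; last first.
    case=> w []/=; rewrite !in_itv/= => /andP[? ?] /andP[? ?].
    by apply: he; rewrite ltr_distl; lra.
  by move=> _; split; rewrite /= in_itv/=; apply/andP; split.
apply: (@countable_bigcupT_measurable _ (plane R)) => [|q]; first exact: countableP.
rewrite /C; case: ifP => // _; apply: measurableX; exact: measurable_itv.
Qed.

Section DotDisk.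
Context {R : realType}.
Implicit Types u v z : R * R.

Lemma dot_ge0 u : 0 <= dot u u.
Proof. by rewrite /dot -!expr2 addr_ge0// sqr_ge0. Qed.

Lemma dot_CS u v : dot u v ^+ 2 <= dot u u * dot v v.
Proof.
rewrite -subr_ge0 (_ : _ - _ = (u.1 * v.2 - u.2 * v.1) ^+ 2) ?sqr_ge0//.
by rewrite /dot; ring.
Qed.

Lemma continuous_dot (z : R * R) : {for z, continuous (fun w : R * R => dot w w)}.
Proof.
have c1 : {for z, continuous (fun w : R * R => w.1)} by exact: cvg_fst.
have c2 : {for z, continuous (fun w : R * R => w.2)} by exact: cvg_snd.
by apply: cvgD; apply: cvgM.
Qed.

Lemma open_disk : open (disk R).
Proof.
rewrite /disk -/([set z | (fun w : R * R => dot w w) z < 1]).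
apply: (@open_comp _ _ (fun w : R * R => dot w w) [set x | x < 1]).
  by move=> z _; exact: continuous_dot.
exact: open_lt.
Qed.

Lemma measurable_disk : measurable (disk R : set (plane R)).
Proof. by apply: open_measurable_plane; exact: open_disk. Qed.

Lemma disk_nbhs z : disk R z -> nbhs z (disk R).
Proof. by move=> ?; apply: open_nbhs_nbhs; split => //; exact: open_disk. Qed.

Lemma disk_coord z : disk R z -> `|z.1| < 1 /\ `|z.2| < 1.
Proof.
rewrite /disk/= /dot -!expr2 => h.
by split; rewrite -(@ltr_pXn2r _ 2)// ?nnegrE// expr1n real_normK ?num_real//;
  apply: le_lt_trans h; rewrite ?lerDl ?lerDr sqr_ge0.
Qed.

Lemma measurable_fun_continuous_on (D : set (R * R)) (f : R * R -> R) :
  open D -> (forall z, D z -> {for z, continuous f}) ->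
  measurable_fun (D : set (plane R)) (f : plane R -> R).
Proof.
move=> oD cf; have mD := open_measurable_plane oD.
apply: (measurability _ (RGenOpens.measurableE R)).
move=> _ [_ [a [b ->] <-]]; apply: open_measurable_plane.
rewrite openE => z [Dz fz]; apply: filterI.
  by apply: open_nbhs_nbhs.
apply: cf => //; apply: open_nbhs_nbhs; split => //.
Qed.

Lemma leb2X (A B : set R) : measurable A -> measurable B ->
  leb2 R (A `*` B) = (lebesgue_measure A * lebesgue_measure B)%E.
Proof. by move=> mA mB; rewrite /leb2/= product_measure1E. Qed.

Lemma leb2_disk_fin : (leb2 R (disk R) < +oo)%E.
Proof.
apply: (@le_lt_trans _ _ (leb2 R (`[-1, 1]%classic `*` `[-1, 1]%classic))).
  apply: le_measure; rewrite ?inE.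
  - exact: measurable_disk.
  - by apply: measurableX; exact: measurable_itv.
  - by move=> z /disk_coord; rewrite !ltr_norml => -[? ?]; split; rewrite /= in_itv/=; lra.
rewrite leb2X//.
by rewrite /= lebesgue_measure_itv/= lte_fin; case: ifP => _; rewrite -?EFinB -?EFinM ?mule0 ltry.
Qed.

End DotDisk.

(** * Change of variables in the plane *)

(* The measure structure that Hierarchy Builder generates on [pushforward]. *)
Local Notation pushm := measure_function_pushforward__canonical__measure_function_Measure.

(** * Lebesgue measure under affine maps *)

Section AffineChange.
Context {R : realType}.
Local Notation mu := (@lebesgue_measure R).

Let aff (a b : R) (x : measurableTypeR R) : measurableTypeR R := a * x + b.

Let measurable_aff a b : measurable_fun setT (aff a b).
Proof. by apply: measurable_funD => //; exact: measurable_funM. Qed.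

(** Lebesgue measure is determined by its values on the intervals []c, d]], and there the scaled
    pushforward agrees with it. For negative [a] the preimage is closed on the left and open on the
    right, which does not change its length. *)
Lemma lebesgue_measure_affine (a b : R) (A : set R) : a != 0 -> measurable A ->
  (mu A = `|a|%:E * pushforward mu (aff a b) A)%E.
Proof.
move=> a0 mA.
rewrite -[RHS]/(mscale (NngNum (normr_ge0 a)) (pushm mu (measurable_aff a b)) A).
apply: lebesgue_measure_unique => // _ [[c d]] _ <-.
transitivity (`|a|%:E * mu (aff a b @^-1` `]c, d]%classic))%E; last by [].
have [a_gt0|a_le0] := ltP 0 a.
  rewrite (_ : _ @^-1` _ = `](c - b) / a, (d - b) / a]%classic); last first.
    apply/seteqP; split => x /=; rewrite !in_itv/= /aff;
      by rewrite ltr_pdivrMr// ler_pdivlMr// ltrBlDr lerBrDr mulrC.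
  rewrite !lebesgue_measure_itv/= !lte_fin ltr_pM2r ?invr_gt0// ltrD2r.
  case: ifP => _; last by rewrite mule0.
  by rewrite -!EFinB -EFinM (gtr0_norm a_gt0); congr EFin; field.
have a_lt0 : a < 0 by rewrite lt_neqAle a0.
rewrite (_ : _ @^-1` _ = `[(d - b) / a, (c - b) / a[%classic); last first.
  apply/seteqP; split => x /=; rewrite !in_itv/= /aff;
    by rewrite ltr_ndivlMr// ler_ndivrMr// ltrBlDr lerBrDr mulrC andbC.
rewrite !lebesgue_measure_itv/= !lte_fin ltr_nM2r ?invr_lt0// ltrD2r.
case: ifP => _; last by rewrite mule0.
by rewrite -!EFinB -EFinM (ltr0_norm a_lt0); congr EFin; field.
Qed.

Lemma ge0_integral_affine (a b : R) (f : R -> \bar R) : a != 0 ->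
  measurable_fun setT f -> (forall x, (0 <= f x)%E) ->
  (\int[mu]_x f (a * x + b)%R = `|a|^-1%:E * \int[mu]_x f x)%E.
Proof.
move=> a0 mf f0.
have -> : (\int[mu]_x f x =
    \int[mscale (NngNum (normr_ge0 a)) (pushm mu (measurable_aff a b))]_x f x)%E.
  by apply: eq_measure_integral => A mA _; exact: lebesgue_measure_affine.
rewrite ge0_integral_mscale//= ge0_integral_pushforward//.
rewrite muleA -EFinM mulVf ?normr_eq0// mul1e preimage_setT.
by apply: eq_integral.
Qed.

Lemma measurable_linear2 (a b s : R) :
  measurable_fun setT (fun z : plane R => a * z.1 + b * z.2 + s).
Proof.
by apply: measurable_funD => //; apply: measurable_funD; apply: measurable_funM.
Qed.

Lemma measurable_affine2 (a b c d s t : R) : measurable_fun setT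
  (fun z : plane R => (a * z.1 + b * z.2 + s, c * z.1 + d * z.2 + t) : plane R).
Proof. by apply: measurable_fun_pair; exact: measurable_linear2. Qed.

Section Tonelli.
Variable f : plane R -> \bar R.
Hypotheses (mf : measurable_fun setT f) (f0 : forall z, (0 <= f z)%E).

Lemma tonelli_xy :
  (\int[leb2 R]_z f z = \int[mu]_x \int[mu]_y f (x, y))%E.
Proof. exact: fubini_tonelli1. Qed.

Lemma tonelli_yx :
  (\int[leb2 R]_z f z = \int[mu]_y \int[mu]_x f (x, y))%E.
Proof. by rewrite tonelli_xy; exact: fubini_tonelli. Qed.

Lemma measurable_int_y : measurable_fun setT (fun x => \int[mu]_y f (x, y))%E.
Proof. exact: measurable_fun_fubini_tonelli_F. Qed.

Lemma measurable_int_x : measurable_fun setT (fun y => \int[mu]_x f (x, y))%E.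
Proof. exact: measurable_fun_fubini_tonelli_G. Qed.

Lemma measurable_slice_y (x : R) : measurable_fun setT (fun y : measurableTypeR R => f (x, y)).
Proof. exact: measurableT_comp. Qed.

Lemma measurable_slice_x (y : R) : measurable_fun setT (fun x : measurableTypeR R => f (x, y)).
Proof. exact: measurableT_comp. Qed.

End Tonelli.

(** Tonelli reduces the formula to one affine substitution in each variable. For [a != 0] the
    substitution in x has slope a, and the one in y then has slope (a d - b c) / a. For [a = 0] the
    coordinates are exchanged, and the slopes are c and b. *)
Lemma ge0_integral_affine2 (a b c d s t : R) (f : plane R -> \bar R) :
  a * d - b * c != 0 ->
  measurable_fun setT f -> (forall z, (0 <= f z)%E) ->
  (\int[leb2 R]_z f (a * z.1 + b * z.2 + s, c * z.1 + d * z.2 + t)%R =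
    `|a * d - b * c|^-1%:E * \int[leb2 R]_z f z)%E.
Proof.
move=> D0 mf f0.
have mg u v w u' v' w' : measurable_fun setT (fun z : plane R =>
   f (u * z.1 + v * z.2 + w, u' * z.1 + v' * z.2 + w')).
  apply: (@measurableT_comp _ _ _ _ _ _ f) => //.
  exact: measurable_affine2.
rewrite (tonelli_yx (mg a b s c d t))//=.
have [a0|a0] := eqVneq a 0; last first.
  (* [g] is [f] after elimination of x: with X = a x + b y + s, the second coordinate c x + d y + t
     is an affine function of X and y. *)
  pose g (z : plane R) :=
    f (1 * z.1 + 0 * z.2 + 0, c / a * z.1 + (a * d - b * c) / a * z.2 + (t - c / a * s)).
  have mg' : measurable_fun setT g by exact: mg.
  have g0 z : (0 <= g z)%E by exact: f0.
  have -> : (\int[mu]_y \int[mu]_x f (a * x + b * y + s, c * x + d * y + t)%R =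
             \int[mu]_y (`|a|^-1%:E * \int[mu]_x g (x, y)))%E.
    apply: eq_integral => y _.
    rewrite -(@ge0_integral_affine a (b * y + s) (fun x => g (x, y)))//.
      apply: eq_integral => x _; rewrite /g/=; congr f; congr pair; first by ring.
      by field.
    - by apply: measurable_slice_x; exact: mg.
  rewrite (ge0_integralZl mu measurableT (measurable_int_x mg' g0))//; first last.
  - by move=> y _; exact: integral_ge0.
  rewrite -tonelli_yx// tonelli_xy//.
  have -> : (\int[mu]_x \int[mu]_y g (x, y) =
      \int[mu]_x (`|(a * d - b * c) / a|^-1%:E * \int[mu]_y f (x, y)))%E.
    apply: eq_integral => x _.
    rewrite -(@ge0_integral_affine ((a * d - b * c) / a) (c / a * x + (t - c / a * s))
      (fun y => f (x, y)))//.
    - apply: eq_integral => y _; rewrite /g/=; congr f; congr pair; by ring.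
    - by rewrite mulf_neq0// invr_neq0.
    - exact: measurable_slice_y.
  rewrite (ge0_integralZl mu measurableT (measurable_int_y mf f0))//; first last.
  - by move=> y _; exact: integral_ge0.
  rewrite -tonelli_xy// muleA -EFinM; congr (_%:E * _)%E.
  by rewrite normrM normfV; field; rewrite !normr_eq0 a0 D0.
have [b0 c0] : b != 0 /\ c != 0.
  by apply/andP; move: D0; rewrite a0 mul0r sub0r oppr_eq0 mulf_eq0 negb_or.
have -> : (\int[mu]_y \int[mu]_x f (a * x + b * y + s, c * x + d * y + t)%R =
           \int[mu]_y (`|c|^-1%:E * \int[mu]_x f (b * y + s, x)%R))%E.
  apply: eq_integral => y _.
  rewrite -(@ge0_integral_affine c (d * y + t) (fun x => f (b * y + s, x)))//.
  - by apply: eq_integral => x _; rewrite a0; congr f; congr pair; ring.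
  - exact: measurable_slice_y.
have mfy := measurable_int_y mf f0.
have mfyb : measurable_fun setT (fun y : measurableTypeR R => \int[mu]_x f (b * y + s, x)%R)%E.
  apply: (@measurableT_comp _ _ _ _ _ _ (fun u => \int[mu]_x f (u, x))%E) => //.
  by apply: measurable_funD => //; exact: measurable_funM.
rewrite (ge0_integralZl mu measurableT mfyb)//; first last.
- by move=> y _; exact: integral_ge0.
rewrite (@ge0_integral_affine b s (fun u => \int[mu]_x f (u, x))%E)//; last first.
  by move=> y; exact: integral_ge0.
rewrite -tonelli_xy// muleA -EFinM; congr (_%:E * _)%E.
by rewrite a0 mul0r sub0r normrN normrM invfM mulrC.
Qed.

Lemma leb2_affine_preimage (a b c d s t : R) (A : set (plane R)) :
  a * d - b * c != 0 -> measurable A ->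
  (leb2 R [set z | A (a * z.1 + b * z.2 + s, c * z.1 + d * z.2 + t)%R] =
    `|a * d - b * c|^-1%:E * leb2 R A)%E.
Proof.
move=> D0 mA.
have mB : measurable [set z : plane R | A (a * z.1 + b * z.2 + s, c * z.1 + d * z.2 + t)].
  by rewrite -[X in measurable X]setTI; exact: measurable_affine2.
rewrite -[A in RHS]setIT -[X in leb2 R X]setIT -!integral_indic//.
rewrite -(ge0_integral_affine2 s t)//; last by apply/measurable_EFinP; exact: measurable_indic.
Qed.
End AffineChange.

(** * Half-open rectangles and uniqueness of measures *)

Section Rectangles.
Context {R : realType}.

(** Half-open, so as to be stable under intersection and tiled exactly by quarters: the same sets
    serve as a generating family closed under intersection and as the pieces of the bisection. *)
Definition rect (a b c d : R) : set (R * R) := `]a, b]%classic `*` `]c, d]%classic.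

Definition crect (a b c d : R) : set (R * R) := `[a, b]%classic `*` `[c, d]%classic.

Lemma rectE (a b c d : R) z : rect a b c d z <-> [/\ a < z.1, z.1 <= b, c < z.2 & z.2 <= d].
Proof.
rewrite /rect; split=> [[]/=|[]]; rewrite ?in_itv/=.
  by move=> /andP[-> ->] /andP[-> ->].
by move=> *; split; rewrite /= in_itv/=; apply/andP.
Qed.

Lemma crectE (a b c d : R) z :
  crect a b c d z <-> [/\ a <= z.1, z.1 <= b, c <= z.2 & z.2 <= d].
Proof.
rewrite /crect; split=> [[]/=|[]]; rewrite ?in_itv/=.
  by move=> /andP[-> ->] /andP[-> ->].
by move=> *; split; rewrite /= in_itv/=; apply/andP.
Qed.

Lemma rect_crect a b c d : rect a b c d `<=` crect a b c d.
Proof. by move=> z /rectE[? ? ? ?]; apply/crectE; split => //; exact: ltW. Qed.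

Lemma measurable_rect (a b c d : R) : measurable (rect a b c d : set (plane R)).
Proof. by apply: measurableX; exact: measurable_itv. Qed.

Lemma leb2_rect (a b c d : R) : a <= b -> c <= d ->
  leb2 R (rect a b c d) = ((b - a) * (d - c))%:E.
Proof.
move=> ab cd; rewrite /rect leb2X//= !lebesgue_measure_itv/= !lte_fin.
case: ltgtP ab => // [ab _|-> _]; last by rewrite mul0e subrr mul0r.
by case: ltgtP cd => // -> _; rewrite mule0 subrr mulr0.
Qed.

Definition rects : set (set (R * R)) :=
  [set A | exists a b c d, A = rect a b c d].

Lemma setI_closed_rects : setI_closed rects.
Proof.
move=> _ _ [a [b [c [d ->]]]] [a' [b' [c' [d' ->]]]].
exists (Num.max a a'), (Num.min b b'), (Num.max c c'), (Num.min d d').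
apply/seteqP; split=> z.
  move=> [/rectE[? ? ? ?] /rectE[? ? ? ?]]; apply/rectE.
  by rewrite !gt_max !le_min; split; apply/andP.
move=> /rectE; rewrite !gt_max !le_min => -[/andP[? ?] /andP[? ?] /andP[? ?] /andP[? ?]].
by split; apply/rectE.
Qed.

Lemma bigcup_itv_oc : \bigcup_n `](- n%:R), n%:R]%classic = [set: R].
Proof.
apply/seteqP; split => // x _; have [n xn] : exists n : nat, `|x| < n%:R.
  exists (Num.bound `|x|); exact: archi_boundP.
by exists n => //=; rewrite in_itv/=; move: xn; rewrite ltr_norml => /andP[-> /ltW].
Qed.

(** Both coordinates are measurable for the sigma-algebra generated by the rectangles, because a
    strip is a countable union of rectangles; hence so is the identity map into the plane. *)
Lemma measurable_plane_rects : @measurable _ (plane R) = <<s rects >>.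
Proof.
apply/seteqP; split; last first.
  apply: smallest_sub; first exact: sigma_algebra_measurable.
  by move=> _ [a [b [c [d ->]]]]; exact: measurable_rect.
pose T' := g_sigma_algebraType rects.
have m1 : measurable_fun setT (fst : T' -> measurableTypeR R).
  apply: (measurability (@ocitv R)) => //.
  move=> _ [_ [[a b] _ <-] <-]; rewrite setTI.
  rewrite (_ : _ @^-1` _ = \bigcup_n rect a b (- n%:R) n%:R).
    apply: (@bigcupT_measurable _ T') => n.
    by apply: sub_sigma_algebra; exists a, b, (- n%:R), n%:R.
  by rewrite /rect -setX_bigcupr bigcup_itv_oc; apply/seteqP; split => // -[x y] // [].
have m2 : measurable_fun setT (snd : T' -> measurableTypeR R).
  apply: (measurability (@ocitv R)) => //.
  move=> _ [_ [[c d] _ <-] <-]; rewrite setTI.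
  rewrite (_ : _ @^-1` _ = \bigcup_n rect (- n%:R) n%:R c d).
    apply: (@bigcupT_measurable _ T') => n.
    by apply: sub_sigma_algebra; exists (- n%:R), n%:R, c, d.
  by rewrite /rect -setX_bigcupl bigcup_itv_oc; apply/seteqP; split => // -[x y] // [].
have mid : measurable_fun setT (fun z : T' => (z.1, z.2) : plane R).
  exact: measurable_fun_pair.
move=> A mA; have := mid measurableT A mA; rewrite setTI.
by rewrite (_ : _ @^-1` _ = A)//; apply/seteqP; split => -[].
Qed.

(** Restricting both measures to the rectangle, where [m1] is finite, makes the uniqueness theorem
    applicable, with the squares ]-n, n] x ]-n, n] as exhausting sequence. *)
Lemma measure_eq_rect (m1 m2 : {measure set (plane R) -> \bar R}) (a b c d : R) :
  (m1 (rect a b c d) < +oo)%E ->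
  (forall a' b' c' d', rect a' b' c' d' `<=` rect a b c d ->
     m1 (rect a' b' c' d') = m2 (rect a' b' c' d')) ->
  forall A : set (plane R), measurable A -> A `<=` rect a b c d -> m1 A = m2 A.
Proof.
move=> fin mE A mA Asub.
have mQ := measurable_rect a b c d.
suff : mrestr m1 mQ A = mrestr m2 mQ A by rewrite /mrestr (setIidl Asub).
apply: (@measure_unique _ R (plane R) rects (fun n => rect (- n%:R) n%:R (- n%:R) n%:R)
  measurable_plane_rects setI_closed_rects _ _ (mrestr m1 mQ) (mrestr m2 mQ)) => //.
- by move=> n; exists (- n%:R), n%:R, (- n%:R), n%:R.
- apply/seteqP; split => // z _.
  exists (Num.bound (`|z.1| + `|z.2|)) => //.
  have := archi_boundP (addr_ge0 (normr_ge0 z.1) (normr_ge0 z.2)).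
  set n := _%:R => h; apply/rectE.
  have : `|z.1| < n by rewrite (le_lt_trans _ h)// lerDl.
  have : `|z.2| < n by rewrite (le_lt_trans _ h)// lerDr.
  by rewrite !ltr_norml => /andP[? ?] /andP[? ?]; split => //; exact: ltW.
- move=> _ [a' [b' [c' [d' ->]]]]; rewrite /= /mrestr.
  have [] := @setI_closed_rects (rect a' b' c' d') (rect a b c d).
  + by exists a', b', c', d'.
  + by exists a, b, c, d.
  + move=> a1 [b1 [c1 [d1 E]]]; rewrite E; apply: mE; rewrite -E; exact: subIsetr.
- move=> n; rewrite /= /mrestr; apply: le_lt_trans fin.
  apply: le_measure; rewrite ?inE; [|exact: measurable_rect|exact: subIsetr].
  by apply: measurableI => //; exact: measurable_rect.
Qed.

Lemma open_bigcup_rect (U : set (R * R)) : open U ->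
  exists Q : nat -> (R * R) * (R * R),
    let r n := rect (Q n).1.1 (Q n).1.2 (Q n).2.1 (Q n).2.2 in
    (forall n, crect (Q n).1.1 (Q n).1.2 (Q n).2.1 (Q n).2.2 `<=` U) /\
    U = \bigcup_n r n.
Proof.
move=> oU.
have E1 (a b c d : R) : b < a -> crect a b c d = set0.
  move=> ba; rewrite -subset0 => z /crectE[az zb _ _].
  by have := lt_le_trans ba (le_trans az zb); rewrite ltxx.
pose f (q : (rat * rat) * (rat * rat)) : (R * R) * (R * R) :=
  ((ratr q.1.1, ratr q.1.2), (ratr q.2.1, ratr q.2.2)).
pose good q := `[< crect (f q).1.1 (f q).1.2 (f q).2.1 (f q).2.2 `<=` U >].
(* Indices that give no rectangle inside [U] get a first side running from 1 to 0, so that the open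
   and the closed versions of the rectangle are both empty. *)
pose Q n : (R * R) * (R * R) :=
  if unpickle n is Some q then if good q then f q else ((1, 0), (0, 0)) else ((1, 0), (0, 0)).
exists Q; split.
  move=> n; rewrite /Q; case: (unpickle n) => [q|]; last by rewrite E1//= ltr01.
  by case: ifP => [/asboolP//|_]; rewrite E1//= ltr01.
apply/seteqP; split; last first.
  move=> z [n _]; rewrite /Q; case: (unpickle n) => [q|]; last first.
    by move=> /rect_crect; rewrite E1//= ltr01.
  case: ifP => [/asboolP qU|_]; first by move=> /rect_crect /qU.
  by move=> /rect_crect; rewrite E1//= ltr01.
move=> z Uz.
have /plane_ballP[e e0 he] : nbhs z U by apply: open_nbhs_nbhs.
have rat_itv (x y : R) : x < y -> exists q : rat, x < ratr q < y.
  by move=> /rat_in_itvoo[q]; rewrite in_itv/=; exists q.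
have [a1 /andP[? ?]] : exists q : rat, z.1 - e < ratr q < z.1.
  by apply: rat_itv; rewrite ltrBlDr ltrDl.
have [b1 /andP[? ?]] : exists q : rat, z.1 < ratr q < z.1 + e.
  by apply: rat_itv; rewrite ltrDl.
have [a2 /andP[? ?]] : exists q : rat, z.2 - e < ratr q < z.2.
  by apply: rat_itv; rewrite ltrBlDr ltrDl.
have [b2 /andP[? ?]] : exists q : rat, z.2 < ratr q < z.2 + e.
  by apply: rat_itv; rewrite ltrDl.
exists (pickle ((a1, b1), (a2, b2))) => //; rewrite /Q pickleK.
have -> : good ((a1, b1), (a2, b2)).
  apply/asboolP => w /crectE /= [? ? ? ?]; apply: he; rewrite ltr_distl; lra.
by apply/rectE; split => //=; exact: ltW.
Qed.

(** A countable cover of [U] by rectangles, made disjoint by [seqDU], reduces the claim to a single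
    rectangle. Only rectangles whose closure lies in [U] are compared, since a density continuous on
    [U] may have infinite mass near the boundary. *)
Lemma measure_eq_open (m1 m2 : {measure set (plane R) -> \bar R}) (U : set (R * R)) :
  open U ->
  (forall a b c d, crect a b c d `<=` U -> (m1 (rect a b c d) < +oo)%E) ->
  (forall a b c d, a <= b -> c <= d -> crect a b c d `<=` U ->
     m1 (rect a b c d) = m2 (rect a b c d)) ->
  forall A : set (plane R), measurable A -> A `<=` U -> m1 A = m2 A.
Proof.
move=> oU fin mE A mA AU.
have [Q [QU UE]] := open_bigcup_rect oU.
set r := (fun n => rect (Q n).1.1 (Q n).1.2 (Q n).2.1 (Q n).2.2) in UE.
have mE' a b c d : crect a b c d `<=` U -> m1 (rect a b c d) = m2 (rect a b c d).
  have [ab|ab] := leP a b; last first.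
    move=> _; rewrite (_ : rect _ _ _ _ = set0) ?measure0//.
    rewrite -subset0 => z /rectE[az zb _ _].
    by have := lt_trans ab (lt_le_trans az zb); rewrite ltxx.
  have [cd|cd] := leP c d; first exact: mE.
  move=> _; rewrite (_ : rect _ _ _ _ = set0) ?measure0//.
  rewrite -subset0 => z /rectE[_ _ az zb].
  by have := lt_trans cd (lt_le_trans az zb); rewrite ltxx.
have mr n : measurable (r n : set (plane R)) by exact: measurable_rect.
have -> : A = \bigcup_n (A `&` seqDU r n).
  by rewrite -setI_bigcupr -seqDU_bigcup_eq -UE setIidl.
have mAn n : measurable (A `&` seqDU r n : set (plane R)).
  apply: measurableI => //; apply: measurableD => //.
  by apply: bigsetU_measurable.
have tA : trivIset setT (fun n => A `&` seqDU r n).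
  exact: trivIset_setIl.
clear UE.
rewrite !measure_bigcup//; apply: eq_eseriesr => n _.
apply: (@measure_eq_rect m1 m2 (Q n).1.1 (Q n).1.2 (Q n).2.1 (Q n).2.2) => //.
- by apply: fin; exact: QU.
- move=> a b c d sub.
  have [[z0 /rectE[? ? ? ?]]|] := pselect (rect a b c d !=set0); last first.
    move=> /set0P/negP; rewrite negbK => /eqP ->; by rewrite !measure0.
  (* Inclusion of a nonempty half-open rectangle passes to the closures: if [a] lay to the left of
     the larger rectangle, a point with first coordinate at most midway between [a] and its left
     side would be in the smaller one only. *)
  apply: mE' => w /crectE[? ? ? ?]; apply: (QU n); apply/crectE.
  have /sub/rectE/=[? ? ? ?] : rect a b c d (b, d).
    by apply/rectE; split => //=; [apply: lt_le_trans|apply: lt_le_trans]; eassumption.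
  split.
  + apply: (@le_trans _ _ a) => //; rewrite leNgt; apply/negP => aa.
    have /sub/rectE/=[] : rect a b c d (Num.min ((a + (Q n).1.1) / 2) b, d).
      by apply/rectE; split => //=; rewrite ?lt_min ?ge_min ?lexx ?orbT//; [apply/andP; split|]; lra.
    by rewrite lt_min => /andP[? _] _ _ _; lra.
  + by apply: (@le_trans _ _ b).
  + apply: (@le_trans _ _ c) => //; rewrite leNgt; apply/negP => cc.
    have /sub/rectE/=[] : rect a b c d (b, Num.min ((c + (Q n).2.1) / 2) d).
      by apply/rectE; split => //=; rewrite ?lt_min ?ge_min ?lexx ?orbT//; [|apply/andP; split]; lra.
    by rewrite lt_min => _ _ /andP[? _] _; lra.
  + by apply: (@le_trans _ _ d).
- by move=> z [_ [] ].
Qed.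

End Rectangles.

(** * Measures with a density *)

Section Density.
Context d (T : measurableType d) (R : realType).
Variables (mu : {measure set T -> \bar R}) (g : T -> R).
Hypotheses (mg : measurable_fun setT g) (g0 : forall x, 0 <= g x).
Local Open Scope ereal_scope.

Let dens (A : set T) : \bar R := \int[mu]_(x in A) (g x)%:E.

Let dens0 : dens set0 = 0.
Proof. exact: integral_set0. Qed.

Let dens_ge0 A : 0 <= dens A.
Proof. by apply: integral_ge0 => x _; rewrite lee_fin. Qed.

Let dens_sigma_additive : semi_sigma_additive dens.
Proof.
move=> A mA tA mUA; rewrite /dens ge0_integral_bigcup//.
- apply: is_cvg_ereal_nneg_natsum_cond => n _ _; exact: dens_ge0.
- by apply/measurable_EFinP; exact: measurable_funTS.
- by move=> x _; rewrite lee_fin.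
Qed.

(** Bundled as a measure, so that pushforward and uniqueness theorems apply to it. *)
Definition density_measure : {measure set T -> \bar R} :=
  HB.pack_for (measure T R) dens
    (isMeasure.Build _ _ _ dens dens0 dens_ge0 dens_sigma_additive).

Lemma density_measureE A : density_measure A = \int[mu]_(x in A) (g x)%:E.
Proof. by []. Qed.

Import HBNNSimple.

(** True for indicators by definition, for simple functions by linearity, and for [f] by monotone
    convergence along [nnsfun_approx]. *)
Lemma ge0_integral_density (f : T -> \bar R) : measurable_fun setT f ->
  (forall x, 0 <= f x) ->
  \int[density_measure]_x f x = \int[mu]_x (f x * (g x)%:E).
Proof.
move=> mf f0; apply/esym; pose h := nnsfun_approx measurableT mf.
have mgE : measurable_fun setT (EFin \o g) by exact/measurable_EFinP.
have -> : \int[density_measure]_x f x =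
    lim (\int[density_measure]_x (EFin \o h n) x @[n --> \oo]).
  have fE x : f x = lim ((EFin \o h n) x @[n --> \oo]).
    by apply/esym/cvg_lim => //; exact: cvg_nnsfun_approx.
  under eq_integral => x _ do rewrite fE.
  apply: monotone_convergence => //.
  - by move=> n; apply/measurable_EFinP/measurable_funP.
  - by move=> n x _ //=; rewrite lee_fin.
  - by move=> x _ a b ab; rewrite lee_fin; exact/lefP/nd_nnsfun_approx.
have -> : \int[mu]_x (f x * (g x)%:E) =
    lim (\int[mu]_x ((EFin \o h n) \* (EFin \o g)) x @[n --> \oo]).
  have fg x : f x * (g x)%:E = lim (((EFin \o h n) \* (EFin \o g)) x @[n --> \oo]).
    by apply/esym/cvg_lim => //; apply: cvgeZr => //; exact: cvg_nnsfun_approx.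
  under eq_integral => x _ do rewrite fg.
  apply: monotone_convergence => [//| | |].
  - by move=> n; apply/emeasurable_funM => //; exact/measurable_EFinP/measurable_funP.
  - by move=> n x _ /=; rewrite mule_ge0 ?lee_fin.
  - by move=> x _ a b ab/=; rewrite lee_wpmul2r ?lee_fin//; exact/lefP/nd_nnsfun_approx.
suff suf n : \int[mu]_x ((EFin \o h n) x * (g x)%:E) =
    \int[density_measure]_x (EFin \o h n) x.
  by under eq_fun do rewrite suf.
transitivity (\int[density_measure]_x
   (\sum_(y \in range (h n)) (y * \1_(h n @^-1` [set y]) x)%:E)); last first.
  by apply: eq_integral => t tE; rewrite /= fimfunE -fsumEFin.
have indich m r : measurable_fun setT (fun x => (r * \1_(h m @^-1` [set r]) x)%:E).
  by apply: (measurable_comp measurableT) => //; exact: measurable_funM.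
rewrite ge0_integral_fsum//; last by move=> m y Ey; exact: nnfun_muleindic_ge0.
transitivity (\int[mu]_x (\sum_(y \in range (h n))
    (y * \1_(h n @^-1` [set y]) x)%:E * (g x)%:E)).
  under [RHS]eq_integral => x xE.
    rewrite -ge0_mule_fsuml => [|y]; last exact: nnfun_muleindic_ge0.
    rewrite fsumEFin // -(fimfunE _ x); over.
  by [].
rewrite ge0_integral_fsum//; last 2 first.
  - by move=> y; apply: emeasurable_funM.
  - by move=> m y Ey; rewrite mule_ge0 ?nnfun_muleindic_ge0// lee_fin.
apply: eq_fsbigr => r rhn.
under [RHS]eq_integral do rewrite EFinM.
rewrite integralZl_indic_nnsfun => //.
under eq_integral do rewrite EFinM -muleA.
rewrite ge0_integralZl//.
- under eq_integral do rewrite muleC.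
  rewrite (eq_integral ((EFin \o g) \_ (h n @^-1` [set r]))); last first.
    by move=> x xE; rewrite epatch_indic.
  rewrite -integral_mkcondr integral_indic// density_measureE.
  by rewrite setTI setIT.
- by apply: emeasurable_funM => //; exact/measurable_EFinP.
- by move=> t Et; rewrite mule_ge0 ?lee_fin.
- by move: rhn; rewrite inE => -[t _ <-]; rewrite lee_fin.
Qed.

End Density.

(** * Dyadic bisection *)

Section Bisection.
Context {R : realType}.

Lemma nested_intervals (a b : nat -> R) :
  (forall n, a n <= a n.+1) -> (forall n, b n.+1 <= b n) ->
  (forall n, a n <= b n) -> exists p, forall n, a n <= p <= b n.
Proof.
move=> ha hb hab.
have mono (n m : nat) : (n <= m)%N -> a n <= a m.
  by move=> /subnKC <-; elim: (m - n)%N => [|k IH]; rewrite ?addn0// addnS (le_trans IH).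
have anti (n m : nat) : (n <= m)%N -> b m <= b n.
  by move=> /subnKC <-; elim: (m - n)%N => [|k IH]; rewrite ?addn0// addnS (le_trans _ IH).
have ub n : ubound (range a) (b n).
  move=> _ [m _ <-]; apply: (le_trans (mono _ _ (leq_maxl m n))).
  by apply: (le_trans (hab _)); apply: anti; exact: leq_maxr.
exists (sup (range a)) => n; apply/andP; split.
  by apply: ub_le_sup; [exists (b 0%N); exact: ub|exists n].
by apply: ge_sup; [exists (a 0%N); exists 0%N|exact: ub].
Qed.

(* F is additive under bisection of dyadic rectangles: unless F x0 y0 0 = 0, nested
   quarters with |F| >= 4^-n |F x0 y0 0| shrink to a point p violating the estimate. *)
Lemma bisection_zero (w h x0 y0 : R) (F : R -> R -> nat -> R) :
  0 <= w -> 0 <= h ->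
  let r n := 2^-1 ^+ n in
  let sub x y n := [/\ x0 <= x, x + w * r n <= x0 + w,
                      y0 <= y & y + h * r n <= y0 + h] in
  (forall x y n, sub x y n -> F x y n =
     F x y n.+1 + F (x + w * r n.+1) y n.+1 +
     (F x (y + h * r n.+1) n.+1 + F (x + w * r n.+1) (y + h * r n.+1) n.+1)) ->
  (forall p, crect x0 (x0 + w) y0 (y0 + h) p -> forall e, 0 < e ->
     exists N, forall n x y, (N <= n)%N -> sub x y n ->
       crect x (x + w * r n) y (y + h * r n) p -> `|F x y n| <= e * r n ^+ 2) ->
  F x0 y0 0%N = 0.
Proof.
move=> w0 h0 r sub Fadd Floc; apply/eqP/negPn/negP => F0.
have r_gt0 n : 0 < r n by rewrite exprn_gt0// invr_gt0.
have rS n : r n = r n.+1 + r n.+1 by rewrite /r exprS; lra.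
(* Half of the initial value, so that the initial rectangle satisfies the strict inequality in
   [bad]. *)
pose e := `|F x0 y0 0%N| / 2.
have e0 : 0 < e by rewrite divr_gt0// normr_gt0.
pose bad (s : R * R * nat) := sub s.1.1 s.1.2 s.2 /\ e * r s.2 ^+ 2 < `|F s.1.1 s.1.2 s.2|.
(* The hypothesis [bad s] stays under the existential quantifier, so that [choice] yields a total
   function, which can be iterated. If no quarter were bad, the four bounds e r_(n+1)^2 would add up
   to e r_n^2. *)
have step (s : R * R * nat) : exists s' : R * R * nat, bad s -> [/\ bad s', s'.2 = s.2.+1,
    s.1.1 <= s'.1.1 /\ s'.1.1 + w * r s'.2 <= s.1.1 + w * r s.2 &
    s.1.2 <= s'.1.2 /\ s'.1.2 + h * r s'.2 <= s.1.2 + h * r s.2].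
  have [bs|] := pselect (bad s); last by exists s.
  case: s bs => -[x y] n [/= [sx1 sx2 sy1 sy2] Fbig].
  have wr : 0 <= w * r n.+1 by rewrite mulr_ge0// ltW.
  have hr : 0 <= h * r n.+1 by rewrite mulr_ge0// ltW.
  have wn : w * r n = w * r n.+1 + w * r n.+1 by rewrite rS mulrDr.
  have hn : h * r n = h * r n.+1 + h * r n.+1 by rewrite rS mulrDr.
  apply: contrapT => /forallNP H.
  have small x' y' : x <= x' -> x' + w * r n.+1 <= x + w * r n ->
      y <= y' -> y' + h * r n.+1 <= y + h * r n -> `|F x' y' n.+1| <= e * r n.+1 ^+ 2.
    move=> *; rewrite leNgt; apply/negP => big.
    apply: (H (x', y', n.+1)) => _; split => //=.
    by split => //=; split; lra.
  have rn2 : r n ^+ 2 = 4 * r n.+1 ^+ 2 by rewrite rS; ring.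
  have s1 : `|F x y n.+1| <= e * r n.+1 ^+ 2 by apply: small; lra.
  have s2 : `|F (x + w * r n.+1) y n.+1| <= e * r n.+1 ^+ 2 by apply: small; lra.
  have s3 : `|F x (y + h * r n.+1) n.+1| <= e * r n.+1 ^+ 2 by apply: small; lra.
  have s4 : `|F (x + w * r n.+1) (y + h * r n.+1) n.+1| <= e * r n.+1 ^+ 2
    by apply: small; lra.
  move: Fbig; rewrite Fadd; last by split.
  rewrite ltNge => /negP; apply.
  apply: (le_trans (ler_normD _ _)); rewrite rn2.
  apply: (le_trans (lerD (ler_normD _ _) (ler_normD _ _))).
  by move: s1 s2 s3 s4; set u := e * r n.+1 ^+ 2;
    rewrite mulrCA -/u; lra.
have [g gP] := choice step.
pose s n := iter n g (x0, y0, 0%N).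
have badS n : bad (s n).
  elim: n => [|n /gP[]//]; split => /=.
    by rewrite /sub /r expr0 !mulr1.
  by rewrite /r expr0 expr1n mulr1 /e; have := normr_gt0 (F x0 y0 0%N); rewrite F0; lra.
have s2 n : (s n).2 = n.
  by elim: n => // n IH; have [_ + _ _] := gP _ (badS n); rewrite /s iterS => ->; rewrite -/(s n) IH.
have [px pxP] : exists p, forall n, (s n).1.1 <= p <= (s n).1.1 + w * r n.
  apply: nested_intervals => n.
  - by have [_ _ [] ] := gP _ (badS n).
  - have [_ _ [_ +] _] := gP _ (badS n).
    by rewrite (_ : g (s n) = s n.+1)// !s2.
  - by rewrite lerDl mulr_ge0// ltW.
have [py pyP] : exists p, forall n, (s n).1.2 <= p <= (s n).1.2 + h * r n.
  apply: nested_intervals => n.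
  - by have [_ _ _ [] ] := gP _ (badS n).
  - have [_ _ _ [_ +]] := gP _ (badS n).
    by rewrite (_ : g (s n) = s n.+1)// !s2.
  - by rewrite lerDl mulr_ge0// ltW.
have pc : crect x0 (x0 + w) y0 (y0 + h) (px, py).
  have /= := pxP 0%N; have /= := pyP 0%N.
  by rewrite /r expr0 !mulr1 => /andP[? ?] /andP[? ?]; apply/crectE.
have [N NP] := Floc (px, py) pc _ e0.
have [sN big] := badS N; rewrite s2 in sN big.
have /andP[? ?] := pxP N; have /andP[? ?] := pyP N.
suff : `|F (s N).1.1 (s N).1.2 N| <= e * r N ^+ 2 by rewrite leNgt big.
by apply: NP => //; apply/crectE.
Qed.

End Bisection.

(** * Consequences of differentiability and elementary estimates *)

Section LocalEstimates.
Context {R : realType}.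

Lemma differentiable_estimate (V W : normedModType R) (f : V -> W) (x : V) :
  differentiable f x -> forall e : R, 0 < e ->
  \forall y \near x, `|f y - f x - 'd f x (y - x)| <= e * `|y - x|.
Proof.
move=> df e e0; have /eqaddoP/(_ e e0) := diff_locally df.
rewrite [X in _ -> X](near_shift 0) /=; apply: filterS => h /=.
by rewrite !fctE /= subr0 addrK opprD addrA.
Qed.

Lemma differentiable_of_estimate (V W : normedModType R) (f : V -> W) (x : V)
    (L : {linear V -> W}) : continuous L ->
  (forall e : R, 0 < e -> \forall h \near (0 : V), `|f (h + x) - f x - L h| <= e * `|h|) ->
  differentiable f x /\ 'd f x = L :> (V -> W).
Proof.
move=> cL est.
have E : f \o shift x = cst (f x) + L +o_ (0 : V) id.
  apply/eqaddoP => e /est; apply: filterS => h /=.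
  by rewrite !fctE /= opprD addrA.
have df : 'd f x = L :> (V -> W) by exact: diff_unique.
by split => //; apply/diff_locallyP; rewrite df.
Qed.

(** Transfers differentials between functions that agree only near the point, such as [Psi \o Phi]
    and the identity, or a function and its extension by zero. *)
Lemma differentiable_near (V W : normedModType R) (f g : V -> W) (x : V) :
  {near x, f =1 g} -> differentiable f x ->
  differentiable g x /\ 'd g x = 'd f x :> (V -> W).
Proof.
move=> fg df; apply: differentiable_of_estimate; first exact: diff_continuous.
move=> e e0; have /eqaddoP/(_ e e0) := diff_locally df.
have : \forall h \near (0 : V), f (h + x) = g (h + x).
  by move: fg; rewrite (near_shift 0) /= => fg; apply: filterS fg => h /=; rewrite subr0.
apply: filterS2 => h fgh; rewrite !fctE /= fgh.
by rewrite (nbhs_singleton fg) opprD addrA.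
Qed.

Lemma linear2E (W : normedModType R) (L : {linear (R * R)%type -> W}) (v : R * R) :
  L v = v.1 *: L (e_x R) + v.2 *: L (e_y R).
Proof.
rewrite -!linearZ -linearD; congr (L _).
by case: v => a b; rewrite /e_x /e_y /=; congr pair => /=; rewrite /GRing.scale/= ?mulr1 ?mulr0 ?addr0 ?add0r.
Qed.

Lemma norm_fst (v : R * R) : `|v.1| <= `|v|.
Proof. by rewrite prod_normE le_max lexx. Qed.

Lemma norm_snd (v : R * R) : `|v.2| <= `|v|.
Proof. by rewrite prod_normE le_max lexx orbT. Qed.

Lemma norm2_le (v : R * R) (e : R) : (`|v| <= e) = (`|v.1| <= e) && (`|v.2| <= e).
Proof. by rewrite prod_normE ge_max. Qed.

Lemma measurable_fun_continuous_on2 (U : set (R * R)) (f : R * R -> R * R) :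
  open U -> (forall z, U z -> {for z, continuous f}) ->
  measurable_fun (U : set (plane R)) (f : plane R -> plane R).
Proof.
move=> oU cf; have mU := open_measurable_plane oU.
apply/measurable_restrictT => //; apply/measurable_fun_pairP; split.
  rewrite (_ : fst \o _ = (fst \o f) \_ U).
    apply: (proj1 (measurable_restrictT (fst \o f) mU)).
    apply: (@measurable_fun_continuous_on R U _ oU) => z Uz.
    by apply: continuous_comp; [exact: cf|exact: cvg_fst].
  by apply/funext => z; rewrite /patch/=; case: ifP.
rewrite (_ : snd \o _ = (snd \o f) \_ U).
  apply: (proj1 (measurable_restrictT (snd \o f) mU)).
  apply: (@measurable_fun_continuous_on R U _ oU) => z Uz.
  by apply: continuous_comp; [exact: cf|exact: cvg_snd].
by apply/funext => z; rewrite /patch/=; case: ifP.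
Qed.

Lemma compact_continuous_bounded (U K : set (R * R)) (f : R * R -> R) :
  (forall z, U z -> {for z, continuous f}) -> compact K -> K `<=` U ->
  exists M, 0 < M /\ forall z, K z -> `|f z| <= M.
Proof.
move=> cf cK KU.
have cfK : compact (f @` K).
  apply: continuous_compact => //; apply: continuous_in_subspaceT => z.
  by rewrite inE => /KU; exact: cf.
have [M0 [_ MP]] := compact_bounded cfK.
exists (`|M0| + 1); split; first by rewrite ltr_pwDr.
move=> z Kz; apply: (MP (`|M0| + 1)); last by exists z.
by rewrite (le_lt_trans (ler_norm _))// ltrDl.
Qed.

Lemma compact_crect (a b c d : R) : compact (crect a b c d).
Proof. by apply: compact_setX; exact: segment_compact. Qed.

Lemma itv_dist_le (a b u v : R) : a <= u -> u <= b -> a <= v -> v <= b -> `|u - v| <= b - a.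
Proof. by move=> *; rewrite ler_norml; lra. Qed.

Lemma rect_thicken (a b c d e : R) (z z' : R * R) : `|z - z'| <= e ->
  rect a b c d z' -> rect (a - e) (b + e) (c - e) (d + e) z.
Proof.
rewrite norm2_le => /andP[/= + +] /rectE[z1 z2 z3 z4]; rewrite !ler_norml => H1 H2.
by apply/rectE; split; lra.
Qed.

Lemma itv_enlarge_le (x w e r : R) : 0 <= w -> 0 <= r -> 0 <= e ->
  x - e * r <= x + w * r + e * r.
Proof.
move=> w0 r0 e0; have := mulr_ge0 w0 r0; have := mulr_ge0 e0 r0.
by set p := e * r; set q := w * r; lra.
Qed.

Lemma itv_shrink_le (x w e r : R) : 0 <= r -> e <= w / 2 ->
  x + e * r <= x + w * r - e * r.
Proof.
move=> r0 /(ler_wpM2r r0); rewrite mulrAC.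
by set p := e * r; set q := w * r; lra.
Qed.

Lemma linear2_bounded (L : {linear (R * R)%type -> (R * R)%type}) :
  exists2 K, 0 < K & forall v, `|L v| <= K * `|v|.
Proof.
exists (`|L (e_x R)| + `|L (e_y R)| + 1); first by rewrite ltr_wpDl// addr_ge0.
move=> v; rewrite linear2E; apply: (le_trans (ler_normD _ _)); rewrite !normrZ.
rewrite mulrDl mul1r mulrDl.
have H1 : `|v.1| * `|L (e_x R)| <= `|L (e_x R)| * `|v|.
  by rewrite mulrC ler_wpM2l// norm_fst.
have H2 : `|v.2| * `|L (e_y R)| <= `|L (e_y R)| * `|v|.
  by rewrite mulrC ler_wpM2l// norm_snd.
by rewrite (le_trans (lerD H1 H2))// lerDl.
Qed.

(** Moving each side of a rectangle with sides w r and h r by eta r changes its area by at most (2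
    eta (w + h) + 4 eta^2) r^2, which is at most eta S r^2 once eta <= 1. The bounds by w / 2 and h
    / 2 keep the shrunk rectangle from turning inside out. *)
Lemma enlarged_area (w h J e : R) : 0 < w -> 0 < h -> 0 <= J -> 0 < e ->
  exists eta, [/\ 0 < eta, eta <= w / 2, eta <= h / 2 & forall r m,
    m <= J * ((w + 2 * eta) * (h + 2 * eta) * r ^+ 2) ->
    J * ((w - 2 * eta) * (h - 2 * eta) * r ^+ 2) <= m ->
    `|m - J * (w * h * r ^+ 2)| <= e * r ^+ 2].
Proof.
move=> w0 h0 J0 e0.
pose S := 2 * w + 2 * h + 4.
have S0 : 0 < S by rewrite /S; lra.
have J1 : 0 < J + 1 by lra.
pose eta := Num.min (Num.min 1 (w / 2)) (Num.min (h / 2) (e / ((J + 1) * S))).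
exists eta.
have eta0 : 0 < eta by rewrite !lt_min ltr01 !divr_gt0// mulr_gt0.
have eta1 : eta <= 1 by rewrite !ge_min lexx.
have etae : J * (eta * S) <= e.
  have : eta <= e / ((J + 1) * S) by rewrite !ge_min lexx !orbT.
  rewrite ler_pdivlMr ?mulr_gt0// => H; apply: le_trans H; rewrite mulrCA.
  by apply: ler_wpM2l; [exact: ltW|apply: ler_wpM2r; [exact: ltW|lra]].
split => //; [by rewrite !ge_min lexx !orbT|by rewrite !ge_min lexx !orbT|].
move=> r m H1 H2; have r20 : 0 <= r ^+ 2 by rewrite sqr_ge0.
have etae' : J * (eta * S) * r ^+ 2 <= e * r ^+ 2 by rewrite ler_wpM2r.
have ee : J * (eta * eta) * r ^+ 2 <= J * eta * r ^+ 2.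
  by rewrite ler_wpM2r// ler_wpM2l// ler_piMr// ltW.
have ee0 : 0 <= J * (eta * eta) * r ^+ 2 by rewrite mulr_ge0// mulr_ge0// mulr_ge0// ltW.
have ee1 : 0 <= J * eta * r ^+ 2 by rewrite mulr_ge0// mulr_ge0// ltW.
move: H1 H2.
rewrite (_ : J * ((w + _) * _ * _) = J * (w * h * r ^+ 2) +
  (J * (eta * S) * r ^+ 2 + 4 * (J * (eta * eta) * r ^+ 2) - 4 * (J * eta * r ^+ 2)));
  last by rewrite /S; ring.
rewrite (_ : J * ((w - _) * _ * _) = J * (w * h * r ^+ 2) -
  (J * (eta * S) * r ^+ 2 - 4 * (J * (eta * eta) * r ^+ 2) - 4 * (J * eta * r ^+ 2)));
  last by rewrite /S; ring.
move=> H1 H2; rewrite ler_distl; move: H1 H2 etae' ee ee0 ee1.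
set X := J * (w * h * _); set Y := J * (eta * S) * _; set Z := J * (eta * eta) * _.
set W := J * eta * _; set E := e * _; clear; lra.
Qed.

End LocalEstimates.

(** * Linear maps of the plane and determinants *)

Definition det2 (R : realType) (u v : R * R) : R := u.1 * v.2 - v.1 * u.2.

Section LinearMaps.
Context {R : realType}.
Implicit Types A B : {linear (R * R)%type -> (R * R)%type}.

Lemma linear2_coord A v : A v =
  ((A (e_x R)).1 * v.1 + (A (e_y R)).1 * v.2, (A (e_x R)).2 * v.1 + (A (e_y R)).2 * v.2).
Proof.
by rewrite {1}linear2E [LHS]surjective_pairing /= /GRing.scale/= ![v.1 * _]mulrC ![v.2 * _]mulrC.
Qed.

Lemma det2_inverse A B : (forall v, B (A v) = v) ->
  det2 (B (e_x R)) (B (e_y R)) * det2 (A (e_x R)) (A (e_y R)) = 1.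
Proof.
move=> BA; have := BA (e_x R); have := BA (e_y R).
rewrite (linear2_coord B (A (e_y R))) (linear2_coord B (A (e_x R))) /det2 => -[E1 E2] [E3 E4].
move: E1 E2 E3 E4; set a := (A (e_x R)).1; set b := (A (e_y R)).1.
set c := (A (e_x R)).2; set d := (A (e_y R)).2.
set a' := (B (e_x R)).1; set b' := (B (e_y R)).1.
set c' := (B (e_x R)).2; set d' := (B (e_y R)).2 => E1 E2 E3 E4.
rewrite (_ : _ * _ = (a' * a + b' * c) * (c' * b + d' * d) -
    (a' * b + b' * d) * (c' * a + d' * c)); last by ring.
by rewrite E1 E2 E3 E4 !mulr1 mulr0 subr0.
Qed.

Lemma leb2_affine_map_preimage B (p q : R * R) (M : set (plane R)) :
  det2 (B (e_x R)) (B (e_y R)) != 0 -> measurable M ->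
  measurable ((fun z => p + B (z - q)) @^-1` M : set (plane R)) /\
  (leb2 R ((fun z => p + B (z - q))%R @^-1` M) =
    `|det2 (B (e_x R)) (B (e_y R))|^-1%:E * leb2 R M)%E.
Proof.
set a := (B (e_x R)).1; set b := (B (e_y R)).1.
set c := (B (e_x R)).2; set d := (B (e_y R)).2.
rewrite -[det2 _ _]/(a * d - b * c) => D0 mM.
pose s := p.1 - a * q.1 - b * q.2; pose t := p.2 - c * q.1 - d * q.2.
have -> : (fun z => p + B (z - q)) @^-1` M =
    [set z : plane R | M (a * z.1 + b * z.2 + s, c * z.1 + d * z.2 + t)].
  apply/funext => z; rewrite /preimage/=; congr (M _).
  rewrite linear2_coord -/a -/b -/c -/d [LHS]surjective_pairing /s /t /=.
  by congr pair; ring.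
split; last exact: leb2_affine_preimage.
by rewrite -[X in measurable X]setTI; exact: (measurable_affine2 a b c d s t).
Qed.

End LinearMaps.


(** * Comparison of two measures by bisection *)

Lemma half_expn_lt (R : realType) (e : R) : 0 < e ->
  exists N, forall n, (N <= n)%N -> 2^-1 ^+ n < e.
Proof.
move=> e0; exists (Num.bound e^-1) => n Nn.
rewrite exprVn invf_plt ?posrE ?exprn_gt0//.
apply: (lt_le_trans (archi_boundP _)); first by rewrite invr_ge0 ltW.
by rewrite -natrX ler_nat (leq_trans Nn)// ltnW// ltn_expl.
Qed.

Section RectMeasures.
Context {R : realType}.

Lemma measure_rect_split (mu : {measure set (plane R) -> \bar R}) (a b c d e f : R) :
  a <= e -> e <= b -> c <= f -> f <= d -> (mu (rect a b c d) < +oo)%E ->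
  fine (mu (rect a b c d)) =
    fine (mu (rect a e c f)) + fine (mu (rect e b c f)) +
    (fine (mu (rect a e f d)) + fine (mu (rect e b f d))).
Proof.
move=> ae eb cf fd fin.
have finS A : measurable (A : set (plane R)) -> A `<=` rect a b c d -> mu A \is a fin_num.
  move=> mA AS; rewrite ge0_fin_numE//; apply: le_lt_trans fin.
  by apply: le_measure; rewrite ?inE//; exact: measurable_rect.
have [m1 m2 m3 m4] : [/\ mu (rect a e c f) \is a fin_num, mu (rect e b c f) \is a fin_num,
    mu (rect a e f d) \is a fin_num & mu (rect e b f d) \is a fin_num].
  by split; apply: finS; first [exact: measurable_rect|
    move=> z /rectE[? ? ? ?]; apply/rectE; split; lra].
rewrite -!fineD ?fin_numD ?m1 ?m2 ?m3 ?m4//; congr fine.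
rewrite -!measureU//; try exact: measurable_rect.
- congr (mu _); apply/seteqP; split => z.
    move=> /rectE[? ? ? ?]; have [?|?] := leP z.1 e; have [?|?] := leP z.2 f;
    [left; left|right; left|left; right|right; right]; apply/rectE; split => //.
  by move=> [[]|[]] /rectE[? ? ? ?]; apply/rectE; split; lra.
- by apply: measurableU; exact: measurable_rect.
- by apply: measurableU; exact: measurable_rect.
- by rewrite -subset0 => z [[] /rectE[? ? ? ?] [] /rectE[? ? ? ?]]; lra.
- by rewrite -subset0 => z [/rectE[? ? ? ?] /rectE[? ? ? ?]]; lra.
- by rewrite -subset0 => z [/rectE[? ? ? ?] /rectE[? ? ? ?]]; lra.
Qed.

Lemma Rintegral_near_constant (Q : set (plane R)) (f : R * R -> R) (k e : R) :
  measurable Q -> (leb2 R Q < +oo)%E -> measurable_fun Q (f : plane R -> R) ->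
  (forall z, Q z -> `|f z - k| <= e) ->
  (\int[leb2 R]_(z in Q) (`|f z|)%:E < +oo)%E /\
  `|\int[leb2 R]_(z in Q) f z - k * fine (leb2 R Q)|%R <= e * fine (leb2 R Q).
Proof.
move=> mQ finQ mf fk.
have ik c : (leb2 R).-integrable Q (EFin \o fun=> c).
  apply: (@measurable_bounded_integrable _ _ _ (leb2 R)) => //.
  exists `|c|; split => // M cM z _ /=; exact: ltW.
have fi : (leb2 R).-integrable Q (EFin \o f).
  apply: (le_integrable mQ _ _ (ik (`|k| + e))); first exact/measurable_EFinP.
  move=> z Qz /=; rewrite lee_fin (le_trans _ (ler_norm _))//.
  by rewrite -[f z](subrK k) (le_trans (ler_normD _ _))// addrC lerD2l fk.
split; first by have /integrableP[] := fi.
have H1 := @le_Rintegral _ _ _ _ Q f (fun=> k + e) mQ fi (ik _).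
have H2 := @le_Rintegral _ _ _ _ Q (fun=> k - e) f mQ (ik _) fi.
rewrite !Rintegral_cst// in H1 H2.
rewrite ler_distl -mulrBl -mulrDl; apply/andP; split.
  by apply: H2 => z Qz; have := fk z Qz; rewrite ler_distl => /andP[+ _].
by apply: H1 => z Qz; have := fk z Qz; rewrite ler_distl => /andP[_ +].
Qed.

(** All rectangles of the bisection have the proportions of the initial one, so w and h stay fixed
    and only the scale r varies. The estimate must hold wherever p lies in the small rectangle,
    since the position of the limit point in the nested rectangles is not controlled. *)
Lemma measure_rect_bisection (m1 m2 : {measure set (plane R) -> \bar R}) (a b c d : R) :
  a <= b -> c <= d -> (m1 (rect a b c d) < +oo)%E -> (m2 (rect a b c d) < +oo)%E ->
  (forall w h p, 0 < w -> 0 < h -> crect a b c d p ->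
    forall e, 0 < e -> exists2 dl, 0 < dl & forall x y r, 0 < r -> r < dl ->
    crect x (x + w * r) y (y + h * r) p ->
    crect x (x + w * r) y (y + h * r) `<=` crect a b c d ->
    `|fine (m1 (rect x (x + w * r) y (y + h * r))) -
      fine (m2 (rect x (x + w * r) y (y + h * r)))| <= e * r ^+ 2) ->
  m1 (rect a b c d) = m2 (rect a b c d).
Proof.
rewrite le_eqVlt => /predU1P[->|ab].
  by move=> _ _ _ _; rewrite (_ : rect _ _ _ _ = set0) ?measure0// -subset0 => z /rectE[? ? _ _]; lra.
rewrite le_eqVlt => /predU1P[->|cd].
  by move=> _ _ _; rewrite (_ : rect _ _ _ _ = set0) ?measure0// -subset0 => z /rectE[_ _ ? ?]; lra.
move=> f1 f2 est.
suff E : fine (m1 (rect a b c d)) - fine (m2 (rect a b c d)) = 0.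
  have mf : m1 (rect a b c d) \is a fin_num by rewrite ge0_fin_numE.
  have nf : m2 (rect a b c d) \is a fin_num by rewrite ge0_fin_numE.
  by rewrite -(fineK mf) -(fineK nf); congr EFin; apply/eqP; rewrite -subr_eq0 E.
pose w := b - a; pose h := d - c.
have w0 : 0 < w by rewrite subr_gt0.
have h0 : 0 < h by rewrite subr_gt0.
pose F x y n := fine (m1 (rect x (x + w * 2^-1 ^+ n) y (y + h * 2^-1 ^+ n))) -
                fine (m2 (rect x (x + w * 2^-1 ^+ n) y (y + h * 2^-1 ^+ n))).
have aw : a + w = b by rewrite /w addrC subrK.
have ch : c + h = d by rewrite /h addrC subrK.
rewrite -[LHS](_ : F a c 0%N = _); last by rewrite /F expr0 !mulr1 aw ch.
have subU x y n : [/\ a <= x, x + w * 2^-1 ^+ n <= a + w, c <= y & y + h * 2^-1 ^+ n <= c + h] ->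
    crect x (x + w * 2^-1 ^+ n) y (y + h * 2^-1 ^+ n) `<=` crect a b c d.
  move=> [h1 h2 h3 h4] z /crectE[? ? ? ?]; apply/crectE; rewrite -aw -ch.
  by split; [exact: le_trans h1 _|exact: le_trans _ h2|exact: le_trans h3 _|exact: le_trans _ h4].
have fin (m : {measure set (plane R) -> \bar R}) x y n : (m (rect a b c d) < +oo)%E ->
    [/\ a <= x, x + w * 2^-1 ^+ n <= a + w, c <= y & y + h * 2^-1 ^+ n <= c + h] ->
    (m (rect x (x + w * 2^-1 ^+ n) y (y + h * 2^-1 ^+ n)) < +oo)%E.
  move=> f [h1 h2 h3 h4]; apply: le_lt_trans f; apply: le_measure; rewrite ?inE.
  - exact: measurable_rect.
  - exact: measurable_rect.
  - move=> z /rectE[? ? ? ?]; apply/rectE; rewrite -aw -ch; split;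
    by [exact: le_lt_trans h1 _|exact: le_trans _ h2|exact: le_lt_trans h3 _|exact: le_trans _ h4].
apply: (bisection_zero (ltW w0) (ltW h0)).
- move=> x y n sU.
  have r0 : 0 < 2^-1 ^+ n.+1 :> R by rewrite exprn_gt0// invr_gt0.
  have wE : x + w * 2^-1 ^+ n = x + w * 2^-1 ^+ n.+1 + w * 2^-1 ^+ n.+1 by rewrite exprS; field.
  have hE : y + h * 2^-1 ^+ n = y + h * 2^-1 ^+ n.+1 + h * 2^-1 ^+ n.+1 by rewrite exprS; field.
  have wp : 0 <= w * 2^-1 ^+ n.+1 by rewrite mulr_ge0// ltW.
  have hp : 0 <= h * 2^-1 ^+ n.+1 by rewrite mulr_ge0// ltW.
  have fin1 := fin m1 x y n f1 sU.
  have fin2 := fin m2 x y n f2 sU.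
  rewrite /F; rewrite wE hE in fin1 fin2 *; move: wp hp fin1 fin2.
  move: (w * _) (h * _) => w' h' wp hp fin1 fin2.
  rewrite (@measure_rect_split m1 _ _ _ _ (x + w') (y + h')) ?lerDl//.
  rewrite (@measure_rect_split m2 _ _ _ _ (x + w') (y + h')) ?lerDl//.
  ring.
- move=> p pQ e e0; rewrite aw ch in pQ.
  have [dl dl0 dlP] := est _ _ _ w0 h0 pQ _ e0.
  have [N NP] := half_expn_lt dl0.
  exists N => n x y Nn /subU sU pn; apply: dlP => //; exact: NP.
Qed.

End RectMeasures.

(** * Change of variables for a differentiable bijection with continuous Jacobian *)

Definition jac (R : realType) (Phi : R * R -> R * R) (z : R * R) : R :=
  `|det2 ('d Phi z (e_x R)) ('d Phi z (e_y R))|.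

Section ChangeOfVariables.
Context {R : realType}.
Variables (U V : set (R * R)) (Phi Psi : R * R -> R * R).
Hypotheses (oU : open U) (oV : open V) (V_fin : (leb2 R V < +oo)%E).
Hypotheses (UV : forall z, U z -> V (Phi z)) (VU : forall z, V z -> U (Psi z)).
Hypotheses (dPhi : forall z, U z -> differentiable Phi z)
  (dPsi : forall z, V z -> differentiable Psi z).
Hypotheses (PhiK : forall z, U z -> Psi (Phi z) = z)
  (PsiK : forall z, V z -> Phi (Psi z) = z).

Hypothesis cjac : forall z, U z -> {for z, continuous (jac Phi)}.
Local Notation jac := (jac Phi).

Lemma diff_inverse (p v : R * R) : U p -> 'd Psi (Phi p) ('d Phi p v) = v.
Proof.
move=> Up.
have E : 'd (Psi \o Phi) p = 'd Psi (Phi p) \o 'd Phi p :> (_ -> _).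
  by apply: diff_comp; [exact: dPhi|apply: dPsi; exact: UV].
rewrite -[LHS]/(('d Psi (Phi p) \o 'd Phi p) v) -E.
have idn : {near p, id =1 Psi \o Phi}.
  apply: filterS (open_nbhs_nbhs (conj oU Up)) => z Uz; exact/esym/PhiK.
have did : differentiable (id : R * R -> R * R) p by exact: ex_diff.
by have [_ ->] := differentiable_near idn did; rewrite diff_val.
Qed.

Lemma diff_inverseV (p v : R * R) : U p -> 'd Phi p ('d Psi (Phi p) v) = v.
Proof.
move=> Up; have E : 'd (Phi \o Psi) (Phi p) = 'd Phi p \o 'd Psi (Phi p) :> (_ -> _).
  by rewrite -[X in 'd Phi X \o _](PhiK Up); apply: diff_comp;
    [apply: dPsi; exact: UV|apply: dPhi; rewrite PhiK].
rewrite -[LHS]/(('d Phi p \o 'd Psi (Phi p)) v) -E.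
have idn : {near Phi p, id =1 Phi \o Psi}.
  apply: filterS (open_nbhs_nbhs (conj oV (UV Up))) => z Vz; exact/esym/PsiK.
have did : differentiable (id : R * R -> R * R) (Phi p) by exact: ex_diff.
by have [_ ->] := differentiable_near idn did; rewrite diff_val.
Qed.

(** [T] inverts the affine approximation of [Phi] at p, so the preimages under [T] are
    parallelograms, to be compared with the image of [Q] under [Phi], written through [Psi]. The
    outer inclusion uses the differentiability of [Phi] at p, the inner one that of [Psi] at
    [Phi p]; the latter takes the place of a topological argument that the image fills the inner
    parallelogram. *)
Lemma rect_image_inclusions (w h : R) (p : R * R) : 0 < w -> 0 < h -> U p ->
  forall eta, 0 < eta -> exists2 dl, 0 < dl & forall x y r, 0 < r -> r < dl ->
    crect x (x + w * r) y (y + h * r) p ->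
    let Q := rect x (x + w * r) y (y + h * r) in
    let T z := p + 'd Psi (Phi p) (z - Phi p) in
    V `&` Psi @^-1` Q `<=` T @^-1` (rect (x - eta * r) (x + w * r + eta * r)
                                         (y - eta * r) (y + h * r + eta * r)) /\
    T @^-1` (rect (x + eta * r) (x + w * r - eta * r)
                  (y + eta * r) (y + h * r - eta * r)) `<=` V `&` Psi @^-1` Q.
Proof.
move=> w0 h0 Up eta eta0; set q := Phi p.
have Vq : V q by exact: UV.
set A := 'd Phi p; set B := 'd Psi q.
have BA v : B (A v) = v by exact: diff_inverse.
have AB v : A (B v) = v by exact: diff_inverseV.
have [K1 K10 KA] := linear2_bounded A; have [K2 K20 KB] := linear2_bounded B.
pose C := w + h.
have C0 : 0 < C by rewrite addr_gt0.
(* Points of the rectangle are within C r of p. The relative error [e1] of [Phi] is magnified by the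
   bound K2 of [B]; the relative error [e2] of [Psi] applies at distances up to K1 C r from q. Both
   products must equal eta. *)
have solve K : 0 < K -> exists2 e, 0 < e & K * (e * C) = eta.
  move=> K0; exists (eta / (K * C)); first by rewrite divr_gt0// mulr_gt0.
  by rewrite mulrCA divfK// gt_eqF// mulr_gt0.
have [e1 e10 e1E] := solve _ K20; have [e2 e20 e2E] := solve _ K10.
have [d1 d10 est1] : exists2 d1, 0 < d1 & forall z, `|z - p| < d1 ->
    `|Phi z - q - A (z - p)| <= e1 * `|z - p|.
  have /nbhs_normP[d1 /= d10 H] := differentiable_estimate (dPhi Up) e10.
  by exists d1 => // z zp; apply: H; rewrite /= distrC.
have [d2 d20 est2] : exists2 d2, 0 < d2 & forall z, `|z - q| < d2 ->
    V z /\ `|Psi z - p - B (z - q)| <= e2 * `|z - q|.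
  have Hn : \forall z \near q, V z /\ `|Psi z - p - B (z - q)| <= e2 * `|z - q|.
    near=> z; split; first by near: z; exact: open_nbhs_nbhs.
    rewrite -{1}(PhiK Up); near: z; exact: (differentiable_estimate (dPsi Vq) e20).
  have /nbhs_normP[d2 /= d20 H] := Hn.
  by exists d2 => // z zp; apply: H; rewrite /= distrC.
exists (Num.min (d1 / C) (d2 / (K1 * C))).
  by rewrite lt_min !divr_gt0// mulr_gt0.
move=> x y r r0; rewrite lt_min !ltr_pdivlMr ?mulr_gt0// => /andP[rd1 rd2].
move=> /crectE[px1 px2 py1 py2] Q T.
have wr : 0 <= w * r by rewrite mulr_ge0// ltW.
have hr : 0 <= h * r by rewrite mulr_ge0// ltW.
have Qp z : x <= z.1 -> z.1 <= x + w * r -> y <= z.2 -> z.2 <= y + h * r -> `|z - p| <= C * r.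
  rewrite norm2_le /= /C mulrDl => z1 z2 z3 z4; apply/andP; split.
    by apply: (le_trans (itv_dist_le z1 z2 px1 px2)); rewrite addrC addKr lerDl.
  by apply: (le_trans (itv_dist_le z3 z4 py1 py2)); rewrite addrC addKr lerDr.
have er : 0 < eta * r by rewrite mulr_gt0.
split=> z.
  move=> [Vz /rectE[z1 z2 z3 z4]].
  have Pz : `|Psi z - p| <= C * r by apply: Qp => //; exact: ltW.
  have {}est1 : `|z - q - A (Psi z - p)| <= e1 * (C * r).
    rewrite -{1}(PsiK Vz); apply: (le_trans (est1 _ _)).
      by apply: (le_lt_trans Pz); rewrite mulrC.
    by rewrite ler_pM2l.
  have : `|T z - Psi z| <= eta * r.
    rewrite (_ : T z - Psi z = B (z - q - A (Psi z - p))); last first.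
      by rewrite [RHS]linearB BA opprB addrA [B _ + p]addrC.
    apply: (le_trans (KB _)); rewrite -e1E -!mulrA.
    by rewrite ler_pM2l.
  by move=> zz; apply: (rect_thicken zz); apply/rectE.
move=> Tzr; have /rectE[z1 z2 z3 z4] := Tzr.
have Tz : `|T z - p| <= C * r.
  apply: Qp; [apply: le_trans (ltW z1)|apply: (le_trans z2)|apply: le_trans (ltW z3)|
    apply: (le_trans z4)]; by rewrite ?lerDl ?gerBl; exact: ltW.
have zq : `|z - q| <= K1 * C * r.
  rewrite (_ : z - q = A (T z - p)); last by rewrite [T z]addrC addrK AB.
  by apply: (le_trans (KA _)); rewrite -mulrA ler_pM2l.
have [|Vz est] := est2 z; first by apply: le_lt_trans zq _; rewrite mulrC.
split => //.
have : `|Psi z - T z| <= eta * r.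
  rewrite opprD addrA; apply: (le_trans est); rewrite -e2E mulrCA -mulrA.
  by rewrite ler_pM2l// mulrA.
by move=> zz; have := rect_thicken zz Tzr; rewrite !addrK !subrK.
Unshelve. all: by end_near.
Qed.

(** The determinants of ['d Psi (Phi p)] and ['d Phi p], abstracted in the proof as [u] and [w], are
    inverse to each other, which turns the factor |u|^-1 of the affine formula into [jac p]. *)
Lemma leb2_diff_preimage (p : R * R) (x1 x2 y1 y2 : R) : U p -> x1 <= x2 -> y1 <= y2 ->
  let T z : R * R := p + 'd Psi (Phi p) (z - Phi p) in
  measurable (T @^-1` rect x1 x2 y1 y2 : set (plane R)) /\
  leb2 R (T @^-1` rect x1 x2 y1 y2) = (jac p * ((x2 - x1) * (y2 - y1)))%:E.
Proof.
move=> Up x12 y12 T.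
suff abs (u w : R) : u * w = 1 -> (u != 0 ->
    measurable (T @^-1` rect x1 x2 y1 y2 : set (plane R)) /\
    leb2 R (T @^-1` rect x1 x2 y1 y2) = (`|u|^-1%:E * leb2 R (rect x1 x2 y1 y2))%E) ->
    measurable (T @^-1` rect x1 x2 y1 y2 : set (plane R)) /\
    leb2 R (T @^-1` rect x1 x2 y1 y2) = (`|w| * ((x2 - x1) * (y2 - y1)))%:E.
  apply: (abs _ _ (det2_inverse (fun v => diff_inverse v Up))) => u0.
  exact: (leb2_affine_map_preimage _ _ u0 (measurable_rect x1 x2 y1 y2)).
move=> uw; have u0 : u != 0 by apply: contra_eq_neq uw => ->; rewrite mul0r eq_sym oner_neq0.
move=> /(_ u0)[mT ->]; split => //; rewrite leb2_rect// -EFinM -normfV.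
by congr (`|_| * _)%:E; rewrite -[LHS]mulr1 -uw mulKf.
Qed.

Lemma leb2_preimage_estimate (w h : R) (p : R * R) : 0 < w -> 0 < h -> U p ->
  forall e, 0 < e -> exists2 dl, 0 < dl & forall x y r, 0 < r -> r < dl ->
    crect x (x + w * r) y (y + h * r) p ->
    `|fine (leb2 R (V `&` Psi @^-1` rect x (x + w * r) y (y + h * r))) -
      jac p * (w * h * r ^+ 2)| <= e * r ^+ 2.
Proof.
move=> w0 h0 Up e e0.
have j0 : 0 <= jac p by exact: normr_ge0.
have [eta [eta0 etaw etah etaP]] := enlarged_area w0 h0 j0 e0.
have [dl dl0 dlP] := rect_image_inclusions w0 h0 Up eta0.
exists dl => // x y r r0 rdl pQ; have /= [up low] := dlP x y r r0 rdl pQ.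
set Q := rect _ _ _ _ in up low *.
have mV := open_measurable_plane oV.
have mPQ : measurable (V `&` Psi @^-1` Q : set (plane R)).
  apply: (measurable_fun_continuous_on2 oV) => //; last exact: measurable_rect.
  by move=> z Vz; apply: differentiable_continuous; exact: dPsi.
have finV : (leb2 R (V `&` Psi @^-1` Q) < +oo)%E.
  by apply: le_lt_trans V_fin; apply: le_measure; rewrite ?inE//; exact: subIsetl.
apply: etaP.
- have [||m1 E1] := @leb2_diff_preimage p (x - eta * r) (x + w * r + eta * r)
    (y - eta * r) (y + h * r + eta * r) Up; [exact: itv_enlarge_le (ltW w0) (ltW r0) (ltW eta0)|
    exact: itv_enlarge_le (ltW h0) (ltW r0) (ltW eta0)|].
  rewrite -lee_fin fineK ?ge0_fin_numE//.
  rewrite (_ : (_ * _)%:E = (jac p * ((x + w * r + eta * r - (x - eta * r)) *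
    (y + h * r + eta * r - (y - eta * r))))%:E); last by congr EFin; ring.
  by rewrite -E1; apply: le_measure; rewrite ?inE.
- have [||m1 E1] := @leb2_diff_preimage p (x + eta * r) (x + w * r - eta * r)
    (y + eta * r) (y + h * r - eta * r) Up; [exact: itv_shrink_le (ltW r0) etaw|
    exact: itv_shrink_le (ltW r0) etah|].
  rewrite -lee_fin fineK ?ge0_fin_numE//.
  rewrite (_ : (_ * _)%:E = (jac p * ((x + w * r - eta * r - (x + eta * r)) *
    (y + h * r - eta * r - (y + eta * r))))%:E); last by congr EFin; ring.
  by rewrite -E1; apply: le_measure; rewrite ?inE.
Qed.

Let mU : measurable (U : set (plane R)). Proof. exact: open_measurable_plane. Qed.
Let mV : measurable (V : set (plane R)). Proof. exact: open_measurable_plane. Qed.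

Let measurable_Psi : measurable_fun setT (Psi \_ V : plane R -> plane R).
Proof.
apply/(measurable_restrictT (Psi : plane R -> plane R) mV).
apply: (measurable_fun_continuous_on2 oV) => z Vz.
by apply: differentiable_continuous; exact: dPsi.
Qed.

Let measurable_Phi : measurable_fun setT (Phi \_ U : plane R -> plane R).
Proof.
apply/(measurable_restrictT (Phi : plane R -> plane R) mU).
apply: (measurable_fun_continuous_on2 oU) => z Uz.
by apply: differentiable_continuous; exact: dPhi.
Qed.

Let measurable_jac : measurable_fun setT (jac \_ U : plane R -> R).
Proof.
apply/(measurable_restrictT (jac : plane R -> R) mU).
exact: (measurable_fun_continuous_on oU).
Qed.

Let jac_ge0 (z : plane R) : 0 <= (jac \_ U) z.
Proof. by rewrite /patch; case: ifP => // _; exact: normr_ge0. Qed.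

(** The measure of the image under [Phi], obtained by pushing Lebesgue measure on [V] forward by
    [Psi]. Patching [Psi] outside [V] makes it measurable on the plane, and the restriction to [V]
    discards the patched values. *)
Let m := pushm (mrestr (leb2 R) mV) measurable_Psi.

Let mE (A : set (plane R)) : m A = leb2 R (V `&` Psi @^-1` A).
Proof.
rewrite /m /pushforward /= /pushforward /mrestr; congr (leb2 R _).
apply/seteqP; split => z /=.
  by move=> [+ Vz]; rewrite /patch mem_set.
by move=> [Vz Az]; split => //; rewrite /patch mem_set.
Qed.

Let nu := density_measure (leb2 R) measurable_jac jac_ge0.

Let nuE (A : set (plane R)) : A `<=` U -> nu A = (\int[leb2 R]_(z in A) (jac z)%:E)%E.
Proof.
move=> AU; rewrite /nu density_measureE; apply: eq_integral => z /[!inE] Az.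
by rewrite /patch mem_set//; exact: AU.
Qed.

Let nu_fin (a b c d : R) : crect a b c d `<=` U -> (nu (rect a b c d) < +oo)%E.
Proof.
move=> QU.
have [M [M0 MP]] := compact_continuous_bounded cjac (@compact_crect R a b c d) QU.
have mQ := measurable_rect a b c d.
rewrite nuE; last exact: subset_trans (@rect_crect R a b c d) QU.
have [ab|ab] := leP a b; last first.
  rewrite (_ : rect _ _ _ _ = set0) ?integral_set0 ?ltry//.
  by rewrite -subset0 => z /rectE[? ? _ _]; lra.
have [cd|cd] := leP c d; last first.
  rewrite (_ : rect _ _ _ _ = set0) ?integral_set0 ?ltry//.
  by rewrite -subset0 => z /rectE[_ _ ? ?]; lra.
have [| | |+ _] := @Rintegral_near_constant R (rect a b c d) jac 0 M mQ.
- by rewrite leb2_rect// ltry.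
- apply: measurable_funS (measurable_fun_continuous_on oU cjac) => //.
  exact: subset_trans (@rect_crect R a b c d) QU.
- by move=> z /rect_crect /MP; rewrite subr0.
by congr (_ < _)%E; apply: eq_integral => z _; rewrite normr_id.
Qed.

Let m_fin (A : set (plane R)) : measurable A -> (m A < +oo)%E.
Proof.
move=> mA; apply: le_lt_trans V_fin; rewrite /m /pushforward /= /mrestr.
apply: le_measure; rewrite ?inE; [|exact: mV|exact: subIsetr].
by apply: measurableI => //; rewrite -[X in measurable X]setTI; exact: measurable_Psi.
Qed.

Let rect_estimate (w h : R) (p : R * R) : 0 < w -> 0 < h -> U p ->
  forall e, 0 < e -> exists2 dl, 0 < dl & forall x y r, 0 < r -> r < dl ->
    crect x (x + w * r) y (y + h * r) p ->
    crect x (x + w * r) y (y + h * r) `<=` U ->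
    `|fine (m (rect x (x + w * r) y (y + h * r))) -
      fine (nu (rect x (x + w * r) y (y + h * r)))| <= e * r ^+ 2.
Proof.
move=> w0 h0 Up e e0.
have e20 : 0 < e / 2 by rewrite divr_gt0.
have wh0 : 0 < w * h by rewrite mulr_gt0.
have [d1 d10 H1] := leb2_preimage_estimate w0 h0 Up e20.
(* The rectangle has area w h r^2, so a variation of the Jacobian by e / (2 w h) costs e r^2 / 2;
   the other half of the error goes to the distortion of the image. *)
have k0 : 0 < e / 2 / (w * h) by rewrite divr_gt0.
have [d2 d20 H2] : exists2 d2, 0 < d2 & forall z, `|z - p| < d2 ->
    `|jac z - jac p| <= e / 2 / (w * h).
  have /cvgrPdist_le/(_ _ k0)/nbhs_normP[d2 /= d20 H] := cjac Up.
  by exists d2 => // z zp; rewrite distrC; apply: H; rewrite /= distrC.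
exists (Num.min d1 (d2 / (w + h))).
  by rewrite lt_min d10 divr_gt0// addr_gt0.
move=> x y r r0; rewrite lt_min ltr_pdivlMr ?addr_gt0// => /andP[rd1 rd2] pQ QU.
have {}H1 := H1 x y r r0 rd1 pQ.
have wr : 0 <= w * r by rewrite mulr_ge0// ltW.
have hr : 0 <= h * r by rewrite mulr_ge0// ltW.
have QU' := subset_trans (@rect_crect R x (x + w * r) y (y + h * r)) QU.
have mQ := measurable_rect x (x + w * r) y (y + h * r).
have lebQ : leb2 R (rect x (x + w * r) y (y + h * r)) = (w * h * r ^+ 2)%:E.
  by rewrite leb2_rect ?lerDl//; congr EFin; ring.
have [| | |_ H3] := @Rintegral_near_constant R _ jac (jac p) (e / 2 / (w * h)) mQ.
- by rewrite lebQ ltry.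
- exact: measurable_funS (measurable_fun_continuous_on oU cjac).
- move=> z /rectE[z1 z2 z3 z4]; apply: H2; apply: le_lt_trans rd2.
  have /crectE[p1 p2 p3 p4] := pQ; rewrite norm2_le mulrDr; apply/andP; split => /=.
    by apply: (le_trans (itv_dist_le (ltW z1) z2 p1 p2)); rewrite addrC addKr mulrC lerDl mulrC.
  by apply: (le_trans (itv_dist_le (ltW z3) z4 p3 p4)); rewrite addrC addKr mulrC lerDr mulrC.
rewrite lebQ [X in _ <= X]mulrA divfK ?gt_eqF// in H3.
rewrite mE nuE// [X in _ <= X * _]splitr mulrDl.
apply: le_trans (lerD H1 H3).
by rewrite [X in _ <= _ + X]distrC; apply: ler_distD.
Qed.

Let m_nu_rect (a b c d : R) : a <= b -> c <= d -> crect a b c d `<=` U ->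
  m (rect a b c d) = nu (rect a b c d).
Proof.
move=> ab cd QU; apply: (measure_rect_bisection ab cd).
- by apply: m_fin; exact: measurable_rect.
- exact: nu_fin.
- move=> w h p w0 h0 pQ e e0; have [dl dl0 H] := rect_estimate w0 h0 (QU p pQ) e0.
  by exists dl => // x y r r0 rdl pr sub; apply: H => //; exact: subset_trans sub QU.
Qed.

(** The set on the left is the image of [A] under [Phi]; as a preimage under [Psi] it is measurable
    at once. *)
Lemma leb2_image (A : set (plane R)) : measurable A -> A `<=` U ->
  leb2 R (V `&` Psi @^-1` A) = (\int[leb2 R]_(z in A) (jac z)%:E)%E.
Proof.
move=> mA AU; rewrite -mE -nuE//.
apply: (measure_eq_open oU) => // a b c d _; apply: m_fin; exact: measurable_rect.
Qed.

(** By [leb2_image], the pushforward of [nu] by [Phi] coincides with Lebesgue measure on the Borel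
    subsets of [V]. What remains is the transfer of integrals through a pushforward and through a
    density. *)
Theorem ge0_change_of_variables (f : plane R -> \bar R) :
  measurable_fun (V : set (plane R)) f -> (forall z, V z -> (0 <= f z)%E) ->
  (\int[leb2 R]_(z in V) f z = \int[leb2 R]_(z in U) (f (Phi z) * (jac z)%:E))%E.
Proof.
move=> mf f0.
have mPhiV : measurable ((Phi \_ U) @^-1` V : set (plane R)).
  by rewrite -[X in measurable X]setTI; exact: measurable_Phi.
have mPhiU := proj2 (measurable_restrictT (Phi : plane R -> plane R) mU) measurable_Phi.
transitivity (\int[pushm nu measurable_Phi]_(y in V) f y)%E.
  apply: eq_measure_integral => A mA AV; rewrite /= /pushforward.
  have mPA : measurable (U `&` Phi @^-1` A : set (plane R)) by exact: mPhiU.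
  have E : (Phi \_ U) @^-1` A `&` U = U `&` Phi @^-1` A.
    by apply/seteqP; split => z /=; rewrite /patch => -[h1 h2]; split => //;
      move: h1 h2; case: ifPn => //; rewrite ?inE ?notin_setE.
  transitivity (\int[leb2 R]_(z in (Phi \_ U) @^-1` A) (jac \_ U z)%:E)%E; last by [].
  apply/esym.
  under eq_integral do rewrite -[(_ \_ _ _)%:E]/((EFin \o (jac \_ U)) _) -restrict_EFin.
  rewrite -integral_mkcondr E -leb2_image//; congr (leb2 R _).
  apply/seteqP; split => z /=; first by move=> [Vz [_]]; rewrite PsiK.
  by move=> Az; have Vz := AV _ Az; split => //; split; [exact: VU|rewrite /preimage/= PsiK].
rewrite ge0_integral_pushforward//; last by move=> y /[!inE]; exact: f0.
rewrite integral_mkcond ge0_integral_density//; first last.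
- move=> x; rewrite /patch; case: ifP => // /[!inE] h; exact: f0.
- apply: (proj1 (measurable_restrictT _ mPhiV)).
  apply: (measurable_comp mV _ mf); last exact: measurable_funTS.
  by move=> _ [z Vz <-].
rewrite [RHS]integral_mkcond; apply: eq_integral => z _.
rewrite /patch /=; have [Uz|Uz] := boolP (z \in U); last by rewrite mule0.
rewrite mem_set// /preimage/= /patch Uz; apply: UV; exact: set_mem.
Qed.

End ChangeOfVariables.

(** * Smooth functions with compact support *)

Section CkCalculus.
Context {R : realType}.
Implicit Types (V W : normedModType R) (k : nat).

Lemma eq_Ck_on V W k (U : set V) (f g : V -> W) : open U -> (forall z, U z -> f z = g z) ->
  Ck_on k U f -> Ck_on k U g.
Proof.
move=> oU; elim: k f g => [|k IH] f g fg /=.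
  move=> cf z Uz; apply: cvg_trans; last by rewrite -(fg z Uz); exact: cf.
  apply: near_eq_cvg; apply: filterS (open_nbhs_nbhs (conj oU Uz)) => w Uw; exact: fg.
move=> [h1 h2].
have dfg z : U z -> differentiable g z /\ 'd g z = 'd f z :> (V -> W).
  move=> Uz; apply: (differentiable_near _ (h1 z Uz)).
  by apply: filterS (open_nbhs_nbhs (conj oU Uz)) => w Uw; exact: fg.
split=> [z /dfg[]//|v]; apply: IH (h2 v) => z /dfg[_ ->//].
Qed.

Lemma Ck_onS V W k (U : set V) (f : V -> W) : Ck_on k.+1 U f -> Ck_on k U f.
Proof.
elim: k f => [|k IH] f /= [h1 h2].
  by move=> z Uz; exact: differentiable_continuous (h1 z Uz).
by split => // v; apply: IH; exact: h2.
Qed.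

Lemma Ck_on_cst V W k (U : set V) (c : W) : open U -> Ck_on k U (fun=> c).
Proof.
move=> oU; elim: k c => [|k IH] c /=; first by move=> z _; exact: cvg_cst.
split => [z _|v]; first exact: differentiable_cst.
apply: eq_Ck_on (IH 0) => // z _; by rewrite diff_cst.
Qed.

Lemma Ck_on_linear V V' W k (U : set V) (L : {linear V' -> W}) (f : V -> V') :
  open U -> continuous L -> Ck_on k U f -> Ck_on k U (L \o f).
Proof.
move=> oU cL; elim: k f => [|k IH] f /=.
  by move=> cf z Uz; apply: continuous_comp; [exact: cf|exact: cL].
move=> [h1 h2]; split=> [z Uz|v].
  by apply: differentiable_comp; [exact: h1|exact: linear_differentiable].
apply: eq_Ck_on (IH _ (h2 v)) => // z Uz.
rewrite diff_comp /=; [|exact: h1|exact: linear_differentiable].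
by rewrite diff_lin.
Qed.

Lemma Ck_on_linear_fun V W k (U : set V) (L : {linear V -> W}) :
  open U -> continuous L -> Ck_on k U L.
Proof.
move=> oU cL; case: k => [|k] /=; first by move=> z _; exact: cL.
split=> [z _|v]; first exact: linear_differentiable.
by apply: eq_Ck_on (Ck_on_cst _ (L v) oU) => // z _; rewrite diff_lin.
Qed.

Lemma Ck_onD V W k (U : set V) (f g : V -> W) : open U ->
  Ck_on k U f -> Ck_on k U g -> Ck_on k U (f \+ g).
Proof.
move=> oU; elim: k f g => [|k IH] f g /=.
  by move=> cf cg z Uz; apply: cvgD; [exact: cf|exact: cg].
move=> [f1 f2] [g1 g2]; split=> [z Uz|v].
  by apply: differentiableD; [exact: f1|exact: g1].
apply: eq_Ck_on (IH _ _ (f2 v) (g2 v)) => // z Uz.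
by rewrite diffD; [|exact: f1|exact: g1].
Qed.

Lemma Ck_onM V k (U : set V) (f g : V -> R) : open U ->
  Ck_on k U f -> Ck_on k U g -> Ck_on k U (f \* g).
Proof.
move=> oU; elim: k f g => [|k IH] f g.
  by move=> cf cg z Uz; apply: cvgM; [exact: cf|exact: cg].
move=> Cf Cg; have [f1 f2] := Cf; have [g1 g2] := Cg; split=> [z Uz|v].
  by apply: differentiableM; [exact: f1|exact: g1].
have Cf' := Ck_onS Cf; have Cg' := Ck_onS Cg.
apply: eq_Ck_on (Ck_onD oU (IH _ _ Cf' (g2 v)) (IH _ _ Cg' (f2 v))) => // z Uz.
by rewrite diffM; [|exact: f1|exact: g1].
Qed.

Lemma Ck_onZ V k (U : set V) (c : R) (f : V -> R) : open U ->
  Ck_on k U f -> Ck_on k U (fun z => c * f z).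
Proof. by move=> oU Cf; apply: Ck_onM => //; exact: Ck_on_cst. Qed.

Lemma Ck_on_comp1 V k (U : set V) (g : R -> R) (f : V -> R) : open U ->
  Ck_on k setT g -> Ck_on k U f -> Ck_on k U (g \o f).
Proof.
move=> oU; elim: k g f => [|k IH] g f.
  by move=> cg cf z Uz; apply: continuous_comp; [exact: cf|exact: cg].
move=> [g1 g2] Cf; have [f1 f2] := Cf; split=> [z Uz|v].
  by apply: differentiable_comp; [exact: f1|exact: g1].
apply: eq_Ck_on (Ck_onM oU (f2 v) (IH _ _ (g2 1) (Ck_onS Cf))) => // z Uz.
rewrite diff_comp /=; [|exact: f1|exact: g1].
by rewrite -[X in _ = 'd g _ X]mulr1 -[X in _ = 'd g _ X]/(_ *: _) linearZ.
Qed.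

Lemma continuous_fst2 : continuous (fst : R * R -> R).
Proof. by move=> z; exact: cvg_fst. Qed.

Lemma continuous_snd2 : continuous (snd : R * R -> R).
Proof. by move=> z; exact: cvg_snd. Qed.

Lemma Ck_on_fst V k (U : set V) (f : V -> R * R) : open U -> Ck_on k U f ->
  Ck_on k U (fst \o f).
Proof. move=> oU; apply: Ck_on_linear => //; exact: continuous_fst2. Qed.

Lemma Ck_on_snd V k (U : set V) (f : V -> R * R) : open U -> Ck_on k U f ->
  Ck_on k U (snd \o f).
Proof. move=> oU; apply: Ck_on_linear => //; exact: continuous_snd2. Qed.

Lemma diff_comp2 V (f : R * R -> R) (g : V -> R * R) (z v : V) :
  differentiable g z -> differentiable f (g z) ->
  'd (f \o g) z v = ('d g z v).1 * 'd f (g z) (e_x R) + ('d g z v).2 * 'd f (g z) (e_y R).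
Proof. by move=> dg df; rewrite diff_comp//= linear2E. Qed.

(** In coordinates the derivative of the composite is a sum of two products, whose factors are of
    class C^k by the assumption on [f], by the induction hypothesis and by [Ck_onS]. *)
Lemma Ck_on_comp2 V k (U : set V) (U' : set (R * R)) (g : R * R -> R) (f : V -> R * R) :
  open U -> (forall z, U z -> U' (f z)) ->
  Ck_on k U' g -> Ck_on k U f -> Ck_on k U (g \o f).
Proof.
move=> oU UU'; elim: k g f UU' => [|k IH] g f UU'.
  by move=> cg cf z Uz; apply: continuous_comp; [exact: cf|exact/cg/UU'].
move=> [g1 g2] Cf; have [f1 f2] := Cf; split=> [z Uz|v].
  by apply: differentiable_comp; [exact: f1|exact/g1/UU'].
have Cf' := Ck_onS Cf.
apply: eq_Ck_on (Ck_onD oU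
  (Ck_onM oU (Ck_on_fst oU (f2 v)) (IH _ _ UU' (g2 (e_x R)) Cf'))
  (Ck_onM oU (Ck_on_snd oU (f2 v)) (IH _ _ UU' (g2 (e_y R)) Cf'))) => // z Uz.
by rewrite diff_comp2//; [exact: f1|exact/g1/UU'].
Qed.

End CkCalculus.

(** * Test functions *)

Section CcInfty.
Context {R : realType}.
Implicit Types (f g : R * R -> R).
Local Notation D := (disk R).

Lemma smooth_diff (W : normedModType R) (f : R * R -> W) z :
  smooth_on D f -> D z -> differentiable f z.
Proof. by move=> /(_ 1%N)[h _]; exact: h. Qed.

Lemma smooth_continuous f z : smooth_on D f -> D z -> {for z, continuous f}.
Proof. by move=> /(_ 0%N) h; exact: h. Qed.

Lemma smooth_diff_dir f v : smooth_on D f -> smooth_on D (fun z => 'd f z v).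
Proof. by move=> sf k; have [_] := sf k.+1; exact. Qed.

(** Frees the later proofs from closures: sums, products and composites only have to exhibit some
    compact subset of the disk outside which they vanish. *)
Lemma Cc_inftyP f : Cc_infty f <-> smooth_on D f /\
  exists K, [/\ compact K, K `<=` D & forall z, D z -> ~ K z -> f z = 0].
Proof.
split=> [[sf cf]|[sf [K [cK KD Kf]]]].
  split => //; exists (disk_support f); split => //; first by move=> z [].
  move=> z Dz; apply: contra_notP => /eqP fz; split => //.
  by apply: subset_closure; split.
split => //.
have cl : closure [set z | D z /\ f z != 0] `<=` K.
  have clK : closed K by exact: compact_closed cK.
  rewrite [X in _ `<=` X]((closure_id K).1 clK).
  by apply: closure_subset => z [Dz]; apply: contra_neqP; exact: Kf.
apply: (subclosed_compact _ cK).
  rewrite (_ : disk_support f = closure [set z | D z /\ f z != 0]).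
    exact: closed_closure.
  by apply/seteqP; split => z; [case|move=> cz; split => //; apply: KD; exact: cl].
by move=> z [_ /cl].
Qed.

Lemma Cc_smooth f : Cc_infty f -> smooth_on D f. Proof. by case. Qed.

Lemma Cc_infty_lin (a : R) f g : Cc_infty f -> Cc_infty g ->
  Cc_infty (fun z => a * f z + g z).
Proof.
move=> /Cc_inftyP[sf [K [cK KD Kf]]] /Cc_inftyP[sg [L [cL LD Lg]]].
apply/Cc_inftyP; split.
  move=> k; apply: Ck_onD; [exact: open_disk| |exact: sg].
  by apply: Ck_onZ; [exact: open_disk|exact: sf].
exists (K `|` L); split; first exact: compactU.
  by move=> z [/KD|/LD].
by move=> z Dz /not_orP[Kz Lz]; rewrite Kf// Lg// mulr0 addr0.
Qed.

Lemma Cc_inftyMl f g : smooth_on D f -> Cc_infty g -> Cc_infty (f \* g).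
Proof.
move=> sf /Cc_inftyP[sg [L [cL LD Lg]]].
apply/Cc_inftyP; split; last by exists L; split => // z Dz /Lg /= ->//; rewrite mulr0.
by move=> k; apply: Ck_onM; [exact: open_disk|exact: sf|exact: sg].
Qed.

Lemma Cc_infty_diff f v : Cc_infty f -> Cc_infty (fun z => 'd f z v).
Proof.
move=> /Cc_inftyP[sf [K [cK KD Kf]]].
apply/Cc_inftyP; split; first exact: smooth_diff_dir.
exists K; split => // z Dz Kz.
have cl : closed K by exact: compact_closed cK.
have H : {near z, (fun=> 0) =1 f}.
  have : nbhs z (D `&` ~` K).
    apply: filterI; first exact: disk_nbhs.
    by apply: open_nbhs_nbhs; split => //; exact: closed_openC.
  by apply: filterS => w [Dw Kw]; rewrite Kf.
have [_ ->] := differentiable_near H (differentiable_cst _ _).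
by rewrite diff_cst.
Qed.

(** The composite vanishes outside the image under [Psi] of the old compact set, which is compact
    because [Psi] is continuous. *)
Lemma Cc_infty_comp f (Phi Psi : R * R -> R * R) :
  (forall z, D z -> D (Phi z)) -> (forall z, D z -> D (Psi z)) ->
  smooth_on D Phi -> smooth_on D Psi -> (forall z, D z -> Psi (Phi z) = z) ->
  Cc_infty f -> Cc_infty (f \o Phi).
Proof.
move=> PD QD sP sQ PK /Cc_inftyP[sf [K [cK KD Kf]]].
apply/Cc_inftyP; split.
  by move=> k; apply: (Ck_on_comp2 _ PD); [exact: open_disk|exact: sf|exact: sP].
exists (Psi @` K); split.
- apply: continuous_compact => //; apply: continuous_in_subspaceT => z.
  rewrite inE => /KD Dz; exact: (sQ 0%N).
- by move=> _ [z /KD Dz <-]; exact: QD.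
- move=> z Dz Kz /=; apply: Kf; first exact: PD.
  by apply: contra_not Kz => Kz; exists (Phi z) => //; exact: PK.
Qed.

End CcInfty.

(** * The flat exponential and smooth bumps *)

Section FlatExp.
Context {R : realType}.
Implicit Types (t : R) (n : nat).

(** The factor t^-n makes the family stable under differentiation: the derivative of the n-th
    function is -n times the (n+1)-th plus the (n+2)-th. All of them are then proved smooth by one
    induction. *)
Definition flat_exp n t : R := if 0 < t then t^-1 ^+ n * expR (- t^-1) else 0.

Lemma flat_exp_le0 n t : t <= 0 -> flat_exp n t = 0.
Proof. by rewrite /flat_exp ltNge => ->. Qed.

Lemma flat_exp_ge0 n t : 0 <= flat_exp n t.
Proof.
rewrite /flat_exp; case: ifP => // t0.
by rewrite mulr_ge0 ?expR_ge0// exprn_ge0// invr_ge0 ltW.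
Qed.

(** Comes from s^(n+2) <= (n+2)! e^s at s = 1/t. A bound of order t^2 makes the derivative at 0
    vanish. *)
Lemma flat_exp_quad n t : flat_exp n t <= n.+2`!%:R * t ^+ 2.
Proof.
rewrite /flat_exp; case: ifP => [t0|_]; last by rewrite mulr_ge0// sqr_ge0.
have s0 : 0 <= t^-1 by rewrite invr_ge0 ltW.
have fact0 : 0 < n.+2`!%:R :> R by rewrite ltr0n fact_gt0.
have : t^-1 ^+ n.+2 <= n.+2`!%:R * expR t^-1.
  rewrite mulrC -ler_pdivrMr//; apply: le_trans (expR_ge1Dxn n.+1 s0).
  by rewrite lerDr.
move=> /(ler_wpM2r (expR_ge0 (- t^-1))); rewrite -[X in _ <= X]mulrA expRxMexpNx_1 mulr1 => H.
rewrite -ler_pdivrMr ?exprn_gt0//; apply: le_trans H.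
by rewrite -[in X in _ <= X]addn2 exprD [X in _ <= _ * X * _]exprVn mulrAC.
Qed.

Lemma near_gt0 t : 0 < t -> \forall x \near t, 0 < x.
Proof. by move=> t0; apply: open_nbhs_nbhs; split => //; exact: open_gt. Qed.

Lemma near_lt0 t : t < 0 -> \forall x \near t, x < 0.
Proof. by move=> t0; apply: open_nbhs_nbhs; split => //; exact: open_lt. Qed.

Lemma is_derive_flat_exp n t : 0 < t ->
  is_derive t 1 (flat_exp n) (- n%:R * flat_exp n.+1 t + flat_exp n.+2 t).
Proof.
move=> t0.
have tn0 : t != 0 by rewrite gt_eqF.
pose v : R -> R := fun x => x^-1.
have dV : is_derive t 1 v (- t ^- 2 *: 1) by exact: is_deriveV.
have dE : is_derive t 1 (expR \o - v) (expR ((- v) t) * - (- t ^- 2 *: 1)).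
  by apply: is_derive1_comp; exact: is_deriveN.
have dF := is_deriveM (is_deriveX n dV) dE.
have E : {near t, v ^+ n * (expR \o - v) =1 flat_exp n}.
  by apply: filterS (near_gt0 t0) => x x0; rewrite /flat_exp x0 !fctE.
have := near_eq_is_derive E dF; congr (is_derive _ _ _ _).
rewrite /flat_exp t0 !fctE /= /v /GRing.scale/= !mulr1 -exprVn.
case: n {dF E} => [|n] /=; first by rewrite !mul0r !mulr0 oppr0 mul0r expr0 !mul1r; ring.
by rewrite !exprS; ring.
Qed.

Lemma diff_flat_exp n t : differentiable (flat_exp n) t /\
  forall h, 'd (flat_exp n) t h = h * (- n%:R * flat_exp n.+1 t + flat_exp n.+2 t).
Proof.
have [t0|t0|t0] := ltgtP 0 t.
- have dF := is_derive_flat_exp n t0.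
  have df : differentiable (flat_exp n) t by apply/derivable1_diffP; case: dF.
  split => // h; rewrite diff1E// derive1E.
  by rewrite (@derive_val _ _ _ _ _ _ _ dF).
- have E : {near t, (fun=> 0 : R) =1 flat_exp n}.
    by apply: filterS (near_lt0 t0) => x x0; rewrite flat_exp_le0// ltW.
  have [df dE] := differentiable_near E (differentiable_cst _ _).
  split => // h; rewrite dE diff_cst.
  by rewrite !flat_exp_le0 ?(ltW t0)// mulr0 addr0 mulr0.
- rewrite -t0; have [||df dE] := @differentiable_of_estimate _ _ _ (flat_exp n) 0 ('d (fun=> 0 : R) (0 : R)).
  + by apply: diff_continuous; exact: differentiable_cst.
  + move=> e e0; have fact0 : 0 < n.+2`!%:R :> R by rewrite ltr0n fact_gt0.
    near=> h; rewrite diff_cst addr0 [flat_exp n 0]flat_exp_le0// !subr0.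
    rewrite ger0_norm ?flat_exp_ge0// (le_trans (flat_exp_quad n h))//.
    rewrite -real_normK ?num_real// expr2 mulrA ler_wpM2r// -ler_pdivlMl//.
    apply: ltW; rewrite mulrC; near: h.
    apply/nbhs_normP; exists (e / n.+2`!%:R) => /=; first exact: divr_gt0.
    by move=> h /=; rewrite sub0r normrN.
  split => // h; rewrite dE diff_cst.
  by rewrite !flat_exp_le0// mulr0 addr0 mulr0.
Unshelve. all: by end_near.
Qed.

Lemma Ck_flat_exp k n : Ck_on k setT (flat_exp n).
Proof.
elim: k n => [|k IH] n.
  by move=> t _; apply: differentiable_continuous; have [] := diff_flat_exp n t.
split=> [t _|h]; first by have [] := diff_flat_exp n t.
have oT : open [set: R] by exact: openT.
apply: eq_Ck_on (Ck_onD oT (Ck_onZ (h * - n%:R) oT (IH n.+1)) (Ck_onZ h oT (IH n.+2))) => //.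
by move=> t _; have [_ ->] := diff_flat_exp n t; rewrite /= mulrDr mulrA.
Qed.

Lemma flat_exp_le1 t : flat_exp 0 t <= 1.
Proof.
rewrite /flat_exp; case: ifP => // t0; rewrite expr0 mul1r.
by rewrite -expR0 ler_expR oppr_le0 invr_ge0 ltW.
Qed.

Lemma flat_exp_cvg t : flat_exp 0 (n%:R * t) @[n --> \oo] --> ((0 < t)%R%:R : R).
Proof.
have [t0|t0] := ltP 0 t; last first.
  rewrite (_ : (fun n => _) = fun=> 0); first exact: cvg_cst.
  by apply/funext => n; rewrite flat_exp_le0// mulr_ge0_le0.
have H : expR (- (harmonic n * t^-1)) @[n --> \oo] --> (1 : R).
  have H0 : - (harmonic n * t^-1) @[n --> \oo] --> (0 : R).
    rewrite -oppr0; apply: cvgN; rewrite -(mul0r t^-1); apply: cvgMl.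
    exact: cvg_harmonic.
  by rewrite -expR0; exact: (cvg_comp _ _ H0 (@continuous_expR R 0)).
rewrite -cvg_shiftS /=; apply: cvg_trans H; apply: near_eq_cvg; apply: nearW => n.
by rewrite /flat_exp mulr_gt0// expr0 mul1r invfM.
Qed.

End FlatExp.

Section Bump.
Context {R : realType}.
Implicit Types (a b c d : R).

(* As n grows, it converges to the indicator function of ]a, b[ x ]c, d[. *)
Definition bump a b c d n (z : R * R) : R :=
  flat_exp 0 (n%:R * (z.1 - a)) * flat_exp 0 (n%:R * (b - z.1)) *
  (flat_exp 0 (n%:R * (z.2 - c)) * flat_exp 0 (n%:R * (d - z.2))).

Lemma bump_ge0 a b c d n z : 0 <= bump a b c d n z.
Proof. by rewrite !mulr_ge0// flat_exp_ge0. Qed.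

Lemma bump_le1 a b c d n z : bump a b c d n z <= 1.
Proof. by rewrite !mulr_ile1 ?mulr_ge0 ?flat_exp_ge0 ?flat_exp_le1. Qed.

Lemma bump_eq0 a b c d n z : ~ crect a b c d z -> bump a b c d n z = 0.
Proof.
move=> zn; have n0 : 0 <= n%:R :> R by [].
have [h1|h1] := leP z.1 a.
  by rewrite /bump flat_exp_le0 ?mul0r// mulr_ge0_le0// subr_le0.
have [h2|h2] := leP b z.1.
  by rewrite /bump [X in _ * X * _]flat_exp_le0 ?mulr0 ?mul0r// mulr_ge0_le0// subr_le0.
have [h3|h3] := leP z.2 c.
  by rewrite /bump [X in _ * (X * _)]flat_exp_le0 ?mul0r ?mulr0// mulr_ge0_le0// subr_le0.
have [h4|h4] := leP d z.2.
  by rewrite /bump [X in _ * (_ * X)]flat_exp_le0 ?mulr0// mulr_ge0_le0// subr_le0.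
by exfalso; apply: zn; apply/crectE; split; exact: ltW.
Qed.

(** The excluded lines carry the right and upper sides, which belong to the half-open rectangle
    although every bump vanishes there. *)
Lemma bump_cvg a b c d z : z.1 != b -> z.2 != d ->
  bump a b c d n z @[n --> \oo] --> (\1_(rect a b c d) z : R).
Proof.
move=> zb zd.
have -> : (\1_(rect a b c d) z : R) = (0 < z.1 - a)%R%:R * (0 < b - z.1)%R%:R *
   ((0 < z.2 - c)%R%:R * (0 < d - z.2)%R%:R).
  rewrite indicE -!natrM !mulnb; congr ((nat_of_bool _)%:R).
  rewrite !subr_gt0; apply/idP/idP.
    rewrite inE => /rectE[-> h1 -> h2] /=.
    by rewrite !lt_neqAle zb zd h1 h2.
  by move=> /andP[/andP[h1 h2] /andP[h3 h4]]; rewrite inE; apply/rectE; split => //; exact: ltW.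
by apply: cvgM; apply: cvgM; exact: flat_exp_cvg.
Qed.

Lemma smooth_bump a b c d n : smooth_on (disk R) (bump a b c d n).
Proof.
move=> k; have oD := @open_disk R.
have C1 : Ck_on k (disk R) (fst : R * R -> R).
  by apply: Ck_on_linear_fun => //; exact: continuous_fst2.
have C2 : Ck_on k (disk R) (snd : R * R -> R).
  by apply: Ck_on_linear_fun => //; exact: continuous_snd2.
have aux (f : R * R -> R) (s t : R) : Ck_on k (disk R) f ->
    Ck_on k (disk R) (fun z => flat_exp 0 (n%:R * (s * f z + t))).
  move=> Cf; apply: (@Ck_on_comp1 _ _ _ _ (flat_exp 0) (fun z => n%:R * (s * f z + t))) => //.
    exact: Ck_flat_exp.
  apply: Ck_onZ => //; apply: Ck_onD => //; last exact: Ck_on_cst.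
  exact: Ck_onZ.
have E : bump a b c d n = (fun z : R * R => flat_exp 0 (n%:R * (1 * z.1 + - a)) * flat_exp 0 (n%:R * (-1 * z.1 + b)) *
  (flat_exp 0 (n%:R * (1 * z.2 + - c)) * flat_exp 0 (n%:R * (-1 * z.2 + d)))).
  by apply/funext => z; rewrite /bump; congr (_ * _ * (_ * _)); congr (flat_exp _ (_ * _)); ring.
rewrite E; apply: Ck_onM => //; apply: Ck_onM => //; exact: aux.
Qed.

Lemma Cc_bump a b c d n : crect a b c d `<=` disk R -> Cc_infty (bump a b c d n).
Proof.
move=> sub; apply/Cc_inftyP; split; first exact: smooth_bump.
by exists (crect a b c d); split => // [|z _]; [exact: compact_crect|exact: bump_eq0].
Qed.

End Bump.

(** * Integrals over the disk and weak gradients *)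

Section IntegrationOnDisk.
Context {R : realType}.
Implicit Types (u v w f g : R * R -> R).
Local Notation D := (disk R : set (plane R)).
Local Notation mD := (@measurable_disk R).

Definition L1_disk f : Prop := (leb2 R).-integrable D (EFin \o f).

Lemma L1_measurable f : L1_disk f -> measurable_fun D (f : plane R -> R).
Proof. by move=> /measurable_int /measurable_EFinP. Qed.

Lemma L1_lin (a : R) f g : L1_disk f -> L1_disk g -> L1_disk (fun z => a * f z + g z).
Proof.
move=> Lf Lg.
have := integrableD mD (integrableZl mD a Lf) Lg.
by apply: eq_integrable => //; exact: mD.
Qed.

Lemma diskint_lin (a : R) f g : L1_disk f -> L1_disk g ->
  diskint (fun z => a * f z + g z) = a * diskint f + diskint g.
Proof.
move=> Lf Lg; have Laf : L1_disk (fun z => a * f z).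
  by apply: eq_integrable (integrableZl mD a Lf) => //; exact: mD.
by rewrite /diskint RintegralD//; [rewrite RintegralZl//; exact: mD|exact: mD].
Qed.

Lemma L1Z (a : R) f : L1_disk f -> L1_disk (fun z => a * f z).
Proof. by move=> Lf; apply: eq_integrable (integrableZl mD a Lf) => //; exact: mD. Qed.

Lemma diskintZ (a : R) f : L1_disk f -> diskint (fun z => a * f z) = a * diskint f.
Proof. by move=> Lf; rewrite /diskint RintegralZl//; exact: mD. Qed.

Lemma L1D f g : L1_disk f -> L1_disk g -> L1_disk (fun z => f z + g z).
Proof.
by move=> Lf Lg; apply: eq_integrable (integrableD mD Lf Lg) => //; exact: mD.
Qed.

Lemma diskintD f g : L1_disk f -> L1_disk g ->
  diskint (fun z => f z + g z) = diskint f + diskint g.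
Proof. by move=> Lf Lg; rewrite /diskint RintegralD//; exact: mD. Qed.

Lemma diskint_ge0 f : (forall z, disk R z -> 0 <= f z) -> 0 <= diskint f.
Proof. by move=> f0; rewrite /diskint; apply: Rintegral_ge0. Qed.

Lemma le_diskint f g : L1_disk f -> L1_disk g -> (forall z, disk R z -> f z <= g z) ->
  diskint f <= diskint g.
Proof. by move=> Lf Lg fg; apply: le_Rintegral => //; exact: mD. Qed.

Lemma eq_diskint f g : (forall z, disk R z -> f z = g z) -> diskint f = diskint g.
Proof. by move=> fg; apply: eq_Rintegral => z /[!inE]; exact: fg. Qed.

Lemma eq_L1 f g : (forall z, disk R z -> f z = g z) -> L1_disk f -> L1_disk g.
Proof.
move=> fg; apply: eq_integrable; first exact: mD.
by move=> z /[!inE] Dz /=; rewrite fg.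
Qed.

Lemma ae_eq_diskint f g : measurable_fun D (f : plane R -> R) ->
  measurable_fun D (g : plane R -> R) -> ae_eq_on_disk f g -> diskint f = diskint g.
Proof.
move=> mf mg fg; congr fine; apply: ae_eq_integral; first exact: mD.
- exact/measurable_EFinP.
- exact/measurable_EFinP.
- by apply: filterS fg => z h Dz; rewrite h.
Qed.

Lemma le_L1 f g : measurable_fun D (f : plane R -> R) -> L1_disk g ->
  (forall z, disk R z -> `|f z| <= g z) -> L1_disk f.
Proof.
move=> mf Lg fg.
pose f' := f \_ D; pose g' := g \_ D.
apply: (@eq_L1 f') => [z Dz|]; first by rewrite /f' patchE mem_set.
apply: (@le_integrable _ _ _ _ _ mD _ (EFin \o g')).
- apply/measurable_EFinP; apply: eq_measurable_fun mf => z zD.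
  by rewrite /f' patchE zD.
- move=> z Dz /=; rewrite /f' /g' !patchE mem_set// lee_fin.
  by rewrite (le_trans (fg z Dz))// ler_norm.
- by apply: eq_L1 Lg => z Dz; rewrite /g' patchE mem_set.
Qed.

Lemma bounded_L1 f (M : R) : measurable_fun D (f : plane R -> R) ->
  (forall z, disk R z -> `|f z| <= M) -> L1_disk f.
Proof.
move=> mf fM; apply: measurable_bounded_integrable => //.
- exact: mD.
- exact: leb2_disk_fin.
- by exists M; split; [exact: num_real|move=> N MN z Dz; exact: le_trans (fM z Dz) (ltW MN)].
Qed.

Lemma L2_measurable u : L2_disk u -> measurable_fun D (u : plane R -> R).
Proof. by case. Qed.

Lemma L2_sqr u : L2_disk u -> L1_disk (fun z => u z ^+ 2).
Proof. by case. Qed.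

Lemma L1_mulr u v : L2_disk u -> L2_disk v -> L1_disk (fun z => u z * v z).
Proof.
move=> [mu Lu] [mv Lv]; apply: (le_L1 _ (L1D Lu Lv)).
  exact: measurable_funM.
move=> z _; rewrite ler_norml; have := sqr_ge0 (u z + v z); have := sqr_ge0 (u z - v z).
have := sqr_ge0 (u z); have := sqr_ge0 (v z).
have -> : (u z + v z) ^+ 2 = u z ^+ 2 + 2 * (u z * v z) + v z ^+ 2 by ring.
have -> : (u z - v z) ^+ 2 = u z ^+ 2 - 2 * (u z * v z) + v z ^+ 2 by ring.
by move: (u z * v z) (u z ^+ 2) (v z ^+ 2) => p a b; lra.
Qed.

Lemma L2_lin (a : R) u v : L2_disk u -> L2_disk v -> L2_disk (fun z => a * u z + v z).
Proof.
move=> Lu Lv; split.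
  by apply: measurable_funD; [apply: measurable_funM => //|]; exact: L2_measurable.
have : L1_disk (fun z => a ^+ 2 * u z ^+ 2 + (a * 2 * (u z * v z) + v z ^+ 2)).
  apply: L1_lin; first exact: L2_sqr.
  by apply: L1_lin; [exact: L1_mulr|exact: L2_sqr].
by apply: eq_L1 => z _; ring.
Qed.

Lemma bounded_L2 f (M : R) : measurable_fun D (f : plane R -> R) ->
  (forall z, disk R z -> `|f z| <= M) -> L2_disk f.
Proof.
move=> mf fM; split=> //; apply: (@bounded_L1 _ (M ^+ 2)).
  exact: measurable_funX.
by move=> z Dz; rewrite normrX lerXn2r ?nnegrE ?fM// (le_trans _ (fM z Dz)).
Qed.

Lemma L2_cst (c : R) : L2_disk (fun=> c).
Proof. by apply: (@bounded_L2 _ `|c|) => //; exact: measurable_cst. Qed.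

Lemma L2_L1 u : L2_disk u -> L1_disk u.
Proof. by move=> Lu; apply: eq_L1 (L1_mulr Lu (L2_cst 1)) => z _; rewrite mulr1. Qed.

(** The integral of (t u + v)^2 is a nonnegative polynomial in t. It is evaluated at its minimum -b
    / a or, when a = 0 and b is nonzero, at the point where 2 t b + c would equal -1. *)
Lemma diskint_CS u v : L2_disk u -> L2_disk v ->
  diskint (fun z => u z * v z) ^+ 2 <=
  diskint (fun z => u z ^+ 2) * diskint (fun z => v z ^+ 2).
Proof.
move=> Lu Lv; set a := diskint (fun z => u z ^+ 2); set b := diskint _; set c := diskint _.
have Luv := L1_mulr Lu Lv.
have Q t : 0 <= t ^+ 2 * a + (2 * t * b + c).
  rewrite /a /b /c -!diskint_lin//; try exact: L2_sqr; last first.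
    by apply: L1_lin => //; exact: L2_sqr.
  apply: diskint_ge0 => z _; rewrite (_ : _ + _ = (t * u z + v z) ^+ 2) ?sqr_ge0//; ring.
have a0 : 0 <= a by apply: diskint_ge0 => z _; exact: sqr_ge0.
have c0 : 0 <= c by apply: diskint_ge0 => z _; exact: sqr_ge0.
have [a_eq0|a_neq0] := eqVneq a 0.
  rewrite a_eq0 mul0r; have [->|b0] := eqVneq b 0; first by rewrite expr0n.
  have := Q (- (c + 1) / (2 * b)); rewrite a_eq0 mulr0 add0r.
  rewrite (_ : 2 * _ * b + c = -1); last by field.
  by rewrite oppr_ge0 ler10.
have := Q (- b / a); have ap : 0 < a by rewrite lt_neqAle eq_sym a_neq0.
rewrite (_ : _ + _ = (a * c - b ^+ 2) / a); last by field.
by rewrite pmulr_lge0 ?invr_gt0// subr_ge0.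
Qed.

Lemma L2_ae_eq0 u : L2_disk u -> diskint (fun z => u z ^+ 2) = 0 ->
  ae_eq_on_disk u (fun=> 0).
Proof.
move=> [mu Lu] u0.
have mu2 : measurable_fun D (EFin \o (fun z : plane R => u z ^+ 2)).
  by apply/measurable_EFinP; exact: measurable_funX.
have : ae_eq (leb2 R) D (EFin \o (fun z => u z ^+ 2)) (cst 0%E).
  apply/(ae_eq_integral_abs (leb2 R) mD mu2).
  transitivity (\int[leb2 R]_(z in D) (u z ^+ 2)%:E)%E.
    by apply: eq_integral => z _ /=; rewrite ger0_norm ?sqr_ge0.
  rewrite -(@fineK _ (\int[leb2 R]_(z in D) (u z ^+ 2)%:E)%E).
    by congr EFin; rewrite -u0.
  by apply: integrable_fin_num => //; exact: mD.
apply: filterS => z h Dz; have := h Dz; rewrite /= => -[/eqP].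
by rewrite sqrf_eq0 => /eqP.
Qed.

End IntegrationOnDisk.

(** * Integration by parts and Poincare's inequality for test functions *)

Section CcIntegrals.
Context {R : realType}.
Implicit Types (f g : R * R -> R).
Local Notation D := (disk R : set (plane R)).
Local Notation mu := (@lebesgue_measure R).
Local Notation mD := (@measurable_disk R).

Lemma Cc_measurable f : Cc_infty f -> measurable_fun D (f : plane R -> R).
Proof.
move=> [sf _]; apply: measurable_fun_continuous_on; first exact: open_disk.
by move=> z Dz; exact: smooth_continuous.
Qed.

Lemma Cc_bounded f : Cc_infty f -> exists M, forall z, disk R z -> `|f z| <= M.
Proof.
move=> /Cc_inftyP[sf [K [cK KD Kf]]].
have [|M [M0 MP]] := @compact_continuous_bounded R (disk R) K f _ cK KD.
  by move=> z; exact: smooth_continuous.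
exists M => z Dz; have [/MP//|Kz] := pselect (K z).
by rewrite Kf// normr0 ltW.
Qed.

Lemma Cc_L2 f : Cc_infty f -> L2_disk f.
Proof. by move=> Cf; have [M MP] := Cc_bounded Cf; exact: bounded_L2 (Cc_measurable Cf) MP. Qed.

Lemma Cc_L1 f : Cc_infty f -> L1_disk f.
Proof. by move=> /Cc_L2; exact: L2_L1. Qed.

(** Every point outside the disk, boundary points included, has a neighborhood that misses the
    compact support. The extension by zero lets integrals over the disk be computed along full
    lines. *)
Lemma Cc_patch_differentiable f : Cc_infty f -> forall z,
  differentiable (f \_ (disk R)) z /\
  forall e, 'd (f \_ (disk R)) z e = ((fun w => 'd f w e) \_ (disk R)) z.
Proof.
move=> /Cc_inftyP[sf [K [cK KD Kf]]] z.
have [Dz|Dz] := pselect (disk R z).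
  have H : {near z, f =1 f \_ (disk R)}.
    by apply: filterS (disk_nbhs Dz) => w Dw; rewrite patchE mem_set.
  have [df dE] := differentiable_near H (smooth_diff sf Dz).
  split; [exact: df|move=> e].
  by transitivity ('d f z e); [exact: (congr1 (fun L => L e) dE)|rewrite /patch mem_set].
have H : {near z, (fun=> 0 : R) =1 f \_ (disk R)}.
  have cl : closed K by exact: compact_closed cK.
  have : nbhs z (~` K).
    by apply: open_nbhs_nbhs; split; [exact: closed_openC|move=> /KD].
  apply: filterS => w Kw; rewrite patchE; case: ifPn => // /[!inE] Dw.
  by rewrite Kf.
have [df dE] := differentiable_near H (differentiable_cst _ _).
split; [exact: df|move=> e].
transitivity (0 : R); last by rewrite /patch memNset.
by transitivity ('d (fun=> 0 : R) z e); [exact: (congr1 (fun L => L e) dE)|rewrite diff_cst].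
Qed.

Lemma Cc_patch_continuous f : Cc_infty f -> continuous (f \_ (disk R)).
Proof.
by move=> Cf z; apply: differentiable_continuous; have [] := Cc_patch_differentiable Cf z.
Qed.

Lemma integral_derivative_eq0 (F f : R -> R) :
  (forall x : R, is_derive x (1 : R) F (f x)) -> continuous f ->
  (forall x, 1 <= `|x| -> F x = 0) -> (forall x, 1 <= `|x| -> f x = 0) ->
  (\int[mu]_x (f x)%:E = 0)%E.
Proof.
move=> dF cf F0 f0.
have -> : (\int[mu]_x (f x)%:E = \int[mu]_(x in `[(-1)%R, 1%R]) (f x)%:E)%E.
  rewrite [RHS]integral_mkcond; apply: eq_integral => x _.
  rewrite patchE; case: ifPn => //; rewrite notin_setE /= in_itv/= => /negP.
  rewrite -ler_norml -ltNge => /ltW /f0 ->; by [].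
rewrite (@continuous_FTC2 _ f F (-1) 1).
- by rewrite !F0 ?normrN ?normr1// subee.
- by lra.
- by apply: continuous_subspaceT.
- have cF x : {for x, continuous F}.
    by apply: differentiable_continuous; apply/derivable1_diffP; case: (dF x).
  split.
  + by move=> x _; case: (dF x).
  + by apply: cvg_at_right_filter; exact: cF.
  + by apply: cvg_at_left_filter; exact: cF.
- by move=> x _; rewrite derive1E; exact: (@derive_val _ _ _ _ _ _ _ (dF x)).
Qed.

Lemma patch_disk_slice f z : 1 <= `|z.1| \/ 1 <= `|z.2| -> (f \_ (disk R)) z = 0.
Proof.
move=> h; rewrite patchE; case: ifPn => // /[!inE] /disk_coord [h1 h2].
by case: h; rewrite leNgt ?h1 ?h2.
Qed.

Lemma diskint_patch_integrable f : Cc_infty f ->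
  (leb2 R).-integrable setT (EFin \o (f \_ (disk R))).
Proof.
move=> Cf; have := Cc_L1 Cf; rewrite /L1_disk => Lf.
by rewrite -restrict_EFin; apply/integrable_restrict; rewrite ?setTI//; exact: mD.
Qed.

Lemma diskint_patch f : diskint f = fine (\int[leb2 R]_z ((f \_ (disk R)) z)%:E)%E.
Proof.
rewrite /diskint /Rintegral integral_mkcond; congr fine.
by apply: eq_integral => z _; rewrite restrict_EFin.
Qed.

Lemma is_derive_slice1 (F : R * R -> R) (x y : R) : differentiable F (x, y) ->
  is_derive x 1 (fun x => F (x, y)) ('d F (x, y) (e_x R)).
Proof.
move=> dF; have dp : is_diff x (fun t : R => (t, y)) (fun h => (h, 0)).
  exact: is_diff_pair.
have H : is_diff x (F \o (fun t : R => (t, y))) ('d F (x, y) \o (fun h => (h, 0))).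
  by apply: is_diff_comp; exact: differentiableP.
have [dH HE] := H; apply: DeriveDef; first exact: diff_derivable.
by rewrite deriveE//; exact: (congr1 (fun L => L 1) HE).
Qed.

Lemma is_derive_slice2 (F : R * R -> R) (x y : R) : differentiable F (x, y) ->
  is_derive y 1 (fun y => F (x, y)) ('d F (x, y) (e_y R)).
Proof.
move=> dF; have dp : is_diff y (fun t : R => (x, t)) (fun h => (0, h)).
  exact: is_diff_pair.
have H : is_diff y (F \o (fun t : R => (x, t))) ('d F (x, y) \o (fun h => (0, h))).
  by apply: is_diff_comp; exact: differentiableP.
have [dH HE] := H; apply: DeriveDef; first exact: diff_derivable.
by rewrite deriveE//; exact: (congr1 (fun L => L 1) HE).
Qed.

Lemma continuous_slice1 (F : R * R -> R) (y : R) : continuous F -> continuous (fun x => F (x, y)).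
Proof.
move=> cF x; apply: (@continuous_comp _ _ _ (fun x => (x, y)) F); last exact: cF.
have [dp _] : is_diff x (fun t : R => (t, y)) (fun h => (h, 0)) by exact: is_diff_pair.
exact: differentiable_continuous.
Qed.

Lemma continuous_slice2 (F : R * R -> R) (x : R) : continuous F -> continuous (fun y => F (x, y)).
Proof.
move=> cF y; apply: (@continuous_comp _ _ _ (fun y => (x, y)) F); last exact: cF.
have [dp _] : is_diff y (fun t : R => (x, t)) (fun h => (0, h)) by exact: is_diff_pair.
exact: differentiable_continuous.
Qed.

(** By Fubini, the inner integral along each horizontal line is that of the derivative of a function
    vanishing for |x| >= 1. *)
Lemma diskint_diff_x f : Cc_infty f -> diskint (fun z => 'd f z (e_x R)) = 0.
Proof.
move=> Cf; have Cdf := Cc_infty_diff (e_x R) Cf.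
rewrite diskint_patch -(integral21_prod_meas1 (diskint_patch_integrable Cdf)).
rewrite integral0_eq// => y _; rewrite /fubini_G/=.
apply: (@integral_derivative_eq0 (fun x => (f \_ (disk R)) (x, y))).
- move=> x; have [df dE] := Cc_patch_differentiable Cf (x, y).
  by rewrite -dE; exact: is_derive_slice1.
- by apply: continuous_slice1; exact: Cc_patch_continuous.
- by move=> x x1; apply: patch_disk_slice; left.
- by move=> x x1; apply: patch_disk_slice; left.
Qed.

Lemma diskint_diff_y f : Cc_infty f -> diskint (fun z => 'd f z (e_y R)) = 0.
Proof.
move=> Cf; have Cdf := Cc_infty_diff (e_y R) Cf.
rewrite diskint_patch -(integral12_prod_meas1 (diskint_patch_integrable Cdf)).
rewrite integral0_eq// => x _; rewrite /fubini_F/=.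
apply: (@integral_derivative_eq0 (fun y => (f \_ (disk R)) (x, y))).
- move=> y; have [df dE] := Cc_patch_differentiable Cf (x, y).
  by rewrite -dE; exact: is_derive_slice2.
- by apply: continuous_slice2; exact: Cc_patch_continuous.
- by move=> y y1; apply: patch_disk_slice; right.
- by move=> y y1; apply: patch_disk_slice; right.
Qed.

Lemma diff_mul f g z e : differentiable f z -> differentiable g z ->
  'd (f \* g) z e = f z * 'd g z e + g z * 'd f z e.
Proof. by move=> df dg; rewrite diffM. Qed.

(** The vanishing of integrals of derivatives is applied to the product of [f] with the test
    function. Taking it as a hypothesis serves both coordinate directions. *)
Lemma Cc_is_weak_derive (e : R * R) f :
  (forall g, Cc_infty g -> diskint (fun z => 'd g z e) = 0) ->
  Cc_infty f -> is_weak_derive e f (fun z => 'd f z e).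
Proof.
move=> div0 Cf phi Cphi.
have Cdf := Cc_infty_diff e Cf; have Cdphi := Cc_infty_diff e Cphi.
have := div0 _ (Cc_inftyMl (Cc_smooth Cf) Cphi).
rewrite (@eq_diskint _ _ (fun z => f z * 'd phi z e + 'd f z e * phi z)); last first.
  move=> z Dz; rewrite diff_mul; [by rewrite [phi z * _]mulrC| |].
    exact: smooth_diff (Cc_smooth Cf) Dz.
  exact: smooth_diff (Cc_smooth Cphi) Dz.
rewrite diskintD; [|exact: L1_mulr (Cc_L2 Cf) (Cc_L2 Cdphi)|exact: L1_mulr (Cc_L2 Cdf) (Cc_L2 Cphi)].
by move=> /eqP; rewrite addr_eq0 => /eqP.
Qed.

(* From int (x f^2)_x = 0, where |x| <= 1. *)
Lemma Cc_poincare f : Cc_infty f ->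
  diskint (fun z => f z ^+ 2) <= 4 * diskint (fun z => 'd f z (e_x R) ^+ 2).
Proof.
move=> Cf; have sf := Cc_smooth Cf; have Cdf := Cc_infty_diff (e_x R) Cf.
have s1 : smooth_on (disk R) (fst : R * R -> R).
  by move=> k; apply: Ck_on_linear_fun; [exact: open_disk|exact: continuous_fst2].
have Cff := Cc_inftyMl sf Cf; have Ch := Cc_inftyMl s1 Cff.
have := diskint_diff_x Ch.
have hE z : disk R z -> 'd (fst \* (f \* f)) z (e_x R) =
    z.1 * (f z * 'd f z (e_x R) + f z * 'd f z (e_x R)) + f z * f z.
  move=> Dz; have df := smooth_diff sf Dz.
  rewrite diff_mul; [|exact: smooth_diff s1 Dz|exact: differentiableM].
  rewrite diff_mul// diff_lin ?mulr1//; exact: continuous_fst2.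
rewrite (eq_diskint hE) => E0.
have L1h : L1_disk (fun z => z.1 * (f z * 'd f z (e_x R) + f z * 'd f z (e_x R)) + f z * f z).
  by apply: eq_L1 (Cc_L1 (Cc_infty_diff (e_x R) Ch)) => z /hE.
have L1f := L2_sqr (Cc_L2 Cf); have L1d := L2_sqr (Cc_L2 Cdf).
(* With a = f and d its derivative in x, the integrand 2 x a d + a^2 exceeds a^2 / 2 - 2 d^2 by (a +
   2 x d)^2 / 2 + 2 (1 - x^2) d^2. The constant 4 is the ratio of 2 to 1/2. *)
have H : diskint (fun z => 2^-1 * f z ^+ 2 + (-2) * 'd f z (e_x R) ^+ 2) <= 0.
  rewrite -[X in _ <= X]E0; apply: le_diskint => //.
    by apply: L1_lin => //; exact: L1Z.
  move=> z /disk_coord[z1 _]; move: ('d f z (e_x R)) (f z) => d a.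
  have z2 : z.1 ^+ 2 <= 1 by rewrite -[z.1 ^+ 2]real_normK ?num_real// expr_le1// ltW.
  rewrite -subr_ge0 (_ : _ - _ = 2^-1 * (a + 2 * z.1 * d) ^+ 2 + 2 * ((1 - z.1 ^+ 2) * d ^+ 2)).
    apply: addr_ge0; first by rewrite mulr_ge0 ?sqr_ge0 ?invr_ge0.
    by rewrite mulr_ge0// mulr_ge0 ?sqr_ge0// subr_ge0.
  by field.
rewrite diskint_lin// in H; last exact: L1Z.
by rewrite diskintZ// in H; lra.
Qed.

End CcIntegrals.

(** * The fundamental lemma of the calculus of variations *)

Section FundamentalLemma.
Context {R : realType}.
Implicit Types (u v f g : R * R -> R).
Local Notation D := (disk R : set (plane R)).
Local Notation mD := (@measurable_disk R).

Lemma negligible_lines (b d : R) :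
  (leb2 R).-negligible [set z : plane R | z.1 = b \/ z.2 = d].
Proof.
have E1 : leb2 R ([set b] `*` setT) = 0%E.
  by rewrite leb2X//= lebesgue_measure_set1 mul0e.
have E2 : leb2 R (setT `*` [set d]) = 0%E.
  by rewrite leb2X//= lebesgue_measure_set1 mule0.
exists (([set b] `*` setT) `|` (setT `*` [set d])); split.
- by apply: measurableU; apply: measurableX.
- apply/eqP; rewrite -measure_le0.
  apply: (le_trans (measureU2 _ _ _)); [exact: measurableX|exact: measurableX|].
  by rewrite /= in E1 E2 *; rewrite E1 E2 adde0.
- by move=> -[x y] /= [->|->]; [left|right].
Qed.

(** Bumps supported in the closed rectangle are admissible test functions and converge almost
    everywhere to its indicator; dominated convergence applies with the bound |v|. *)
Lemma integral_rect_eq0 v (a b c d : R) : L2_disk v ->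
  (forall phi, Cc_infty phi -> diskint (fun z => v z * phi z) = 0) ->
  crect a b c d `<=` disk R ->
  (\int[leb2 R]_(z in rect a b c d) (v z)%:E = 0)%E.
Proof.
move=> Lv v0 sub; have L1v := L2_L1 Lv; have mv := L2_measurable Lv.
have sub' : rect a b c d `<=` D by apply: subset_trans sub; exact: rect_crect.
have mr := measurable_rect a b c d.
have mb n : measurable_fun D (bump a b c d n : plane R -> R).
  exact: Cc_measurable (Cc_bump n sub).
pose f_ n (z : plane R) := (v z * bump a b c d n z)%:E.
pose f (z : plane R) := (v z * \1_(rect a b c d) z)%:E.
have [|||||_ _] := @dominated_convergence _ (plane R) R (leb2 R) D mD f_ f
    (fun z => `|v z|%:E).
- by move=> n; apply/measurable_EFinP; exact: measurable_funM.
- apply/measurable_EFinP; apply: (measurable_funM mv).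
  have mi : measurable_fun setT (\1_(rect a b c d : set (plane R)) : plane R -> R).
    exact: measurable_indic.
  exact: (measurable_funS measurableT (@subsetT _ _) mi).
- apply: negligibleS (negligible_lines b d) => z /= nz.
  apply: contrapT => /not_orP[/eqP zb /eqP zd]; apply: nz => Dz.
  apply: cvg_EFin; first exact: nearW.
  by apply: cvgM; [exact: cvg_cst|exact: bump_cvg].
- apply: eq_integrable (integrable_abse L1v) => //; exact: mD.
- apply: nearW => z n Dz /=; rewrite lee_fin normrM ler_piMr//.
  by rewrite ger0_norm ?bump_ge0// bump_le1.
have -> : [sequence (\int[leb2 R]_(z in D) f_ n z)%E]_n = fun=> 0%E.
  apply/funext => n /=; have Cb := Cc_bump n sub.
  have Lb : L1_disk (fun z => v z * bump a b c d n z) by apply: L1_mulr => //; exact: Cc_L2.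
  rewrite -[LHS]fineK; last by apply: integrable_fin_num => //; exact: mD.
  by congr EFin; exact: v0.
move=> /cvg_lim E; transitivity (\int[leb2 R]_(x in D) f x)%E; last by rewrite -E// lim_cst.
rewrite -[in LHS](setIidr sub') integral_mkcondr; apply: eq_integral => z _.
by rewrite /f /patch indicE; case: ifP => _; rewrite ?mulr1 ?mulr0.
Qed.

(** The positive and negative parts of [v] are densities of two measures that agree on rectangles,
    hence on all Borel subsets of the disk; so [v] has integral zero over each of these sets. *)
Lemma fundamental_lemma v : L2_disk v ->
  (forall phi, Cc_infty phi -> diskint (fun z => v z * phi z) = 0) ->
  ae_eq_on_disk v (fun=> 0).
Proof.
move=> Lv v0; have L1v := L2_L1 Lv; have mv := L2_measurable Lv.
pose vp (z : plane R) := Num.max (v z) 0; pose vn (z : plane R) := Num.max (- v z) 0.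
have mvp : measurable_fun D vp by apply: measurable_maxr => //; exact: measurable_cst.
have mvn : measurable_fun D vn.
  by apply: measurable_maxr; [exact: measurableT_comp|exact: measurable_cst].
have vp0 z : 0 <= (vp \_ D) z by rewrite /patch; case: ifP => // _; rewrite le_max lexx orbT.
have vn0 z : 0 <= (vn \_ D) z by rewrite /patch; case: ifP => // _; rewrite le_max lexx orbT.
have mvp' : measurable_fun setT (vp \_ D) by apply/(measurable_restrictT _ mD).
have mvn' : measurable_fun setT (vn \_ D) by apply/(measurable_restrictT _ mD).
pose m1 := density_measure (leb2 R) mvp' vp0.
pose m2 := density_measure (leb2 R) mvn' vn0.
have m1E A : A `<=` D -> m1 A = (\int[leb2 R]_(z in A) (EFin \o v)^\+ z)%E.
  move=> AD; rewrite /m1 density_measureE; apply: eq_integral => z /[!inE] Az.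
  by rewrite /patch mem_set; [rewrite funeposE EFin_max|exact: AD].
have m2E A : A `<=` D -> m2 A = (\int[leb2 R]_(z in A) (EFin \o v)^\- z)%E.
  move=> AD; rewrite /m2 density_measureE; apply: eq_integral => z /[!inE] Az.
  by rewrite /patch mem_set; [rewrite funenegE EFin_max|exact: AD].
have vA A : measurable A -> A `<=` D -> (leb2 R).-integrable A (EFin \o v).
  by move=> mA AD; apply: integrableS L1v => //; exact: mD.
have m1fin A : measurable A -> A `<=` D -> m1 A \is a fin_num.
  move=> mA AD; rewrite m1E//; apply: integrable_fin_num => //.
  by apply: integrable_funepos => //; exact: vA.
have m2fin A : measurable A -> A `<=` D -> m2 A \is a fin_num.
  move=> mA AD; rewrite m2E//; apply: integrable_fin_num => //.
  by apply: integrable_funeneg => //; exact: vA.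
have m12 A : measurable A -> A `<=` D -> m1 A = m2 A.
  apply: (measure_eq_open (@open_disk R)).
    move=> a b c d sub; rewrite -ge0_fin_numE//; apply: m1fin.
      exact: measurable_rect.
    by apply: subset_trans sub; exact: rect_crect.
  move=> a b c d _ _ sub; have mr := measurable_rect a b c d.
  have sub' : rect a b c d `<=` D by apply: subset_trans sub; exact: rect_crect.
  have := integral_rect_eq0 Lv v0 sub; rewrite integralE -m1E// -m2E//.
  have := m1fin _ mr sub'; have := m2fin _ mr sub'.
  move: (m1 _) (m2 _) => [x| |] [y| |] //= _ _; rewrite -EFinB => -[] /eqP.
  by rewrite subr_eq0 => /eqP ->.
have : ae_eq (leb2 R) D (EFin \o v) (cst 0%E).
  apply: integral_ae_eq => //; first exact: mD.
  move=> E ED mE; rewrite integral0 integralE -m1E// -m2E// m12//.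
  by rewrite subee//; exact: m2fin.
by apply: filterS => z h Dz; have := h Dz => -[].
Qed.

End FundamentalLemma.

(** * Weak gradients and the space [H10] *)

Section WeakGradient.
Context {R : realType}.
Implicit Types (u v w f phi : R * R -> R) (g h : R * R -> R * R) (e : R * R).

Lemma ae_eq_diskint_of_sub u v : ae_eq_on_disk (fun z => -1 * v z + u z) (fun=> 0) ->
  ae_eq_on_disk u v.
Proof.
apply: filterS => z h Dz; have := h Dz; rewrite mulN1r addrC => /eqP.
by rewrite subr_eq0 => /eqP.
Qed.

Lemma is_weak_derive_lin (a : R) e u1 u2 v1 v2 :
  L2_disk u1 -> L2_disk u2 -> L2_disk v1 -> L2_disk v2 ->
  is_weak_derive e u1 v1 -> is_weak_derive e u2 v2 ->
  is_weak_derive e (fun z => a * u1 z + u2 z) (fun z => a * v1 z + v2 z).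
Proof.
move=> Lu1 Lu2 Lv1 Lv2 w1 w2 phi Cphi.
have Lphi := Cc_L2 Cphi; have Ldphi := Cc_L2 (Cc_infty_diff e Cphi).
rewrite (@eq_diskint _ _ (fun z => a * (u1 z * 'd phi z e) + u2 z * 'd phi z e)); last first.
  by move=> z _; ring.
rewrite [in RHS](@eq_diskint _ _ (fun z => a * (v1 z * phi z) + v2 z * phi z)); last first.
  by move=> z _; ring.
rewrite !diskint_lin; try exact: L1_mulr.
by rewrite w1// w2//; ring.
Qed.

Lemma weak_derive_unique e u v1 v2 : L2_disk v1 -> L2_disk v2 ->
  is_weak_derive e u v1 -> is_weak_derive e u v2 -> ae_eq_on_disk v1 v2.
Proof.
move=> L1 L2 w1 w2; apply: ae_eq_diskint_of_sub; apply: fundamental_lemma.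
  exact: L2_lin.
move=> phi Cphi; have Lphi := Cc_L2 Cphi.
rewrite (@eq_diskint _ _ (fun z => -1 * (v2 z * phi z) + v1 z * phi z)); last first.
  by move=> z _; ring.
rewrite diskint_lin; try exact: L1_mulr.
by rewrite -[diskint (fun z => v1 z * _)]opprK -[diskint (fun z => v2 z * _)]opprK
  -w1// -w2//; ring.
Qed.

Lemma weak_deriveP e u : has_L2_derive e u ->
  L2_disk (weak_derive e u) /\ is_weak_derive e u (weak_derive e u).
Proof.
move=> [v vP].
exact: (@xgetPex _ (fun=> 0) [set v | L2_disk v /\ is_weak_derive e u v] (ex_intro _ v vP)).
Qed.

(** A relation, because [weak_grad] picks its representative by choice, whereas computations produce
    explicit fields such as [grad phi] or a transported gradient. [diskint_dot_weak_grad] passes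
    from the former to the latter. *)
Definition is_weak_grad u g : Prop :=
  [/\ L2_disk u, L2_disk (fst \o g), L2_disk (snd \o g),
      is_weak_derive (e_x R) u (fst \o g) & is_weak_derive (e_y R) u (snd \o g)].

Definition L2_field g : Prop := L2_disk (fst \o g) /\ L2_disk (snd \o g).

Lemma is_weak_grad_L2 u g : is_weak_grad u g -> L2_disk u. Proof. by case. Qed.

Lemma is_weak_grad_field u g : is_weak_grad u g -> L2_field g. Proof. by case. Qed.

Lemma is_weak_grad_H1 u g : is_weak_grad u g -> H1 u.
Proof. by move=> [? ? ? ? ?]; split => //; [exists (fst \o g)|exists (snd \o g)]. Qed.

Lemma H1_weak_grad u : H1 u -> is_weak_grad u (weak_grad u).
Proof. by move=> [Lu /weak_deriveP[a b] /weak_deriveP[c d]]; exact: (And5 Lu a c b d). Qed.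

Lemma weak_grad_field u g : is_weak_grad u g -> L2_field (weak_grad u).
Proof. by move=> /is_weak_grad_H1/H1_weak_grad/is_weak_grad_field. Qed.

Lemma weak_grad_ae u g : is_weak_grad u g -> ae_eq (leb2 R) (disk R) (weak_grad u) g.
Proof.
move=> wg; have [_ a1 a2 a3 a4] := H1_weak_grad (is_weak_grad_H1 wg).
have [_ b1 b2 b3 b4] := wg.
have E1 := weak_derive_unique a1 b1 a3 b3; have E2 := weak_derive_unique a2 b2 a4 b4.
apply: filterS2 E1 E2 => z E1 E2 Dz; have := E1 Dz; have := E2 Dz.
by rewrite /= [g z]surjective_pairing [weak_grad u z]surjective_pairing /= => -> ->.
Qed.

Lemma L1_dot g h : L2_field g -> L2_field h -> L1_disk (fun z => dot (g z) (h z)).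
Proof. by move=> [g1 g2] [h1 h2]; apply: L1D; exact: L1_mulr. Qed.

Lemma diskint_dot_weak_grad u v g h : is_weak_grad u g -> is_weak_grad v h ->
  diskint (fun z => dot (weak_grad u z) (weak_grad v z)) =
  diskint (fun z => dot (g z) (h z)).
Proof.
move=> wg wh; apply: ae_eq_diskint.
- exact: L1_measurable (L1_dot (weak_grad_field wg) (weak_grad_field wh)).
- exact: L1_measurable (L1_dot (is_weak_grad_field wg) (is_weak_grad_field wh)).
- apply: filterS2 (weak_grad_ae wg) (weak_grad_ae wh) => z E1 E2 Dz.
  by rewrite E1// E2.
Qed.

Lemma is_weak_grad_lin (a : R) u v g h : is_weak_grad u g -> is_weak_grad v h ->
  is_weak_grad (fun z => a * u z + v z) (fun z => (a * (g z).1 + (h z).1, a * (g z).2 + (h z).2)).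
Proof.
move=> [u1 u2 u3 u4 u5] [v1 v2 v3 v4 v5]; split; try exact: L2_lin.
- exact: (is_weak_derive_lin a u1 v1 u2 v2 u4 v4).
- exact: (is_weak_derive_lin a u1 v1 u3 v3 u5 v5).
Qed.

Lemma Cc_is_weak_grad phi : Cc_infty phi -> is_weak_grad phi (grad phi).
Proof.
move=> C; split.
- exact: Cc_L2.
- by apply: Cc_L2; exact: Cc_infty_diff.
- by apply: Cc_L2; exact: Cc_infty_diff.
- by apply: Cc_is_weak_derive => // g; exact: diskint_diff_x.
- by apply: Cc_is_weak_derive => // g; exact: diskint_diff_y.
Qed.

Definition H1_sqnorm u g : R := diskint (fun z => u z ^+ 2) + diskint (fun z => dot (g z) (g z)).

Lemma eq_H1_sqnorm u v g h : (forall z, disk R z -> u z = v z) ->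
  (forall z, disk R z -> g z = h z) -> H1_sqnorm u g = H1_sqnorm v h.
Proof.
by move=> uv gh; congr (_ + _); apply: eq_diskint => z Dz; rewrite ?uv// gh.
Qed.

Lemma H1_normE u g : is_weak_grad u g -> H1_norm u ^+ 2 = H1_sqnorm u g.
Proof.
move=> wg; rewrite sqr_sqrtr; last first.
  by apply: diskint_ge0 => z _; rewrite addr_ge0 ?sqr_ge0 ?dot_ge0.
rewrite diskintD; [|exact: L2_sqr (is_weak_grad_L2 wg)|]; last first.
  exact: L1_dot (weak_grad_field wg) (weak_grad_field wg).
by rewrite (diskint_dot_weak_grad wg wg).
Qed.

Lemma is_weak_grad_sub_Cc u g phi : is_weak_grad u g -> Cc_infty phi ->
  is_weak_grad (u \- phi) (fun z => g z - grad phi z).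
Proof.
move=> wg C; have := is_weak_grad_lin (-1) (Cc_is_weak_grad C) wg.
congr is_weak_grad; first by apply/funext => z /=; ring.
by apply/funext => z; rewrite [RHS]surjective_pairing /=; congr pair; ring.
Qed.

(** Trades the chosen gradient for an explicit one and the norm for its square, the form in which
    approximation is used below. *)
Lemma H10P u : H10 u <-> exists g, is_weak_grad u g /\
  forall eps : R, 0 < eps -> exists phi, Cc_infty phi /\
    H1_sqnorm (u \- phi) (fun z => g z - grad phi z) < eps.
Proof.
split=> [[Hu app]|[g [wg app]]].
  exists (weak_grad u); split; first exact: H1_weak_grad.
  move=> eps eps0; have [|phi [C n]] := app (Num.sqrt eps); first by rewrite sqrtr_gt0.
  exists phi; split => //; rewrite -(H1_normE (is_weak_grad_sub_Cc (H1_weak_grad Hu) C)).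
  rewrite -[X in _ < X](sqr_sqrtr (ltW eps0)) ltrXn2r// ?nnegrE ?sqrtr_ge0//.
split; first exact: is_weak_grad_H1 wg.
move=> eps eps0; have [|phi [C n]] := app (eps ^+ 2); first by rewrite exprn_gt0.
exists phi; split => //; rewrite -(H1_normE (is_weak_grad_sub_Cc wg C)) in n.
by rewrite -(@ltr_pXn2r _ 2)// ?nnegrE ?sqrtr_ge0// ltW.
Qed.

Lemma H10_sub_Cc u phi : H10 u -> Cc_infty phi -> H10 (u \- phi).
Proof.
move=> /H10P[g [wg app]] C; apply/H10P.
exists (fun z => g z - grad phi z); split; first exact: is_weak_grad_sub_Cc.
move=> eps /app[psi [Cpsi H]]; exists (fun z => -1 * phi z + psi z); split.
  exact: Cc_infty_lin.
have gradE z : disk R z -> grad (fun z => -1 * phi z + psi z) z = grad psi z - grad phi z.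
  move=> Dz; have dphi := smooth_diff (Cc_smooth C) Dz.
  have dpsi := smooth_diff (Cc_smooth Cpsi) Dz.
  have E e : 'd (fun z => -1 * phi z + psi z) z e = 'd psi z e - 'd phi z e.
    rewrite (_ : (fun z => _) = psi - phi); last by apply/funext => w; rewrite !fctE; ring.
    by rewrite (diffB dpsi dphi).
  exact: (congr2 pair (E (e_x R)) (E (e_y R))).
apply: (@le_lt_trans _ _ (H1_sqnorm (u \- psi) (fun z => g z - grad psi z))); last exact: H.
rewrite le_eqVlt; apply/orP; left; apply/eqP; apply: eq_H1_sqnorm.
- by move=> z _ /=; ring.
- by move=> z Dz; rewrite gradE// opprB addrA subrK.
Qed.

Lemma Cc_H10 phi : Cc_infty phi -> H10 phi.
Proof.
move=> C; apply/H10P; exists (grad phi); split; first exact: Cc_is_weak_grad.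
move=> eps eps0; exists phi; split => //; rewrite /H1_sqnorm.
rewrite (@eq_diskint _ _ (fun=> 0)); last by move=> z _ /=; rewrite subrr expr0n.
rewrite (@eq_diskint _ (fun z => dot _ _) (fun=> 0)); last first.
  by move=> z _; rewrite subrr /dot /= mulr0 addr0.
by rewrite /diskint /Rintegral integral0 addr0.
Qed.

Lemma diskint_sqrD u v : L2_disk u -> L2_disk v ->
  diskint (fun z => (u z + v z) ^+ 2) <=
  2 * diskint (fun z => u z ^+ 2) + 2 * diskint (fun z => v z ^+ 2).
Proof.
move=> Lu Lv; have Su := L2_sqr Lu; have Sv := L2_sqr Lv.
rewrite -(diskintZ 2 Sv) -diskint_lin//; last exact: L1Z.
apply: le_diskint; last first.
- move=> z _; rewrite -subr_ge0 (_ : _ - _ = (u z - v z) ^+ 2) ?sqr_ge0//; ring.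
- by apply: L1_lin => //; exact: L1Z.
- by apply: eq_L1 (L2_sqr (L2_lin 1 Lu Lv)) => z _; rewrite mul1r.
Qed.

Lemma le0_of_lt_eps (x M : R) : 0 <= M -> (forall eps : R, 0 < eps -> x <= M * eps) -> x <= 0.
Proof.
move=> M0 H; rewrite leNgt; apply/negP => x0.
have M1 : 0 < M + 1 by rewrite ltr_wpDl.
have := H (x / (2 * (M + 1))); rewrite divr_gt0 ?mulr_gt0// => /(_ isT).
rewrite mulrA ler_pdivlMr ?mulr_gt0//; have := mulr_ge0 M0 (ltW x0).
by rewrite (_ : x * (2 * (M + 1)) = 2 * (M * x) + 2 * x); [lra|ring].
Qed.

(** The inequality for an approximant phi passes to the limit. Splitting u as (u - phi) + phi costs
    a factor 2, [Cc_poincare] a factor 4, and splitting the derivative of phi another 2, whence 16.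
    The error is at most 2 |u - phi|^2 + 16 |g - grad phi|^2 in L2 norms, within 18 eps. *)
Lemma H10_poincare u g : H10 u -> is_weak_grad u g ->
  diskint (fun z => u z ^+ 2) <= 16 * diskint (fun z => dot (g z) (g z)).
Proof.
move=> /H10P[g' [wg' app]] wg.
rewrite -(diskint_dot_weak_grad wg wg) (diskint_dot_weak_grad wg' wg').
rewrite -subr_le0; apply: (@le0_of_lt_eps _ 18) => // eps /app[phi [C H]].
have [Lu _] := wg'; have [Lg1 Lg2] := is_weak_grad_field wg'.
have wgd := is_weak_grad_sub_Cc wg' C; have [Ld1 Ld2] := is_weak_grad_field wgd.
have Ldphi e := Cc_L2 (Cc_infty_diff e C).
have H1 : diskint (fun z => u z ^+ 2) <=
    2 * diskint (fun z => (u \- phi) z ^+ 2) + 2 * diskint (fun z => phi z ^+ 2).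
  rewrite (@eq_diskint _ _ (fun z => ((u \- phi) z + phi z) ^+ 2)); last first.
    by move=> z _ /=; rewrite subrK.
  by apply: diskint_sqrD; [exact: is_weak_grad_L2 wgd|exact: Cc_L2].
have H2 := Cc_poincare C.
have H3 : diskint (fun z => 'd phi z (e_x R) ^+ 2) <=
    2 * diskint (fun z => (g' z).1 ^+ 2) + 2 * diskint (fun z => (g' z - grad phi z).1 ^+ 2).
  rewrite (@eq_diskint _ _ (fun z => ((g' z).1 + -1 * (g' z - grad phi z).1) ^+ 2)); last first.
    by move=> z _ /=; congr (_ ^+ 2); ring.
  rewrite (@eq_diskint _ (fun z => (g' z - grad phi z).1 ^+ 2)
    (fun z => (-1 * (g' z - grad phi z).1) ^+ 2)); last by move=> z _; ring.
  apply: diskint_sqrD => //.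
  by have := L2_lin (-1) Ld1 (L2_cst 0); congr L2_disk; apply/funext => z /=; rewrite addr0.
have H4 : diskint (fun z => (g' z).1 ^+ 2) <= diskint (fun z => dot (g' z) (g' z)).
  apply: le_diskint; [exact: L2_sqr Lg1|exact: L1_dot|].
  by move=> z _; rewrite /dot -!expr2 lerDl sqr_ge0.
have H5 : diskint (fun z => (g' z - grad phi z).1 ^+ 2) <=
    diskint (fun z => dot (g' z - grad phi z) (g' z - grad phi z)).
  apply: le_diskint; [exact: L2_sqr Ld1|exact: L1_dot|].
  by move=> z _; rewrite /dot -!expr2 lerDl sqr_ge0.
have H6 : 0 <= diskint (fun z => (u \- phi) z ^+ 2).
  by apply: diskint_ge0 => z _; exact: sqr_ge0.
have H7 : 0 <= diskint (fun z => dot (g' z - grad phi z) (g' z - grad phi z)).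
  by apply: diskint_ge0 => z _; exact: dot_ge0.
move: H H1 H2 H3 H4 H5 H6 H7; rewrite /H1_sqnorm.
move: (diskint (fun z => u z ^+ 2)) (diskint (fun z => (u \- phi) z ^+ 2))
  (diskint (fun z => phi z ^+ 2)) (diskint (fun z => 'd phi z (e_x R) ^+ 2))
  (diskint (fun z => (g' z).1 ^+ 2)) (diskint (fun z => (g' z - grad phi z).1 ^+ 2))
  (diskint (fun z => dot (g' z - grad phi z) (g' z - grad phi z)))
  (diskint (fun z => dot (g' z) (g' z))) => A1 A2 A3 A4 A5 A6 A7 A8.
clear; lra.
Qed.

End WeakGradient.

(** * Isometries of the Poincare disk *)

Section PoincareIsometry.
Context {R : realType}.
Local Notation D := (disk R : set (plane R)).
Local Notation mD := (@measurable_disk R).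

Lemma det2_sqr (u v : R * R) : det2 u v ^+ 2 = dot u u * dot v v - dot u v ^+ 2.
Proof. by rewrite /det2 /dot; ring. Qed.

Definition conf_factor (Phi : R * R -> R * R) (z : R * R) : R :=
  (1 - dot (Phi z) (Phi z)) / (1 - dot z z).

Variables (Phi Psi : R * R -> R * R).
Hypotheses (PhiD : forall z, disk R z -> disk R (Phi z))
  (PsiD : forall z, disk R z -> disk R (Psi z)).
Hypotheses (sPhi : smooth_on (disk R) Phi) (sPsi : smooth_on (disk R) Psi).
Hypotheses (PhiK : forall z, disk R z -> Psi (Phi z) = z)
  (PsiK : forall z, disk R z -> Phi (Psi z) = z).
Hypothesis isoPhi : forall z u v, disk R z ->
  hyp_metric (Phi z) ('d Phi z u) ('d Phi z v) = hyp_metric z u v.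
Local Notation lam := (conf_factor Phi).

Let dPhi z : disk R z -> differentiable Phi z.
Proof. exact: smooth_diff. Qed.

Let dPsi z : disk R z -> differentiable Psi z.
Proof. exact: smooth_diff. Qed.

Lemma conf_factor_gt0 z : disk R z -> 0 < lam z.
Proof. by move=> Dz; rewrite divr_gt0// subr_gt0//; exact: PhiD. Qed.

Lemma dot_diff z u v : disk R z ->
  dot ('d Phi z u) ('d Phi z v) = lam z ^+ 2 * dot u v.
Proof.
move=> Dz; have := isoPhi u v Dz; rewrite /hyp_metric /conf_factor.
have a0 : 1 - dot (Phi z) (Phi z) != 0 by rewrite gt_eqF// subr_gt0; exact: PhiD.
have b0 : 1 - dot z z != 0 by rewrite gt_eqF// subr_gt0.
move: (1 - dot (Phi z) (Phi z)) (1 - dot z z) a0 b0 (dot ('d Phi z u) _) (dot u v) => a b a0 b0 x y H.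
have -> : x = a ^+ 2 * (a ^- 2 * x) by rewrite mulrA divff ?mul1r// expf_neq0.
by rewrite H; field.
Qed.

(** The square of the Jacobian is the Gram determinant of the images of the two basis vectors, which
    is lam^4 by conformality. *)
Lemma jacE z : disk R z -> jac Phi z = lam z ^+ 2.
Proof.
move=> Dz; apply/eqP; rewrite -(@eqrXn2 _ 2)// ?normr_ge0 ?sqr_ge0//.
rewrite /jac real_normK ?num_real// det2_sqr !dot_diff//.
by apply/eqP; rewrite /dot /e_x /e_y /=; ring.
Qed.

Lemma continuous_jac z : disk R z -> {for z, continuous (jac Phi)}.
Proof.
move=> Dz.
have c e : {for z, continuous (fun w => 'd Phi w e)}.
  by have [_ h] := sPhi 1%N; exact: (h e).
have c1 e : {for z, continuous (fun w => ('d Phi w e).1)}.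
  by apply: (@continuous_comp _ _ _ (fun w => 'd Phi w e) fst); [exact: c|exact: cvg_fst].
have c2 e : {for z, continuous (fun w => ('d Phi w e).2)}.
  by apply: (@continuous_comp _ _ _ (fun w => 'd Phi w e) snd); [exact: c|exact: cvg_snd].
apply: (@continuous_comp _ _ _ (fun w => det2 ('d Phi w (e_x R)) ('d Phi w (e_y R))) (fun x : R => `|x|)).
  apply: cvgB; apply: cvgM; first [exact: c1|exact: c2].
exact: norm_continuous.
Qed.

Lemma measurable_comp_Phi (f : R * R -> R) : measurable_fun D (f : plane R -> R) ->
  measurable_fun D (f \o Phi : plane R -> R).
Proof.
move=> mf.
have mPhi : measurable_fun D (Phi : plane R -> plane R).
  apply: measurable_fun_continuous_on2; first exact: open_disk.
  by move=> z Dz; apply: differentiable_continuous; exact: dPhi.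
apply: (measurable_comp mD _ mf) => // _ [z Dz <-]; exact: PhiD.
Qed.

Lemma measurable_jac : measurable_fun D (jac Phi : plane R -> R).
Proof.
apply: measurable_fun_continuous_on; first exact: open_disk.
exact: continuous_jac.
Qed.

Let cov := ge0_change_of_variables (@open_disk R) (@open_disk R) leb2_disk_fin
  PhiD PsiD dPhi dPsi PhiK PsiK continuous_jac.

Lemma L1_comp f : L1_disk f -> L1_disk (fun z => f (Phi z) * jac Phi z).
Proof.
move=> Lf; have mf := L1_measurable Lf; apply/integrableP; split.
  apply/measurable_EFinP; apply: measurable_funM; last exact: measurable_jac.
  exact: measurable_comp_Phi.
have /integrableP[_] := Lf.
rewrite (cov (f := fun z => `|(f z)%:E|%E)); last 2 first.
- by apply: measurableT_comp => //; exact/measurable_EFinP.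
- by [].
congr (_ < _)%E; apply: eq_integral => z _ /=.
by rewrite normrM EFinM (ger0_norm (normr_ge0 (det2 _ _))).
Qed.

(** Positive and negative parts are transported separately; multiplication by the nonnegative
    [jac Phi] commutes with taking them. *)
Lemma diskint_comp f : L1_disk f ->
  diskint (fun z => f (Phi z) * jac Phi z) = diskint f.
Proof.
move=> Lf; have mf := L1_measurable Lf; congr fine.
have mfE : measurable_fun D (EFin \o f : plane R -> \bar R) by exact/measurable_EFinP.
rewrite integralE [RHS]integralE.
rewrite (cov (f := (EFin \o f)^\+)%E); last 2 first.
- exact: measurable_funepos.
- by move=> z _; exact: funepos_ge0.
rewrite (cov (f := (EFin \o f)^\-)%E); last 2 first.
- exact: measurable_funeneg.
- by move=> z _; exact: funeneg_ge0.
congr (_ - _)%E; apply: eq_integral => z _.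
  by rewrite !funeposE /= -!EFin_max -EFinM maxr_pMl ?normr_ge0// mul0r.
by rewrite !funenegE /= -!EFin_max -EFinM maxr_pMl ?normr_ge0// mul0r mulNr.
Qed.

Let path_diff (z : R * R) (t : R) : disk R (t *: z) ->
  is_derive t 1 (fun s => dot (Phi (s *: z)) (Phi (s *: z)))
    (2 * dot (Phi (t *: z)) ('d Phi (t *: z) z)).
Proof.
move=> Dz; have dP := dPhi Dz.
have H : is_diff t (Phi \o (fun s : R => s *: z)) ('d Phi (t *: z) \o (fun s => s *: z)).
  by apply: is_diff_comp; exact: differentiableP.
have [dH HE] := H.
have HL (L : {linear (R * R)%type -> R}) : continuous L ->
    is_derive t 1 (L \o (Phi \o (fun s : R => s *: z))) (L ('d Phi (t *: z) z)).
  move=> cL; have dL := @linear_differentiable _ _ _ L (Phi (t *: z)) cL.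
  have dc : differentiable (L \o (Phi \o (fun s : R => s *: z))) t.
    exact: differentiable_comp.
  apply: DeriveDef; first exact: diff_derivable.
  rewrite deriveE// diff_comp//= diff_lin//; congr (L _).
  by rewrite -[X in 'd Phi _ X]scale1r; exact: (congr1 (fun L => L 1) HE).
have H1 := HL fst (@continuous_fst2 R); have H2 := HL snd (@continuous_snd2 R).
have := is_deriveD (is_deriveM H1 H1) (is_deriveM H2 H2).
by congr (is_derive _ _ _ _); rewrite /dot /GRing.scale/=; ring.
Qed.

Lemma disk_scale (z : R * R) (t : R) : disk R z -> 0 <= t <= 1 -> disk R (t *: z).
Proof.
rewrite /disk/= => Dz /andP[t0 t1].
rewrite (_ : dot (t *: z) (t *: z) = t ^+ 2 * dot z z); last first.
  by rewrite /dot /= /GRing.scale/=; ring.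
by apply: le_lt_trans Dz; rewrite ler_piMl ?dot_ge0// expr_le1.
Qed.

Lemma conf_factor_lower (z : R * R) : disk R z ->
  (1 - dot (Phi 0) (Phi 0)) / 4 <= lam z.
Proof.
move=> Dz; set r := Num.sqrt (dot z z).
have r0 : 0 <= r by exact: sqrtr_ge0.
have r2 : r ^+ 2 = dot z z by rewrite sqr_sqrtr// dot_ge0.
have r1 : r < 1 by rewrite -(@ltr_pXn2r _ 2)// ?nnegrE// expr1n r2.
pose F t := 1 - dot (Phi (t *: z)) (Phi (t *: z)).
(* |F'(t)| <= 2 r F(t) / (1 - r^2 t^2) makes h nondecreasing; compare t = 0 and t = 1. *)
pose h t := F t * ((1 + r * t) / (1 - r * t)).
have itv (t : R) : 0 <= t <= 1 -> [/\ 0 < F t, 0 < 1 - r * t & 0 < 1 + r * t].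
  move=> /[dup] t01 /andP[t0 t1]; split.
  - by rewrite subr_gt0; apply: PhiD; exact: disk_scale.
  - by rewrite subr_gt0; apply: le_lt_trans r1; rewrite ler_piMr.
  - by rewrite ltr_wpDr// mulr_ge0.
have dh (t : R) : 0 <= t <= 1 -> exists2 d, is_derive t (1 : R) h d & 0 <= d.
  move=> t01; have [F0 m0 p0] := itv t t01; have Dt := disk_scale Dz t01.
  pose q := dot (Phi (t *: z)) ('d Phi (t *: z) z).
  have dF : is_derive t 1 F (0 - 2 * q) by apply: is_deriveB; exact: path_diff.
  have rt : is_derive t 1 (fun s : R => r * s) (r *: 1) by exact: is_deriveZ.
  have dp : is_derive t 1 (fun s : R => 1 + r * s) (0 + r *: 1) by exact: is_deriveD.
  have dm : is_derive t 1 (fun s : R => 1 - r * s) (0 - r *: 1) by exact: is_deriveB.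
  have dV := @is_deriveV R (fun s : R => 1 - r * s) t _ 1 (lt0r_neq0 m0) dm.
  have dH := is_deriveM dF (is_deriveM dp dV).
  eexists; first exact: dH.
  rewrite !fctE /GRing.scale/= !mulr1 !add0r.
  have pm : 1 - dot (t *: z) (t *: z) = (1 - r * t) * (1 + r * t).
    by rewrite -[dot (t *: z) (t *: z)]/((t * z.1) * (t * z.1) + (t * z.2) * (t * z.2))
      (_ : _ + _ = t ^+ 2 * r ^+ 2); [|rewrite r2 /dot]; ring.
  (* At the point t z, Cauchy-Schwarz and conformality give q^2 <= |Phi|^2 lam^2 r^2, where |Phi| <
     1 and lam times 1 - |t z|^2 is [F t]. *)
  have qF : q * ((1 - r * t) * (1 + r * t)) <= F t * r.
    have Fr0 : 0 <= F t * r by rewrite mulr_ge0// ltW.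
    apply: (le_trans (ler_norm _)); rewrite -(@ler_pXn2r _ 2)// ?nnegrE//.
    rewrite real_normK ?num_real// -pm exprMn exprMn.
    apply: (@le_trans _ _ ((dot (Phi (t *: z)) (Phi (t *: z)) * (lam (t *: z) ^+ 2 * r ^+ 2)) *
        (1 - dot (t *: z) (t *: z)) ^+ 2)).
      by rewrite ler_wpM2r ?sqr_ge0// r2 -(dot_diff z z Dt) dot_CS.
    have -> : dot (Phi (t *: z)) (Phi (t *: z)) * (lam (t *: z) ^+ 2 * r ^+ 2) *
        (1 - dot (t *: z) (t *: z)) ^+ 2 = dot (Phi (t *: z)) (Phi (t *: z)) * (F t ^+ 2 * r ^+ 2).
      rewrite /conf_factor -/(F t); field.
      by rewrite gt_eqF// subr_gt0.
    rewrite ler_piMl//; first by rewrite mulr_ge0 ?sqr_ge0.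
    by apply: ltW; exact: PhiD.
  move: m0 p0 F0 qF; rewrite /F; set a := 1 - r * t; set b := 1 + r * t; set c := 1 - _.
  move=> m0 p0 c0 qF.
  rewrite (_ : _ + _ = 2 / a ^+ 2 * (c * r - q * (a * b))).
    by rewrite mulr_ge0 ?divr_ge0 ?sqr_ge0// subr_ge0.
  have -> : b = 2 - a by rewrite /a /b; ring.
  by field; rewrite gt_eqF.
have h01 : h 0 <= h 1.
  apply: (@ger0_derive1_ndecr R h 0 1) => //.
  - by move=> t; rewrite in_itv/= => /andP[/ltW t0 /ltW t1]; have [|d []] := dh t; rewrite ?t0.
  - move=> t; rewrite in_itv/= => /andP[/ltW t0 /ltW t1]; have [|d hd d0] := dh t; first by rewrite t0.
    by rewrite derive1E (@derive_val _ _ _ _ _ _ _ hd).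
  - apply: continuous_in_subspaceT => t; rewrite inE /= in_itv/= => t01.
    have [d [hd _] _] := dh t t01.
    by apply: differentiable_continuous; apply/derivable1_diffP.
have [F1 m1 p1] : [/\ 0 < F 1, 0 < 1 - r * 1 & 0 < 1 + r * 1] by apply: itv; rewrite ler01 lexx.
have [F00 _ _] : [/\ 0 < F 0, 0 < 1 - r * 0 & 0 < 1 + r * 0] by apply: itv; rewrite ler01 lexx.
have zE : 1 - dot z z = (1 - r) * (1 + r) by rewrite -r2; ring.
have E0 : F 0 = 1 - dot (Phi 0) (Phi 0) by rewrite /F scale0r.
have E1 : F 1 = 1 - dot (Phi z) (Phi z) by rewrite /F scale1r.
rewrite /conf_factor zE -E0 -E1.
rewrite mulr1 in m1; rewrite mulr1 in p1.
move: h01 F1 F00; rewrite /h !mulr0 !mulr1 addr0 subr0 divr1 mulr1.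
move: (F 0) (F 1) => F0 F1 h01 F10 F00.
rewrite ler_pdivrMr// mulrAC ler_pdivlMr ?mulr_gt0//.
move: h01; rewrite mulrA ler_pdivlMr// => h01.
(* Dividing by 1 - |z|^2 = (1 - r) (1 + r) would give the bound F0 / (1 + r)^2 for lam; the constant
   4 comes from 1 + r <= 2. *)
have : F0 * (1 - r) * (1 + r) <= F1 * (1 + r) * (1 + r) by rewrite ler_pM2r.
move=> /le_trans H; rewrite mulrA; apply: H; rewrite -mulrA ler_pM2l//.
have : (1 + r) <= 2 by lra.
move=> H; apply: (@le_trans _ _ (2 * 2)); last by rewrite -natrM.
by rewrite ler_pM// ltW.
Qed.

End PoincareIsometry.

(** * Composition with an isometry on test functions and on [H10] *)

Section Pullback.
Context {R : realType}.
Local Notation D := (disk R : set (plane R)).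
Local Notation mD := (@measurable_disk R).

(* The transpose of a conformal matrix is conformal with the same factor. *)
Lemma orthogonal_frame (a b g h : R * R) (s : R) : s != 0 ->
  dot a a = s -> dot b b = s -> dot a b = 0 ->
  dot g a * dot h a + dot g b * dot h b = s * dot g h.
Proof.
(* [k] is 1 or -1, the orientation of the frame, and b is k times the quarter turn (-a.2, a.1) of
   a. *)
move=> s0 aa bb ab; pose k := det2 a b / s.
have b1 : b.1 = - (a.2 * k).
  apply: (mulfI s0); rewrite -{1}aa /k mulrN mulrCA [s * _]mulrC divfK//.
  rewrite -[LHS]subr0 -(mulr0 a.1) -ab /dot /det2; ring.
have b2 : b.2 = a.1 * k.
  apply: (mulfI s0); rewrite -{1}aa /k mulrCA [s * _]mulrC divfK//.
  rewrite -[LHS]subr0 -(mulr0 a.2) -ab /dot /det2; ring.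
have k2 : k ^+ 2 = 1.
  apply: (mulfI s0); rewrite mulr1 -[in RHS]bb -{1}aa /dot b1 b2; ring.
rewrite -{}aa /dot b1 b2.
rewrite (_ : _ + _ = (g.1 * a.1 + g.2 * a.2) * (h.1 * a.1 + h.2 * a.2) +
  k ^+ 2 * ((g.2 * a.1 - g.1 * a.2) * (h.2 * a.1 - h.1 * a.2))); last by ring.
by rewrite k2; ring.
Qed.

Variables (Phi Psi : R * R -> R * R).
Hypotheses (PhiD : forall z, disk R z -> disk R (Phi z))
  (PsiD : forall z, disk R z -> disk R (Psi z)).
Hypotheses (sPhi : smooth_on (disk R) Phi) (sPsi : smooth_on (disk R) Psi).
Hypotheses (PhiK : forall z, disk R z -> Psi (Phi z) = z)
  (PsiK : forall z, disk R z -> Phi (Psi z) = z).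
Hypothesis isoPhi : forall z u v, disk R z ->
  hyp_metric (Phi z) ('d Phi z u) ('d Phi z v) = hyp_metric z u v.

(** The transpose of ['d Phi z] applied to [g (Phi z)], as the chain rule prescribes for the
    gradient of a composite. *)
Definition pullback (g : R * R -> R * R) (z : R * R) : R * R :=
  (dot (g (Phi z)) ('d Phi z (e_x R)), dot (g (Phi z)) ('d Phi z (e_y R))).

Lemma dot_pullback g h z : disk R z ->
  dot (pullback g z) (pullback h z) = dot (g (Phi z)) (h (Phi z)) * jac Phi z.
Proof.
move=> Dz; rewrite (jacE PhiD isoPhi Dz) mulrC.
rewrite -[LHS]/(dot (g (Phi z)) ('d Phi z (e_x R)) * dot (h (Phi z)) ('d Phi z (e_x R)) +
  dot (g (Phi z)) ('d Phi z (e_y R)) * dot (h (Phi z)) ('d Phi z (e_y R))).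
apply: orthogonal_frame; first by rewrite expf_neq0// gt_eqF//; exact: conf_factor_gt0.
all: by rewrite (dot_diff PhiD isoPhi)// /dot /e_x /e_y /=; ring.
Qed.

Lemma grad_comp phi z : Cc_infty phi -> disk R z -> grad (phi \o Phi) z = pullback (grad phi) z.
Proof.
move=> C Dz; have dP := smooth_diff sPhi Dz.
have dphi := smooth_diff (Cc_smooth C) (PhiD Dz).
have E e : 'd (phi \o Phi) z e = dot (grad phi (Phi z)) ('d Phi z e).
  by rewrite diff_comp2// /dot /grad /= mulrC [X in _ + X]mulrC.
exact: (congr2 pair (E (e_x R)) (E (e_y R))).
Qed.

Lemma measurable_diff_Phi e :
  measurable_fun D (fun z : plane R => ('d Phi z e).1) /\
  measurable_fun D (fun z : plane R => ('d Phi z e).2).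
Proof.
have sd k : Ck_on k (disk R) (fun z => 'd Phi z e) by have [_] := sPhi k.+1; exact.
split; apply: (@measurable_fun_continuous_on R (disk R)).
- exact: open_disk.
- exact: (Ck_on_fst (k := 0) open_disk (sd 0%N)).
- exact: open_disk.
- exact: (Ck_on_snd (k := 0) open_disk (sd 0%N)).
Qed.

Lemma measurable_pullback g e : L2_field g ->
  measurable_fun D (fun z : plane R => dot (g (Phi z)) ('d Phi z e)).
Proof.
move=> [/L2_measurable m1 /L2_measurable m2]; have [d1 d2] := measurable_diff_Phi e.
apply: measurable_funD; apply: measurable_funM => //.
  exact: (measurable_comp_Phi PhiD sPhi m1).
exact: (measurable_comp_Phi PhiD sPhi m2).
Qed.

Let L1_comp_Phi f := L1_comp PhiD PsiD sPhi sPsi PhiK PsiK (f := f).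
Let diskint_comp_Phi f := diskint_comp PhiD PsiD sPhi sPsi PhiK PsiK (f := f).

Lemma pullback_field g : L2_field g -> L2_field (pullback g).
Proof.
move=> Lg; have H := L1_comp_Phi (L1_dot Lg Lg).
have bound z : disk R z -> `|(pullback g z).1 ^+ 2| <= dot (g (Phi z)) (g (Phi z)) * jac Phi z /\
    `|(pullback g z).2 ^+ 2| <= dot (g (Phi z)) (g (Phi z)) * jac Phi z.
  by move=> Dz; rewrite -dot_pullback// !ger0_norm ?sqr_ge0// /dot -!expr2 lerDl lerDr !sqr_ge0.
by split; split; [exact: measurable_pullback|
  apply: le_L1 H _; [apply: measurable_funX; exact: measurable_pullback|move=> z /bound[]]|
  exact: measurable_pullback|
  apply: le_L1 H _; [apply: measurable_funX; exact: measurable_pullback|move=> z /bound[]]].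
Qed.

Lemma diskint_dot_pullback g h : L2_field g -> L2_field h ->
  diskint (fun z => dot (pullback g z) (pullback h z)) = diskint (fun z => dot (g z) (h z)).
Proof.
move=> Lg Lh; rewrite -(diskint_comp_Phi (L1_dot Lg Lh)).
by apply: eq_diskint => z Dz; exact: dot_pullback.
Qed.

Let c : R := ((1 - dot (Phi 0) (Phi 0)) / 4) ^+ 2.

Let disk0 : disk R 0.
Proof. by rewrite /disk /dot /= mulr0 addr0 ltr01. Qed.

Let c_gt0 : 0 < c.
Proof. by rewrite exprn_gt0// divr_gt0// subr_gt0; exact: PhiD. Qed.

Let jac_ge z : disk R z -> c <= jac Phi z.
Proof.
move=> Dz; rewrite (jacE PhiD isoPhi Dz) lerXn2r//.
- by rewrite nnegrE divr_ge0// subr_ge0 ltW//; exact: PhiD.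
- by rewrite nnegrE ltW//; exact: conf_factor_gt0.
- exact: (conf_factor_lower PhiD sPhi isoPhi).
Qed.

(** Since [jac Phi] is at least [c], inserting the factor [jac Phi / c] only enlarges the square,
    and the change of variables applies. *)
Lemma L2_comp u : L2_disk u -> L2_disk (u \o Phi).
Proof.
move=> [mu Lu]; have mc := measurable_comp_Phi PhiD sPhi mu.
split=> //; apply: le_L1 (L1Z c^-1 (L1_comp_Phi Lu)) _.
  exact: measurable_funX.
move=> z Dz; rewrite ger0_norm ?sqr_ge0//= mulrC -mulrA ler_peMr ?sqr_ge0//.
by rewrite ler_pdivlMr// mul1r jac_ge.
Qed.

Lemma diskint_sqr_comp u : L2_disk u ->
  diskint (fun z => (u \o Phi) z ^+ 2) <= c^-1 * diskint (fun z => u z ^+ 2).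
Proof.
move=> Lu; have Su := L2_sqr Lu; rewrite -(diskint_comp_Phi Su) -diskintZ; last exact: (L1_comp_Phi Su).
apply: le_diskint; [exact: L2_sqr (L2_comp Lu)|exact: L1Z (L1_comp_Phi Su)|].
move=> z Dz /=; rewrite mulrC -mulrA ler_peMr ?sqr_ge0//.
by rewrite ler_pdivlMr// mul1r jac_ge.
Qed.

Lemma Cc_comp phi : Cc_infty phi -> Cc_infty (phi \o Phi).
Proof. exact: (Cc_infty_comp PhiD PsiD sPhi sPsi PhiK). Qed.

Lemma dirichlet_comp phi psi : Cc_infty phi -> Cc_infty psi ->
  dirichlet (phi \o Phi) (psi \o Phi) = dirichlet phi psi.
Proof.
move=> C1 C2.
suff E : diskint (fun z => dot (grad (phi \o Phi) z) (grad (psi \o Phi) z)) =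
    diskint (fun z => dot (grad phi z) (grad psi z)) by exact: (congr1 (fun x => (2 * pi)^-1 * x) E).
transitivity (diskint (fun z => dot (pullback (grad phi) z) (pullback (grad psi) z))).
  by apply: eq_diskint => z Dz; rewrite (grad_comp C1 Dz) (grad_comp C2 Dz).
exact: diskint_dot_pullback (is_weak_grad_field (Cc_is_weak_grad C1))
  (is_weak_grad_field (Cc_is_weak_grad C2)).
Qed.

(** For a fixed test function [eta], the defect A + B is linear in (u, g), bounded by their H1 norm,
    and zero when u is a test function, where the chain rule is classical. The direction e is
    abstract, and the facts that depend on it are hypotheses, to treat both coordinates at once. *)
Lemma is_weak_derive_comp e u g : is_weak_grad u g ->
  (forall h, L2_field h -> L2_disk (fun z => dot (h (Phi z)) ('d Phi z e)) /\
    diskint (fun z => dot (h (Phi z)) ('d Phi z e) ^+ 2) <= diskint (fun z => dot (h z) (h z))) ->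
  (forall phi, Cc_infty phi -> is_weak_derive e phi (fun z => 'd phi z e)) ->
  (forall eps : R, 0 < eps -> exists phi, Cc_infty phi /\
    H1_sqnorm (u \- phi) (fun z => g z - grad phi z) < eps) ->
  is_weak_derive e (u \o Phi) (fun z => dot (g (Phi z)) ('d Phi z e)).
Proof.
move=> wg He wCc app eta Ceta.
have Lu := is_weak_grad_L2 wg; have Lg := is_weak_grad_field wg.
have Leta := Cc_L2 Ceta; have Ldeta := Cc_L2 (Cc_infty_diff e Ceta).
set A := diskint (fun z => (u \o Phi) z * _).
set B := diskint (fun z => dot (g (Phi z)) ('d Phi z e) * eta z).
(* Squaring lets the Cauchy-Schwarz bounds be used without square roots. *)
suff : (A + B) ^+ 2 <= 0.
  by rewrite le_eqVlt ltNge sqr_ge0 orbF sqrf_eq0 addr_eq0 => /eqP.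
pose N1 := diskint (fun z => 'd eta z e ^+ 2); pose N2 := diskint (fun z => eta z ^+ 2).
have N10 : 0 <= N1 by apply: diskint_ge0 => z _; exact: sqr_ge0.
have N20 : 0 <= N2 by apply: diskint_ge0 => z _; exact: sqr_ge0.
(* From (X + Y)^2 <= 2 X^2 + 2 Y^2, where X^2 is at most c^-1 N1 |u - phi|^2 and Y^2 at most N2 |g -
   grad phi|^2, in L2 norms. *)
apply: (@le0_of_lt_eps _ _ (2 * (c^-1 * N1) + 2 * N2)).
  by rewrite addr_ge0// mulr_ge0// mulr_ge0// invr_ge0 ltW.
move=> eps /app[phi [C H]].
have wgd := is_weak_grad_sub_Cc wg C.
have Lw := is_weak_grad_L2 wgd; have Lh := is_weak_grad_field wgd.
set w := u \- phi in Lw H; set h := (fun z => g z - grad phi z) in Lh H.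
have [Leh Neh] := He _ Lh.
have Cc := Cc_comp C; have Ldc := Cc_L2 (Cc_infty_diff e Cc).
pose X := diskint (fun z => (w \o Phi) z * 'd eta z e).
pose Y := diskint (fun z => dot (h (Phi z)) ('d Phi z e) * eta z).
have AX : A = X + diskint (fun z => (phi \o Phi) z * 'd eta z e).
  rewrite -diskintD; [|exact: L1_mulr (L2_comp Lw) Ldeta|exact: L1_mulr (Cc_L2 Cc) Ldeta].
  by apply: eq_diskint => z _; rewrite /w /=; ring.
have BY : B = Y + diskint (fun z => 'd (phi \o Phi) z e * eta z).
  rewrite -diskintD; [|exact: L1_mulr|exact: L1_mulr].
  apply: eq_diskint => z Dz; have dP := smooth_diff sPhi Dz.
  have dphi := smooth_diff (Cc_smooth C) (PhiD Dz).
  have -> : 'd (phi \o Phi) z e = dot (grad phi (Phi z)) ('d Phi z e).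
    by rewrite diff_comp2// /dot /grad /= mulrC [X in _ + X]mulrC.
  rewrite -mulrDl; congr (_ * _); rewrite /h.
  move: (g (Phi z)) (grad phi (Phi z)) ('d Phi z e) => g1 g2 v.
  by rewrite /dot /=; ring.
have -> : A + B = X + Y by rewrite AX BY (wCc _ Cc _ Ceta); ring.
have HX : X ^+ 2 <= c^-1 * diskint (fun z => w z ^+ 2) * N1.
  apply: (le_trans (diskint_CS (L2_comp Lw) Ldeta)).
  by rewrite ler_wpM2r// diskint_sqr_comp.
have HY : Y ^+ 2 <= diskint (fun z => dot (h z) (h z)) * N2.
  by apply: (le_trans (diskint_CS Leh Leta)); rewrite ler_wpM2r.
have W0 : 0 <= diskint (fun z => w z ^+ 2) by apply: diskint_ge0 => z _; exact: sqr_ge0.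
have G0 : 0 <= diskint (fun z => dot (h z) (h z)) by apply: diskint_ge0 => z _; exact: dot_ge0.
have XY : (X + Y) ^+ 2 <= 2 * X ^+ 2 + 2 * Y ^+ 2.
  by rewrite -subr_ge0 (_ : _ - _ = (X - Y) ^+ 2) ?sqr_ge0//; ring.
apply: (le_trans XY); move: HX HY W0 G0 H N10 N20; rewrite /H1_sqnorm.
have : 0 < c^-1 by rewrite invr_gt0.
move: (X ^+ 2) (Y ^+ 2) (diskint (fun z => w z ^+ 2)) (diskint (fun z => dot (h z) (h z))) N1 N2 c^-1.
clear=> X Y W G N1 N2 k k0 HX HY W0 G0 H N10 N20.
have H1 : k * W * N1 <= k * N1 * eps.
  by rewrite mulrAC ler_wpM2l ?mulr_ge0 ?(ltW k0)//; lra.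
have H2 : G * N2 <= N2 * eps by rewrite mulrC ler_wpM2l//; lra.
rewrite (_ : (2 * (k * N1) + 2 * N2) * eps = 2 * (k * N1 * eps) + 2 * (N2 * eps)); last by ring.
by lra.
Qed.

Lemma is_weak_grad_comp u g : is_weak_grad u g ->
  (forall eps : R, 0 < eps -> exists phi, Cc_infty phi /\
    H1_sqnorm (u \- phi) (fun z => g z - grad phi z) < eps) ->
  is_weak_grad (u \o Phi) (pullback g).
Proof.
move=> wg app; have Lg := is_weak_grad_field wg; have [L1g L2g] := pullback_field Lg.
split=> //; first exact: L2_comp (is_weak_grad_L2 wg).
- apply: (is_weak_derive_comp wg _ _ app).
    move=> h Lh; have [L1h L2h] := pullback_field Lh; split => //.
    rewrite -(diskint_dot_pullback Lh Lh); apply: le_diskint; [exact: L2_sqr L1h|exact: L1_dot|].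
    by move=> z _; rewrite /dot -!expr2 lerDl sqr_ge0.
  by move=> phi; apply: Cc_is_weak_derive => f; exact: diskint_diff_x.
- apply: (is_weak_derive_comp wg _ _ app).
    move=> h Lh; have [L1h L2h] := pullback_field Lh; split => //.
    rewrite -(diskint_dot_pullback Lh Lh); apply: le_diskint; [exact: L2_sqr L2h|exact: L1_dot|].
    by move=> z _; rewrite /dot -!expr2 lerDr sqr_ge0.
  by move=> phi; apply: Cc_is_weak_derive => f; exact: diskint_diff_y.
Qed.

Lemma H1_sqnorm_comp u g : L2_disk u -> L2_field g ->
  H1_sqnorm (u \o Phi) (pullback g) <= (c^-1 + 1) * H1_sqnorm u g.
Proof.
move=> Lu Lg; rewrite /H1_sqnorm diskint_dot_pullback//.
have := diskint_sqr_comp Lu.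
have : 0 <= diskint (fun z => u z ^+ 2) by apply: diskint_ge0 => z _; exact: sqr_ge0.
have : 0 <= diskint (fun z => dot (g z) (g z)) by apply: diskint_ge0 => z _; exact: dot_ge0.
have : 0 < c^-1 by rewrite invr_gt0.
move: (diskint _) (diskint _) (diskint _) c^-1 => x y z k k0 x0 y0 zy.
have := mulr_ge0 (ltW k0) x0.
by rewrite !mulrDl !mulrDr !mul1r; lra.
Qed.

(** If phi approximates [u], then [phi \o Phi] approximates [u \o Phi], the squared error growing at
    most by the factor c^-1 + 1 of [H1_sqnorm_comp]. *)
Lemma H10_comp_weak_grad u : H10 u -> H10 (u \o Phi) /\
  exists g, is_weak_grad u g /\ is_weak_grad (u \o Phi) (pullback g).
Proof.
move=> /H10P[g [wg app]]; have wgc := is_weak_grad_comp wg app.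
split; last by exists g.
apply/H10P; exists (pullback g); split => // eps eps0.
have k0 : 0 < c^-1 + 1 by rewrite addr_gt0// invr_gt0.
have [|phi [C H]] := app (eps / (c^-1 + 1)); first by rewrite divr_gt0.
exists (phi \o Phi); split; first exact: Cc_comp.
have wgd := is_weak_grad_sub_Cc wg C.
apply: (@le_lt_trans _ _ (H1_sqnorm ((u \- phi) \o Phi) (pullback (fun z => g z - grad phi z)))).
  rewrite le_eqVlt; apply/orP; left; apply/eqP; apply: eq_H1_sqnorm => // z Dz.
  rewrite grad_comp// /pullback.
  move: (g (Phi z)) (grad phi (Phi z)) ('d Phi z (e_x R)) ('d Phi z (e_y R)) => g1 g2 v w.
  by rewrite [LHS]surjective_pairing /dot /=; congr pair; ring.
apply: (le_lt_trans (H1_sqnorm_comp (is_weak_grad_L2 wgd) (is_weak_grad_field wgd))).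
by rewrite mulrC -ltr_pdivlMr.
Qed.

Lemma dirichlet_weak_comp u v : H10 u -> H10 v ->
  dirichlet_weak (u \o Phi) (v \o Phi) = dirichlet_weak u v.
Proof.
move=> /H10_comp_weak_grad[_ [g [wu wu']]] /H10_comp_weak_grad[_ [h [wv wv']]].
rewrite /dirichlet_weak (diskint_dot_weak_grad wu' wv') (diskint_dot_weak_grad wu wv).
by rewrite diskint_dot_pullback//; [exact: is_weak_grad_field wu|exact: is_weak_grad_field wv].
Qed.

(** The L2 bound replaces a discussion of null sets: the squared difference of the composites has
    integral at most c^-1 times zero. *)
Lemma ae_eq_comp u v : L2_disk u -> L2_disk v -> ae_eq_on_disk u v ->
  ae_eq_on_disk (u \o Phi) (v \o Phi).
Proof.
move=> Lu Lv uv; have Ld := L2_lin (-1) Lv Lu.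
apply: ae_eq_diskint_of_sub; apply: (L2_ae_eq0 (L2_comp Ld)).
apply/eqP; rewrite eq_le; apply/andP; split; last by apply: diskint_ge0 => z _; exact: sqr_ge0.
apply: (le_trans (diskint_sqr_comp Ld)).
rewrite (@ae_eq_diskint _ _ (fun=> 0)).
- by rewrite /diskint /Rintegral integral0 mulr0.
- exact: L1_measurable (L2_sqr Ld).
- exact: measurable_cst.
- by apply: filterS uv => z E Dz; rewrite E//; ring.
Qed.

(* T preserves the Dirichlet norm of u - phi, which by Poincare's inequality bounds
   the L2 norm of T (u - phi). *)
Lemma isometric_extension_comp T u : isometric_extension Phi T -> H10 u ->
  ae_eq_on_disk (T u) (u \o Phi).
Proof.
move=> [[TH10 _ Tlin Tiso] TC] Hu; have [Lu _ _] := Hu.1.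
have [LTu _ _] := (TH10 _ Hu).1; have Luc := L2_comp Lu.
have Ld := L2_lin (-1) Luc LTu.
apply: ae_eq_diskint_of_sub; apply: (L2_ae_eq0 Ld).
apply/eqP; rewrite eq_le; apply/andP; split; last by apply: diskint_ge0 => z _; exact: sqr_ge0.
have [g [wg app]] := (H10P u).1 Hu.
have k0 : 0 < c^-1 by rewrite invr_gt0.
(* After splitting the square with a factor 2, c^-1 comes from the L2 bound for (u - phi) o Phi, and
   16 from Poincare's inequality for T (u - phi). *)
apply: (@le0_of_lt_eps _ _ (2 * c^-1 + 32)); first by rewrite addr_ge0// mulr_ge0// ltW.
move=> eps /app[phi [C H]].
have Hw := H10_sub_Cc Hu C; have [Lw _ _] := Hw.1.
have wgd := is_weak_grad_sub_Cc wg C.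
have HTw := TH10 _ Hw; have [LTw _ _] := HTw.1.
have Lwc := L2_comp Lw.
have -> : diskint (fun z => (-1 * (u \o Phi) z + T u z) ^+ 2) =
    diskint (fun z => (-1 * ((u \- phi) \o Phi) z + T (u \- phi) z) ^+ 2).
  (* The shape required by the linearity clause of [linear_isometry]: [T u] splits almost
     everywhere, and [T phi] is known. *)
  have uE : u = 1 \*o (u \- phi) \+ phi.
    by apply/funext => z /=; rewrite mul1r subrK.
  have := Tlin 1 _ _ Hw (Cc_H10 C); rewrite -uE => Tu.
  apply: ae_eq_diskint.
  - exact: L1_measurable (L2_sqr Ld).
  - exact: L1_measurable (L2_sqr (L2_lin (-1) Lwc LTw)).
  - apply: filterS2 Tu (TC _ C) => z Tu Tphi Dz.
    by rewrite (Tu Dz) /= (Tphi Dz) /=; ring.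
have TwE : diskint (fun z => dot (weak_grad (T (u \- phi)) z) (weak_grad (T (u \- phi)) z)) =
    diskint (fun z => dot (g z - grad phi z) (g z - grad phi z)).
  rewrite -(diskint_dot_weak_grad wgd wgd).
  have := Tiso _ _ Hw Hw; rewrite /dirichlet_weak.
  apply: mulfI; rewrite invr_neq0// mulf_neq0// gt_eqF//; exact: pi_gt0.
have P := H10_poincare HTw (H1_weak_grad HTw.1); rewrite TwE in P.
have Q := diskint_sqr_comp Lw.
have Lwc' : L2_disk (fun z => -1 * ((u \- phi) \o Phi) z).
  by have := L2_lin (-1) Lwc (L2_cst 0); congr L2_disk; apply/funext => z /=; rewrite addr0.
apply: (le_trans (diskint_sqrD Lwc' LTw)).
have -> : diskint (fun z => (-1 * ((u \- phi) \o Phi) z) ^+ 2) =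
    diskint (fun z => ((u \- phi) \o Phi) z ^+ 2).
  by apply: eq_diskint => z _; rewrite mulN1r sqrrN.
have W0 : 0 <= diskint (fun z => (u \- phi) z ^+ 2) by apply: diskint_ge0 => z _; exact: sqr_ge0.
have G0 : 0 <= diskint (fun z => dot (g z - grad phi z) (g z - grad phi z)).
  by apply: diskint_ge0 => z _; exact: dot_ge0.
move: H; rewrite /H1_sqnorm; move: P Q W0 G0 k0.
move: (diskint (fun z => T (u \- phi) z ^+ 2)) (diskint (fun z => dot _ _))
  (diskint (fun z => ((u \- phi) \o Phi) z ^+ 2)) (diskint (fun z => (u \- phi) z ^+ 2)) c^-1.
move=> x G y W k P Q W0 G0 k0 H.
have H1 : k * W <= k * eps by rewrite ler_wpM2l ?(ltW k0)//; lra.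
rewrite (_ : (2 * k + 32) * eps = 2 * (k * eps) + 32 * eps); last by ring.
move: H1 P Q G0 W0 H {k0}; move: (k * W) (k * eps) => kW keps; lra.
Qed.

Lemma isometric_extension_pullback : isometric_extension Phi (fun u => u \o Phi).
Proof.
split; last by move=> phi _; exact: ae_eq_refl.
split.
- by move=> u /H10_comp_weak_grad[].
- by move=> u v [[Lu _ _] _] [[Lv _ _] _]; exact: ae_eq_comp.
- by move=> a u v _ _; exact: ae_eq_refl.
- exact: dirichlet_weak_comp.
Qed.

Lemma linear_isometry_pullback :
  linear_isometry (@Cc_infty R) (@eq_on_disk R) (@dirichlet R) (fun phi => phi \o Phi).
Proof.
split; [exact: Cc_comp| |by []|exact: dirichlet_comp].
by move=> u v _ _ uv z Dz; apply: uv; exact: PhiD.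
Qed.

End Pullback.

(** Extension by density is expressed as existence together with uniqueness up to almost everywhere
    equality; the witness is composition with [Phi] itself. *)
Theorem mainTheorem4 (R : realType) (Phi : (R * R)%type -> (R * R)%type)
    (hPhi : poincare_isometry Phi) :
  (forall phi psi : (R * R)%type -> R, Cc_infty phi -> Cc_infty psi ->
     Cc_infty (phi \o Phi) /\ Cc_infty (psi \o Phi) /\
     dirichlet (phi \o Phi) (psi \o Phi) = dirichlet phi psi) /\
  linear_isometry (@Cc_infty R) (@eq_on_disk R) (@dirichlet R)
    (fun phi => phi \o Phi) /\
  (exists T : ((R * R)%type -> R) -> ((R * R)%type -> R),
     isometric_extension Phi T /\
     (forall T', isometric_extension Phi T' ->
        forall u, H10 u -> ae_eq_on_disk (T' u) (T u)) /\
     (forall u, H10 u -> ae_eq_on_disk (T u) (u \o Phi))).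
Proof.
have [[PhiD sPhi [Psi [PsiD sPsi PhiK PsiK]]] isoPhi] := hPhi.
have LI := linear_isometry_pullback PhiD PsiD sPhi sPsi PhiK PsiK isoPhi.
split; first by move=> phi psi C1 C2; have [H _ _ D] := LI; split; [exact: H|split; [exact: H|exact: D]].
split => //; exists (fun u => u \o Phi); split; last split.
- exact: (isometric_extension_pullback PhiD PsiD sPhi sPsi PhiK PsiK isoPhi).
- move=> T' HT' u Hu.
  exact: (isometric_extension_comp PhiD PsiD sPhi sPsi PhiK PsiK isoPhi HT' Hu).
- by move=> u _; exact: ae_eq_refl.
Qed.
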